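(* Let $\mathcal{S},\mathcal{T}$ be operator systems that are $\Delta$-equivalent, and let $\mathcal{F}:\mathrm{Hmod}(\mathcal{S})\to\mathrm{Hmod}(\mathcal{T})$ and $\mathcal{G}:\mathrm{Hmod}(\mathcal{T})\to\mathrm{Hmod}(\mathcal{S})$ be the functors induced by a TRO $\mathcal{M}$ implementing the equivalence and by its adjoint $\mathcal{M}^*$, respectively, as defined in the context. Then, up to natural equivalence, $\mathcal{G}\circ\mathcal{F}\cong\mathrm{Id}_{\mathrm{Hmod}(\mathcal{S})}$ and $\mathcal{F}\circ\mathcal{G}\cong\mathrm{Id}_{\mathrm{Hmod}(\mathcal{T})}$. In particular, the categories $\mathrm{Hmod}(\mathcal{S})$ and $\mathrm{Hmod}(\mathcal{T})$ are equivalent through completely contractive functors.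
   Context: An operator system is a (not necessarily closed) selfadjoint subspace of some $\mathcal{B}(H)$ containing $I_H$. $[\,\cdot\,]$ is norm-closed linear span. A TRO is a linear subspace $\mathcal{M}\subseteq\mathcal{B}(H,K)$ with $\mathcal{M}\mathcal{M}^*\mathcal{M}\subseteq\mathcal{M}$; it is non-degenerate if $I_H\in[\mathcal{M}^*\mathcal{M}]$ and $I_K\in[\mathcal{M}\mathcal{M}^*]$. Concrete operator systems $\mathcal{S}\subseteq\mathcal{B}(H)$, $\mathcal{T}\subseteq\mathcal{B}(K)$ are TRO-equivalent via $\mathcal{M}$ if $\mathcal{M}\subseteq\mathcal{B}(H,K)$ is a non-degenerate TRO with $\mathcal{M}^*\mathcal{T}\mathcal{M}\subseteq\overline{\mathcal{S}}$, $\mathcal{M}\mathcal{S}\mathcal{M}^*\subseteq\overline{\mathcal{T}}$ (norm closures). Operator systems are $\Delta$-equivalent if they have unital complete order embeddings with TRO-equivalent images. $\mathcal{I}(\mathcal{S})$ is the injective envelope of $\mathcal{S}$ with its C*-algebra structure, $\mathcal{S}\subseteq\mathrm{C}^*_{\rm env}(\mathcal{S})\subseteq\mathcal{I}(\mathcal{S})$ with $\mathrm{C}^*_{\rm env}(\mathcal{S})$ the C*-envelope, and the multiplier C*-algebra of $\mathcal{S}$ is $\mathcal{A}_{\mathcal{S}}=\{a\in\mathcal{I}(\mathcal{S}):a\mathcal{S}\subseteq\mathcal{S},\ a^*\mathcal{S}\subseteq\mathcal{S}\}$, considered as contained in $\mathcal{S}$. The category $\mathrm{Hmod}(\mathcal{S})$.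 A C*-representation of $\mathcal{S}$ is a pair $(H,\phi)$ with $\phi:\mathcal{S}\to\mathcal{B}(H)$ a unital completely positive map whose restriction to $\mathcal{A}_{\mathcal{S}}$ is a *-homomorphism. Objects are unitary equivalence classes of C*-representations, identified with representatives ($(H_1,\phi_1)$, $(H_2,\phi_2)$ are unitarily equivalent if $U\phi_1(s)=\phi_2(s)U$ for all $s\in\mathcal{S}$, for some unitary $U:H_1\to H_2$). Morphisms from $(H_1,\phi_1)$ to $(H_2,\phi_2)$ are the operators $T\in\mathcal{B}(H_1,H_2)$ with $T\phi_1(s)=\phi_2(s)T$ for all $s\in\mathcal{S}$. A functor is completely contractive if the induced maps between the spaces of morphisms (operator subspaces of $\mathcal{B}(H_1,H_2)$) are completely contractive. The functors. Given $\Delta$-equivalent $\mathcal{S},\mathcal{T}$, take complete order embeddings of $\mathcal{S}$ and $\mathcal{T}$, with images generating copies of their C*-envelopes, and a non-degenerate TRO $\mathcal{M}$ such that (identifying $\mathcal{S},\mathcal{T}$ with their images) $\mathcal{S}$ and $\mathcal{T}$ are TRO-equivalent via $\mathcal{M}$, $\mathcal{A}_{\mathcal{S}}=[\mathcal{M}^*\mathcal{M}]$ and $\mathcal{A}_{\mathcal{T}}=[\mathcal{M}\mathcal{M}^*]$; fix such data. For an object $(H,\phi)$ of $\mathrm{Hmod}(\mathcal{S})$ let $K$ be the Hilbert space completion (after quotienting by null vectors) of $\mathcal{M}\otimes_{\mathcal{A}_{\mathcal{S}}}H$ with respect to $\langle a\otimes\xi,b\otimes\eta\rangle=\langle\phi(b^*a)\xi,\eta\rangle$,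 let $\psi:\mathcal{T}\to\mathcal{B}(K)$ be determined by $\langle\psi(t)(a\otimes\xi),b\otimes\eta\rangle=\langle\phi(b^*\cdot t\cdot a)\xi,\eta\rangle$, and $\mathcal{F}((H,\phi))=(K,\psi)$. For a morphism $T$ from $(H_1,\phi_1)$ to $(H_2,\phi_2)$, $\mathcal{F}(T):K_1\to K_2$ is the bounded operator determined by $\mathcal{F}(T)(m\otimes\xi)=m\otimes T\xi$, $m\in\mathcal{M}$, $\xi\in H_1$. The functor $\mathcal{G}$ is defined in the same way with $\mathcal{M}^*$ in place of $\mathcal{M}$ and the roles of $\mathcal{S},\mathcal{T}$ exchanged. *)

(* Defs.v *)
From HB Require Import structures.
From mathcomp Require Import all_boot all_order all_algebra.
From mathcomp Require Import complex.
From mathcomp Require Import boolp classical_sets functions reals.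
From mathcomp Require Import topology normedtype sequences.

Set Implicit Arguments.
Unset Strict Implicit.
Unset Printing Implicit Defensive.

Import Order.TTheory GRing.Theory Num.Theory.
Import numFieldNormedType.Exports.

Local Open Scope classical_set_scope.
Local Open Scope ring_scope.
Local Open Scope complex_scope.

(* The inner product is linear in its first argument.  The norm of a normed
   module over R[i] takes its values in R[i]. *)
HB.mixin Record isHilbert (R : realType) H & CompleteNormedModule R[i] H := {
  dot : H -> H -> R[i];
  dotP : forall (a : R[i]) (x y z : H),
    dot (a *: x + y) z = a * dot x z + dot y z;
  dotC : forall x y : H, dot x y = (dot y x)^*;
  dot_norm : forall x : H, dot x x = `|x| ^+ 2
}.

#[short(type="hilbertType")]
HB.structure Definition Hilbert (R : realType) :=
  {H of CompleteNormedModule R[i] H & isHilbert R H}.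

Lemma Re_normK (R : realType) (V : normedModType R[i]) (x : V) :
  (complex.Re `|x|)%:C = `|x|.
Proof. by apply: RRe_real; exact: ger0_real (normr_ge0 x). Qed.

Lemma Re_norm_ge0 (R : realType) (V : normedModType R[i]) (x : V) :
  0 <= complex.Re `|x|.
Proof. by have := normr_ge0 x; rewrite -Re_normK lecR. Qed.

Section BoundedOperators.
Variables (R : realType) (H K : hilbertType R).

Definition bounded_linear : {pred H -> K} :=
  [pred f : H -> K | `[< linear f /\
     exists c : R, 0 <= c /\ forall x, `|f x| <= c%:C * `|x| >]].

Lemma bounded_linearP (f : H -> K) :
  reflect (linear f /\ exists c : R, 0 <= c /\ forall x, `|f x| <= c%:C * `|x|)
    (f \in bounded_linear).
Proof. by rewrite inE; exact: asboolP. Qed.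

Record bop := Bop { bval :> H -> K; _ : bval \in bounded_linear }.

HB.instance Definition _ := [isSub for bval].
HB.instance Definition _ := [Choice of bop by <:].

Fact bounded_linear_submod : submod_closed bounded_linear.
Proof.
split=> [|a f g /bounded_linearP[lf [c [c0 cf]]] /bounded_linearP[lg [d [d0 dg]]]].
  apply/bounded_linearP; split=> [b x y|]; first by rewrite [RHS]addr0 scaler0.
  by exists 0; split=> // x; rewrite normr0 mul0r.
apply/bounded_linearP; split=> [b x y|].
  change (a *: f (b *: x + y) + g (b *: x + y) =
    b *: (a *: f x + g x) + (a *: f y + g y)).
  rewrite lf lg !scalerDr !scalerA (mulrC b) -!addrA; congr (_ + _).
  by rewrite addrCA.
exists (complex.Re `|a| * c + d).
have na : `|a| = (complex.Re `|a|)%:C by rewrite RRe_real// ger0_real.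
have na0 : 0 <= complex.Re `|a| by have := normr_ge0 a; rewrite na lecR.
split=> [|x]; first by rewrite addr_ge0// mulr_ge0.
rewrite rmorphD rmorphM/= -na mulrDl (le_trans (ler_normD _ _))//.
by rewrite lerD// normrZ -mulrA ler_wpM2l.
Qed.

HB.instance Definition _ :=
  GRing.isSubmodClosed.Build R[i] (H -> K) bounded_linear bounded_linear_submod.
HB.instance Definition _ := [SubChoice_isSubLmodule of bop by <:].

Lemma bopP (S T : bop) : (forall x, S x = T x) -> S = T.
Proof. by move=> ST; apply/val_inj/funext. Qed.

Lemma bop_linear (T : bop) : linear T.
Proof. by case: T => f /= /bounded_linearP[]. Qed.

Lemma bop_bounded (T : bop) :
  exists c : R, 0 <= c /\ forall x, `|T x| <= c%:C * `|x|.
Proof. by case: T => f /= /bounded_linearP[]. Qed.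

Lemma bop0 (T : bop) : T 0 = 0.
Proof. by have := bop_linear T (-1) 0 0; rewrite scaler0 addr0 scaleN1r addNr. Qed.

Definition opbounds (T : bop) : set R :=
  [set c : R | 0 <= c /\ forall x, `|T x| <= c%:C * `|x|].

Definition opnorm (T : bop) : R := inf (opbounds T).

Lemma opnorm_le (T : bop) c : opbounds T c -> opnorm T <= c.
Proof. by move=> Tc; apply: ge_inf => //; exists 0 => d []. Qed.

Lemma opnorm_ge0 (T : bop) : 0 <= opnorm T.
Proof.
by apply: lb_le_inf => [|c []//]; have [c] := bop_bounded T; exists c.
Qed.

Lemma opnormP (T : bop) x : `|T x| <= (opnorm T)%:C * `|x|.
Proof.
have [->|x0] := eqVneq x 0; first by rewrite bop0 !normr0 mulr0.
have nx0 : 0 < complex.Re `|x| by rewrite -ltcR Re_normK normr_gt0.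
rewrite -(Re_normK x) -(Re_normK (T x)) -rmorphM/= lecR -ler_pdivrMr//.
apply: lb_le_inf => [|c [_ /(_ x)]]; first by have [c] := bop_bounded T; exists c.
by rewrite -(Re_normK x) -(Re_normK (T x)) -rmorphM/= lecR ler_pdivrMr.
Qed.

Lemma opboundsP (T : bop) : opbounds T (opnorm T).
Proof. by split; [exact: opnorm_ge0|exact: opnormP]. Qed.

Fact opnormD (S T : bop) : (opnorm (S + T))%:C <= (opnorm S)%:C + (opnorm T)%:C.
Proof.
rewrite -rmorphD/= lecR; apply: opnorm_le; split=> [|x].
  by rewrite addr_ge0// opnorm_ge0.
by rewrite rmorphD/= mulrDl (le_trans (ler_normD _ _))// lerD// opnormP.
Qed.

Fact opnormZ (a : R[i]) (T : bop) : (opnorm (a *: T))%:C = `|a| * (opnorm T)%:C.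
Proof.
have le (b : R[i]) (S : bop) : (opnorm (b *: S))%:C <= `|b| * (opnorm S)%:C.
  have nb : `|b| = (complex.Re `|b|)%:C by rewrite RRe_real// ger0_real.
  have nb0 : 0 <= complex.Re `|b| by have := normr_ge0 b; rewrite nb lecR.
  rewrite nb -rmorphM/= lecR; apply: opnorm_le; split=> [|x].
    by rewrite mulr_ge0// opnorm_ge0.
  rewrite (_ : (b *: S) x = b *: S x)// normrZ rmorphM/= -nb -mulrA.
  by rewrite ler_wpM2l// opnormP.
apply/eqP; rewrite eq_le le/=.
have [->|a0] := eqVneq a 0; first by rewrite normr0 mul0r lecR opnorm_ge0.
have := le a^-1 (a *: T); rewrite scalerA mulVf// scale1r normfV.
by rewrite ler_pdivlMl// normr_gt0.
Qed.

Fact opnorm0_eq0 (T : bop) : (opnorm T)%:C = 0 -> T = 0.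
Proof.
move=> T0; apply: bopP => x; apply/eqP; rewrite -normr_le0.
by rewrite (le_trans (opnormP T x))// T0 mul0r.
Qed.

HB.instance Definition _ := @Lmodule_isNormed.Build R[i] bop
  (fun T => (opnorm T)%:C) opnormD opnormZ opnorm0_eq0.

End BoundedOperators.

Section OperatorAlgebra.
Variable R : realType.
Implicit Types H K L : hilbertType R.

Fact id_bounded_linear H : (@idfun H : H -> H) \in @bounded_linear R H H.
Proof.
by apply/bounded_linearP; split=> //; exists 1; split=> // x; rewrite mul1r.
Qed.

Definition bid H : bop H H := Bop (@id_bounded_linear H).

Fact comp_bounded_linear H K L (T : bop K L) (S : bop H K) :
  (fun x => T (S x)) \in @bounded_linear R H L.
Proof.
apply/bounded_linearP; split=> [a x y|]; first by rewrite !bop_linear.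
have [c [c0 cT]] := bop_bounded T; have [d [d0 dS]] := bop_bounded S.
exists (c * d); split=> [|x]; first exact: mulr_ge0.
by rewrite (le_trans (cT _))// rmorphM/= -mulrA ler_wpM2l// lecR.
Qed.

Definition bcomp H K L (T : bop K L) (S : bop H K) : bop H L :=
  Bop (comp_bounded_linear T S).

(* By the Riesz representation theorem the set below is a singleton, so the
   default value 0 is never taken. *)
Definition adj H K (T : bop H K) : bop K H :=
  xget 0 [set T' : bop K H | forall x y, dot (T x) y = dot x (T' y)].

End OperatorAlgebra.

Notation "T *o S" := (bcomp T S) (at level 40, left associativity) : ring_scope.

Section Subspaces.
Variable R : realType.
Implicit Types V W : normedModType R[i].

Definition subspace V (X : set V) : Prop :=
  X 0 /\ forall (a : R[i]) x y, X x -> X y -> X (a *: x + y).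

Definition clspan V (X : set V) : set V := closure (smallest (@subspace V) X).

(* Maps whose domain is a subspace X of V are represented by total functions
   on V; only their values on X matter. *)
Definition linear_on V W (X : set V) (f : V -> W) : Prop :=
  forall (a : R[i]) x y, X x -> X y -> f (a *: x + y) = a *: f x + f y.

End Subspaces.

Section OperatorSystems.
Variable R : realType.
Implicit Types H K L : hilbertType R.

Definition operator_system H (S : set (bop H H)) : Prop :=
  [/\ subspace S, forall s, S s -> S (adj s) & S (bid H)].

(* Positivity of the operator [X i j] on the n-fold direct sum of H.  In R[i],
   0 <= z means that z is real and nonnegative. *)
Definition mxpos H n (X : 'M[bop H H]_n) : Prop :=
  forall xi : 'I_n -> H, 0 <= \sum_i \sum_j dot (X i j (xi j)) (xi i).

Definition completely_positive H K (S : set (bop H H))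
    (f : bop H H -> bop K K) : Prop :=
  forall n (X : 'M[bop H H]_n),
    (forall i j, S (X i j)) -> mxpos X -> mxpos (map_mx f X).

Definition ucp H K (S : set (bop H H)) (f : bop H H -> bop K K) : Prop :=
  [/\ linear_on S f, f (bid H) = bid K & completely_positive S f].

Definition unital_complete_order_embedding H K (S : set (bop H H))
    (f : bop H H -> bop K K) : Prop :=
  [/\ linear_on S f, f (bid H) = bid K, set_inj S f &
      forall n (X : 'M[bop H H]_n), (forall i j, S (X i j)) ->
        (mxpos X <-> mxpos (map_mx f X))].

Definition injective_system L (J : set (bop L L)) : Prop :=
  forall H (E F : set (bop H H)) (f : bop H H -> bop L L),
    operator_system E -> operator_system F -> E `<=` F ->
    ucp E f -> f @` E `<=` J ->
    exists g : bop H H -> bop L L,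
      [/\ ucp F g, g @` F `<=` J & {in E, g =1 f}].

Definition cstar_algebra H (A : set (bop H H)) : Prop :=
  [/\ operator_system A, closed A & forall a b, A a -> A b -> A (a *o b)].

Definition cstar_generated H (X : set (bop H H)) : set (bop H H) :=
  smallest (@cstar_algebra H) X.

Definition star_isomorphism H K (A : set (bop H H)) (B : set (bop K K))
    (f : bop H H -> bop K K) : Prop :=
  [/\ linear_on A f, forall a b, A a -> A b -> f (a *o b) = f a *o f b,
      forall a, A a -> f (adj a) = adj (f a) & set_bij A B f].

End OperatorSystems.

Record opsys (R : realType) := Opsys {
  os_space : hilbertType R;
  os_set :> set (bop os_space os_space);
  os_axiom : operator_system os_set
}.

Arguments os_set {R} o _.

Section TRO.
Variables (R : realType) (H K : hilbertType R).
Implicit Types M : set (bop H K).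

Definition TRO M : Prop :=
  subspace M /\ forall a b c, M a -> M b -> M c -> M (a *o adj b *o c).

Definition lprod M : set (bop H H) := clspan [set adj a *o b | a in M & b in M].

Definition rprod M : set (bop K K) := clspan [set a *o adj b | a in M & b in M].

Definition nondegenerate M : Prop := lprod M (bid H) /\ rprod M (bid K).

Definition TRO_equivalent_via (S : set (bop H H)) (T : set (bop K K)) M : Prop :=
  [/\ TRO M, nondegenerate M,
      forall a t b, M a -> T t -> M b -> closure S (adj a *o t *o b) &
      forall a s b, M a -> S s -> M b -> closure T (a *o s *o adj b)].

End TRO.

Definition Delta_equivalent (R : realType) (S T : opsys R) : Prop :=
  exists (H K : hilbertType R)
    (f : bop (os_space S) (os_space S) -> bop H H)
    (g : bop (os_space T) (os_space T) -> bop K K) (M : set (bop H K)),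
    [/\ unital_complete_order_embedding S f,
        unital_complete_order_embedding T g &
        TRO_equivalent_via (f @` S) (g @` T) M].

(* An injective operator system is unitally completely order isomorphic to a
   C*-algebra, which we take to be concretely represented. *)
Record injective_envelope (R : realType) (S : opsys R) := InjectiveEnvelope {
  ie_space : hilbertType R;
  ie_alg : set (bop ie_space ie_space);
  ie_emb : bop (os_space S) (os_space S) -> bop ie_space ie_space;
  ie_cstar : cstar_algebra ie_alg;
  ie_embP : unital_complete_order_embedding S ie_emb;
  ie_sub : ie_emb @` S `<=` ie_alg;
  ie_injective : injective_system ie_alg;
  ie_minimal : forall J : set (bop ie_space ie_space),
    operator_system J -> ie_emb @` S `<=` J -> J `<=` ie_alg ->
    injective_system J -> J = ie_alg
}.

Arguments ie_alg {R S} i _.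
Arguments ie_emb {R S} i _.

Section Envelopes.
Variables (R : realType) (S : opsys R) (I : injective_envelope S).

Definition cstar_envelope : set (bop (ie_space I) (ie_space I)) :=
  cstar_generated (ie_emb I @` S).

Definition multiplier_algebra : set (bop (ie_space I) (ie_space I)) :=
  [set a | ie_alg I a /\ forall s, os_set S s ->
    (ie_emb I @` S) (a *o ie_emb I s) /\
    (ie_emb I @` S) (adj a *o ie_emb I s)].

(* The multiplier algebra, considered as contained in S. *)
Definition multipliers : set (bop (os_space S) (os_space S)) :=
  [set s | os_set S s /\ multiplier_algebra (ie_emb I s)].

Definition generates_cstar_envelope (H : hilbertType R)
    (f : bop (os_space S) (os_space S) -> bop H H) : Prop :=
  exists g : bop H H -> bop (ie_space I) (ie_space I),
    star_isomorphism (cstar_generated (f @` S)) cstar_envelope g /\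
    forall s, os_set S s -> g (f s) = ie_emb I s.

End Envelopes.

Record category := Category {
  ob :> Type;
  hom : ob -> ob -> Type;
  idm : forall X, hom X X;
  compm : forall X Y Z, hom Y Z -> hom X Y -> hom X Z;
  compmA : forall W X Y Z (h : hom Y Z) (g : hom X Y) (f : hom W X),
    compm h (compm g f) = compm (compm h g) f;
  compm1 : forall X Y (f : hom X Y), compm f (idm X) = f;
  comp1m : forall X Y (f : hom X Y), compm (idm Y) f = f
}.

Arguments idm {c} X.

Record functor (C D : category) := Functor {
  fob :> C -> D;
  fmor : forall X Y, hom X Y -> hom (fob X) (fob Y);
  fmor1 : forall X, fmor (idm X) = idm (fob X);
  fmorM : forall X Y Z (g : hom Y Z) (f : hom X Y),
    fmor (compm g f) = compm (fmor g) (fmor f)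
}.

Definition functor_id (C : category) : functor C C :=
  @Functor C C id (fun _ _ f => f) (fun _ => erefl) (fun _ _ _ _ _ => erefl).

Fact functor_comp1 (C D E : category) (G : functor D E) (F : functor C D) X :
  fmor G (fmor F (idm X)) = idm (G (F X)).
Proof. by rewrite !fmor1. Qed.

Fact functor_compM (C D E : category) (G : functor D E) (F : functor C D)
    X Y Z (g : hom Y Z) (f : hom X Y) :
  fmor G (fmor F (compm g f)) = compm (fmor G (fmor F g)) (fmor G (fmor F f)).
Proof. by rewrite !fmorM. Qed.

Definition functor_comp (C D E : category) (G : functor D E) (F : functor C D) :
    functor C E :=
  @Functor C E (fun X => G (F X)) (fun _ _ f => fmor G (fmor F f))
    (functor_comp1 G F) (functor_compM G F).

Definition naturally_equivalent (C D : category) (F G : functor C D) : Prop :=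
  exists (eta : forall X, hom (F X) (G X)) (theta : forall X, hom (G X) (F X)),
    (forall X, compm (theta X) (eta X) = idm (F X) /\
               compm (eta X) (theta X) = idm (G X)) /\
    (forall X Y (f : hom X Y),
       compm (eta Y) (fmor F f) = compm (fmor G f) (eta X)).

Section Hmod.
Variables (R : realType) (S : opsys R) (I : injective_envelope S).

Record crep := Crep {
  rep_space :> hilbertType R;
  rep_map : bop (os_space S) (os_space S) -> bop rep_space rep_space;
  rep_ucp : ucp S rep_map;
  (* rep_map is a *-homomorphism on the multiplier algebra, whose product and
     involution are those of the injective envelope *)
  rep_mul : forall a b c, multipliers I a -> multipliers I b ->
    multipliers I c -> ie_emb I c = ie_emb I a *o ie_emb I b ->
    rep_map c = rep_map a *o rep_map b;
  rep_adj : forall a c, multipliers I a -> multipliers I c ->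
    ie_emb I c = adj (ie_emb I a) -> rep_map c = adj (rep_map a)
}.

Record intertwiner (X Y : crep) := Intertwiner {
  ival :> bop X Y;
  ivalP : forall s, os_set S s -> ival *o rep_map X s = rep_map Y s *o ival
}.

Lemma intertwiner_inj X Y (f g : intertwiner X Y) :
  (forall x, f x = g x) -> f = g.
Proof.
case: f g => [f Pf] [g Pg] /= /bopP fg; rewrite -fg in Pg *.
by congr Intertwiner; exact: Prop_irrelevance.
Qed.

Fact id_intertwiner (X : crep) s :
  os_set S s -> bid X *o rep_map X s = rep_map X s *o bid X.
Proof. by move=> _; apply: bopP. Qed.

Fact comp_intertwiner (X Y Z : crep) (g : intertwiner Y Z) (f : intertwiner X Y)
    s : os_set S s -> (g *o f) *o rep_map X s = rep_map Z s *o (g *o f).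
Proof.
move=> Ss; apply: bopP => x /=.
have /(congr1 (fun h => bval h x))/= -> := ivalP f Ss.
by have /(congr1 (fun h => bval h (f x)))/= -> := ivalP g Ss.
Qed.

Definition Hmod : category.
Proof.
refine (@Category crep intertwiner (fun X => Intertwiner (@id_intertwiner X))
  (fun X Y Z g f => Intertwiner (comp_intertwiner g f)) _ _ _);
  by move=> *; exact: intertwiner_inj.
Defined.

End Hmod.

(* The norm of [X i j] as an operator between n-fold direct sums. *)
Definition mxopnorm (R : realType) (H K : hilbertType R) n
    (X : 'I_n -> 'I_n -> bop H K) : R :=
  inf [set c : R | 0 <= c /\ forall xi : 'I_n -> H,
    \sum_i `|\sum_j X i j (xi j)| ^+ 2 <= (c ^+ 2)%:C * \sum_j `|xi j| ^+ 2].

Section CompletelyContractive.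
Variables (R : realType) (S T : opsys R).
Variables (I : injective_envelope S) (J : injective_envelope T).

Definition completely_contractive (F : functor (Hmod I) (Hmod J)) : Prop :=
  forall X Y : crep I,
    (forall (a : R[i]) (f g h : intertwiner X Y),
       ival h = a *: ival f + ival g ->
       ival (fmor F h) = a *: ival (fmor F f) + ival (fmor F g)) /\
    (forall n (f : 'I_n -> 'I_n -> intertwiner X Y),
       mxopnorm (fun i j => ival (fmor F (f i j)))
         <= mxopnorm (fun i j => ival (f i j))).

End CompletelyContractive.

Definition completely_contractively_equivalent (R : realType) (S T : opsys R)
    (I : injective_envelope S) (J : injective_envelope T) : Prop :=
  exists (F : functor (Hmod I) (Hmod J)) (G : functor (Hmod J) (Hmod I)),
    [/\ completely_contractive F, completely_contractive G,
        naturally_equivalent (functor_comp G F) (functor_id (Hmod I)) &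
        naturally_equivalent (functor_comp F G) (functor_id (Hmod J))].

(* The Hilbert spaces, embeddings and TRO from which the two functors are
   built; md_lprod and md_rprod identify the multiplier algebras with [M^* M]
   and [M M^* ]. *)
Record morita_data (R : realType) (S T : opsys R)
    (I : injective_envelope S) (J : injective_envelope T) := MoritaData {
  md_H : hilbertType R;
  md_K : hilbertType R;
  md_S : bop (os_space S) (os_space S) -> bop md_H md_H;
  md_T : bop (os_space T) (os_space T) -> bop md_K md_K;
  md_M : set (bop md_H md_K);
  md_SP : unital_complete_order_embedding (os_set S) md_S;
  md_TP : unital_complete_order_embedding (os_set T) md_T;
  md_S_env : generates_cstar_envelope I md_S;
  md_T_env : generates_cstar_envelope J md_T;
  md_MP : TRO_equivalent_via (md_S @` os_set S) (md_T @` os_set T) md_M;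
  md_lprod : md_S @` multipliers I = lprod md_M;
  md_rprod : md_T @` multipliers J = rprod md_M
}.

Section InducedFunctor.
Variables (R : realType) (S T : opsys R).
Variables (I : injective_envelope S) (J : injective_envelope T).
Variables (H K : hilbertType R).
Variable f : bop (os_space S) (os_space S) -> bop H H.
Variable g : bop (os_space T) (os_space T) -> bop K K.
Variable M : set (bop H K).

(* The value at x of the continuous extension of phi to the norm closure of
   f(S), where s in S is identified with f(s). *)
Definition closure_extension (X : crep I) (x : bop H H) : bop X X :=
  xget 0 [set y : bop X X | forall u : nat -> bop (os_space S) (os_space S),
    (forall n, os_set S (u n)) ->
    f (u n) @[n --> \oo] --> x -> rep_map X (u n) @[n --> \oo] --> y].

(* Y is the completion of the tensor product of M and X over the multiplier
   algebra of S, with its representation of T; [tau a xi] is the class of the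
   elementary tensor of a and xi.  The balancing condition is restricted to
   those s with a f(s) in M because M need not be norm closed. *)
Record induced_object (X : crep I) (Y : crep J) (tau : bop H K -> X -> Y) :
    Prop := InducedObject {
  tau_linear_l : forall (c : R[i]) a b xi, M a -> M b ->
    tau (c *: a + b) xi = c *: tau a xi + tau b xi;
  tau_linear_r : forall a, M a -> linear (tau a);
  tau_balanced : forall a s xi, M a -> multipliers I s -> M (a *o f s) ->
    tau (a *o f s) xi = tau a (rep_map X s xi);
  tau_dot : forall a b xi eta, M a -> M b ->
    dot (tau a xi) (tau b eta) = dot (closure_extension X (adj b *o a) xi) eta;
  tau_dense : clspan [set tau a xi | a in M & xi in [set: X]] = [set: Y];
  tau_rep : forall t a b xi eta, os_set T t -> M a -> M b ->
    dot (rep_map Y t (tau a xi)) (tau b eta) =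
    dot (closure_extension X (adj b *o g t *o a) xi) eta
}.

Definition induced_functor (F : functor (Hmod I) (Hmod J)) : Prop :=
  exists tau : forall X : crep I, bop H K -> X -> (F X : crep J),
    (forall X : crep I, induced_object (@tau X)) /\
    (forall (X Y : crep I) (h : intertwiner X Y) a xi, M a ->
       (fmor F h : intertwiner (F X) (F Y)) (@tau X a xi) = @tau Y a (h xi)).

End InducedFunctor.

Arguments md_S {R S T I J} m _.
Arguments md_T {R S T I J} m _.
Arguments md_M {R S T I J} m _.

Section InducedFunctors.
Variables (R : realType) (S T : opsys R).
Variables (I : injective_envelope S) (J : injective_envelope T).
Variable D : morita_data I J.

Definition induced_by_TRO (F : functor (Hmod I) (Hmod J)) : Prop :=
  induced_functor (md_S D) (md_T D) (md_M D) F.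

Definition induced_by_adjoint (G : functor (Hmod J) (Hmod I)) : Prop :=
  induced_functor (md_T D) (md_S D) [set adj m | m in md_M D] G.

End InducedFunctors.

(* Main.v *)
From HB Require Import structures.
From mathcomp Require Import all_boot all_order all_algebra.
From mathcomp Require Import complex.
From mathcomp Require Import boolp classical_sets functions reals.
From mathcomp Require Import topology normedtype sequences.
From mathcomp Require Import ring lra.
Require Import Defs.

(* Write A and B for the multiplier algebras, so A = [M^* M], B = [M M^* ].  As
   1 lies in [M M^* ], there are m_1, ..., m_n in the closure of M with
   \sum_i m_i m_i^* = 1.  Such a frame realizes the tensor product of M and X
   over A, for a C*-representation (X, phi) of S, as the range of the projection
   [phi(m_i^* m_j)] in X^n: the tensor of a and xi is (phi(m_i^* a) xi)_i, the
   action of T is t |-> [phi(m_i^* t m_j)], and a morphism h acts by diag(h).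
   No completion is taken, and the boundedness and complete positivity of the
   action and the complete contractivity of h |-> diag(h) are immediate.  The
   computations use phi(a s) = phi(a) phi(s) for a in A and s in S, as A lies in
   the multiplicative domain of phi.

   Vectors with the same Gram matrix that span dense subspaces are intertwined
   by a unitary.  This identifies any functor induced by M with the one just
   described, and identifies X with its image under the composition of the two
   functors, because the inner product of n^* (x) b (x) eta with m^* (x) a (x) xi
   equals that of phi(n^* b) eta with phi(m^* a) xi.  The other composition
   follows by exchanging S and T and replacing M by M^*. *)

Set Implicit Arguments.
Unset Strict Implicit.
Unset Printing Implicit Defensive.

Import Order.TTheory GRing.Theory Num.Theory.
Import numFieldNormedType.Exports.

Local Open Scope classical_set_scope.
Local Open Scope ring_scope.
Local Open Scope complex_scope.

(** The frame has to sum to 1 exactly, since otherwise [phi(m_i^* m_j)] is not idempotent. It can be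
    finite because 1 is a norm limit of finite sums \sum_i a_i b_i^*, one of which lies within 1/2
    of it; correcting the error takes a limit, so the m_i lie in the closure of M only.

    As M and S need not be closed, the products m_i^* t m_j lie in the closure of S. The
    computations therefore use the continuous extension of phi to that closure, whose complete
    positivity has to be recovered: a positive matrix over the closure must be approximated by
    positive matrices over S.

    The statement concerns all functors that satisfy the defining relations, not a chosen model.
    Hence complete contractivity, clear for diag(h), has to be carried over by unitaries natural in
    the representation. The identity A = [M^* M] makes phi multiplicative on the products m_i^* m_j;
    the identity B = [M M^* ] makes the new representation multiplicative on B, because [M M^* ]
    maps the closure of M into itself. *)

Section ComplexModulus.
Variable R : realType.
Implicit Types a b : R[i].

(** Real-valued, so that [lra] and [nra] can treat moduli as atoms. *)
Definition cm a : R := complex.Re `|a|.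

Lemma cmE a : `|a| = (cm a)%:C.
Proof. by rewrite /cm RRe_real// normr_real. Qed.

Lemma cm_ge0 a : 0 <= cm a.
Proof. by have := normr_ge0 a; rewrite cmE ler0c. Qed.

Lemma cmM a b : cm (a * b) = cm a * cm b.
Proof. by apply: complexI; rewrite -cmE normrM !cmE -rmorphM. Qed.

Lemma cmD a b : cm (a + b) <= cm a + cm b.
Proof. by have := ler_normD a b; rewrite !cmE -rmorphD lecR. Qed.

Lemma cmN a : cm (- a) = cm a. Proof. by rewrite /cm normrN. Qed.

Lemma cm_real (r : R) : cm r%:C = `|r|.
Proof. by rewrite /cm normc_def/= expr0n/= addr0 sqrtr_sqr. Qed.

Lemma cm_natV (n : nat) : cm (n%:R^-1 : R[i]) = n%:R^-1.
Proof.
rewrite -(rmorph_nat (real_complex R)) -fmorphV/= cm_real.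
by rewrite ger0_norm// invr_ge0.
Qed.

Lemma cm0 : cm 0 = 0. Proof. by rewrite /cm normr0. Qed.

Lemma cm_eq0 a : cm a = 0 -> a = 0.
Proof. by move=> a0; apply: normr0_eq0; rewrite cmE a0. Qed.

Lemma cm_le0 a : (forall e : R, 0 < e -> cm a <= e) -> a = 0.
Proof.
move=> ae; apply/cm_eq0/le_anti; rewrite cm_ge0 andbT.
by apply/ler_addgt0Pl => e /ae; rewrite addr0.
Qed.

Lemma ler_Re_cm a : complex.Re a <= cm a.
Proof.
have := normc_ge_Re a; rewrite cmE lecR; apply: le_trans; exact: ler_norm.
Qed.

Lemma ler_normRe_cm a : `|complex.Re a| <= cm a.
Proof. by have := normc_ge_Re a; rewrite cmE lecR. Qed.

Lemma ler_nRe_cm a : - complex.Re a <= cm a.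
Proof. by have := ler_Re_cm (- a); rewrite cmN raddfN. Qed.

Lemma mul_conjc a : a * conjc a = (cm a ^+ 2)%:C.
Proof. by rewrite -sqr_normc cmE rmorphXn. Qed.

Lemma conjcM a b : conjc (a * b) = conjc a * conjc b.
Proof. exact: (rmorphM (@conjc R)). Qed.

Lemma conjcD a b : conjc (a + b) = conjc a + conjc b.
Proof. exact: (raddfD (@conjc R)). Qed.

Lemma conjcN a : conjc (- a) = - conjc a.
Proof. exact: (raddfN (@conjc R)). Qed.

Lemma ReD a b : complex.Re (a + b) = complex.Re a + complex.Re b.
Proof. by case: a b => [? ?] []. Qed.

Lemma ReN a : complex.Re (- a) = - complex.Re a.
Proof. by case: a. Qed.

Lemma ReJ a : complex.Re (conjc a) = complex.Re a.
Proof. by case: a. Qed.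

Lemma ReZ (r : R) a : complex.Re (r%:C * a) = r * complex.Re a.
Proof. by case: a => x y /=; rewrite mul0r subr0. Qed.

Lemma mul2C (r : R) : (2 * r)%:C = 2 * r%:C.
Proof. by rewrite (rmorphM (real_complex R)) (rmorph_nat (real_complex R)). Qed.

Lemma realcM (r s : R) : (r * s)%:C = r%:C * s%:C.
Proof. exact: (rmorphM (real_complex R)). Qed.

Lemma realcD (r s : R) : (r + s)%:C = r%:C + s%:C.
Proof. exact: (raddfD (real_complex R)). Qed.

Lemma Re_sum (I : Type) (r : seq I) (P : pred I) (F : I -> R[i]) :
  complex.Re (\sum_(i <- r | P i) F i) = \sum_(i <- r | P i) complex.Re (F i).
Proof. by elim/big_rec2 : _ => // i x y _ <-; rewrite ReD. Qed.

Lemma cm_sum (I : Type) (r : seq I) (P : pred I) (F : I -> R[i]) :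
  cm (\sum_(i <- r | P i) F i) <= \sum_(i <- r | P i) cm (F i).
Proof.
elim/big_ind2 : _ => [|x a y b xa yb|//]; first by rewrite cm0.
by rewrite (le_trans (cmD _ _))// lerD.
Qed.

(** Lets a complex identity that is linear in a vector be checked on real parts alone: apply the
    real statement to the vector and to ['i] times it. *)
Lemma Re_eq0_complex a : complex.Re a = 0 -> complex.Re ('i * a) = 0 -> a = 0.
Proof.
case: a => x y /= -> /eqP; rewrite mul0r mul1r sub0r oppr_eq0 => /eqP ->.
by [].
Qed.

End ComplexModulus.

Lemma small_invS (R : realType) (e : R) : 0 < e ->
  exists N : nat, forall n, (N <= n)%N -> n.+1%:R^-1 < e.
Proof.
move=> e0; exists (Num.truncn e^-1) => n en.
rewrite invf_plt ?posrE// (lt_le_trans (truncnS_gt _))//.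
by rewrite ler_nat ltnS.
Qed.

Lemma expr_small (R : realType) (q e : R) : 0 <= q -> q < 1 -> 0 < e ->
  exists N : nat, forall n, (N <= n)%N -> q ^+ n < e.
Proof.
move=> q0 q1 e0; have : (fun n => q ^+ n) @ \oo --> (0 : R).
  by apply: cvg_expr; rewrite ger0_norm.
move=> /cvgrPdist_lt/(_ e e0)[N _ NP]; exists N => n /NP/=.
by rewrite sub0r normrN ger0_norm ?exprn_ge0.
Qed.

(** * Real-valued norms, limits and closures in normed modules *)

Section RealNorm.
Variables (R : realType) (V : normedModType R[i]).
Implicit Types (x y z : V) (X : set V).

(* The norm of a normed module over R[i] is R[i]-valued; this is its real value. *)
Definition nm x : R := complex.Re `|x|.

Lemma normE x : `|x| = (nm x)%:C. Proof. by rewrite Re_normK. Qed.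

Lemma nm_ge0 x : 0 <= nm x. Proof. exact: Re_norm_ge0. Qed.

Lemma nm0 : nm 0 = 0. Proof. by rewrite /nm normr0. Qed.

Lemma nm_eq0 x : nm x = 0 -> x = 0.
Proof. by move=> x0; apply: normr0_eq0; rewrite normE x0. Qed.

Lemma nmN x : nm (- x) = nm x. Proof. by rewrite /nm normrN. Qed.

Lemma nmBC x y : nm (x - y) = nm (y - x). Proof. by rewrite /nm distrC. Qed.

Lemma nmD x y : nm (x + y) <= nm x + nm y.
Proof. by have := ler_normD x y; rewrite !normE -rmorphD lecR. Qed.

Lemma nmB x y z : nm (x - z) <= nm (x - y) + nm (y - z).
Proof. by rewrite (le_trans _ (nmD _ _))// addrA subrK. Qed.

Lemma nmZ (a : R[i]) x : nm (a *: x) = cm a * nm x.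
Proof. by rewrite /nm normrZ (normE x) cmE -realcM. Qed.

(** The divisor [1 + cm a] stays positive when a = 0. *)
Lemma nm_lin_lt (a : R[i]) x x' y y' (e : R) :
  nm (x - x') < e / 2 / (1 + cm a) -> nm (y - y') < e / 2 ->
  nm (a *: x + y - (a *: x' + y')) < e.
Proof.
have a0 : 0 < 1 + cm a by rewrite ltr_pwDl ?cm_ge0.
rewrite opprD addrACA -scalerBr => xx' yy'.
rewrite (le_lt_trans (nmD _ _))// nmZ [ltRHS]splitr.
rewrite ler_ltD//; move: xx'; rewrite ltr_pdivlMr// => /ltW; apply: le_trans.
by rewrite mulrC ler_wpM2l ?nm_ge0// lerDr.
Qed.

Lemma nm_sum (I : Type) (r : seq I) (P : pred I) (F : I -> V) :
  nm (\sum_(i <- r | P i) F i) <= \sum_(i <- r | P i) nm (F i).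
Proof.
elim/big_ind2 : _ => [|x a y b xa yb|//]; first by rewrite nm0.
by rewrite (le_trans (nmD _ _))// lerD.
Qed.

Lemma nm_le0 x : (forall e : R, 0 < e -> nm x <= e) -> x = 0.
Proof.
move=> xe; apply/nm_eq0/le_anti; rewrite nm_ge0 andbT.
by apply/ler_addgt0Pl => e /xe; rewrite addr0.
Qed.

Lemma nm_ball x y (e : R) : ball x e%:C y <-> nm (x - y) < e.
Proof. by rewrite -ball_normE /ball_/= normE ltcR. Qed.

Lemma gt0_complex (e : R[i]) : 0 < e -> e = (complex.Re e)%:C.
Proof. by move=> e0; rewrite RRe_real// gtr0_real. Qed.

Lemma near_nm x (P : set V) :
  nbhs x P <-> exists2 e : R, 0 < e & forall y, nm (x - y) < e -> P y.
Proof.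
split=> [/nbhs_ballP[e /= e0 eP]|[e e0 eP]].
  exists (complex.Re e); first by rewrite -ltcR -gt0_complex.
  by move=> y /nm_ball; rewrite -gt0_complex//; exact: eP.
by apply/nbhs_ballP; exists e%:C; rewrite /= ?ltcR// => y /nm_ball; exact: eP.
Qed.

Lemma closureP X x :
  closure X x <-> forall e : R, 0 < e -> exists2 y, X y & nm (x - y) < e.
Proof.
split=> [clx e e0|clx B /near_nm[e /clx[y Xy xy] eB]].
  have [|y [Xy xy]] := clx [set y | nm (x - y) < e]; last by exists y.
  by apply/near_nm; exists e.
by exists y; split=> //; exact: eB.
Qed.

Definition seq_lim (u : nat -> V) x : Prop :=
  forall e : R, 0 < e -> exists N : nat, forall n, (N <= n)%N -> nm (x - u n) < e.

Lemma seq_limP (u : nat -> V) x : u n @[n --> \oo] --> x <-> seq_lim u x.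
Proof.
split=> [ux e e0|ux B /near_nm[e /ux[N xN] eB]].
  have /ux [N _ NP] : nbhs x [set y | nm (x - y) < e].
    by apply/near_nm; exists e.
  by exists N => n; exact: NP.
by exists N => // n; rewrite /= => /xN; exact: eB.
Qed.

Lemma seq_lim_unique (u : nat -> V) x y : seq_lim u x -> seq_lim u y -> x = y.
Proof.
move=> ux uy; apply/eqP; rewrite -subr_eq0; apply/eqP/nm_le0 => e e0.
have e2 : 0 < e / 2 by rewrite divr_gt0.
have [N xN] := ux _ e2; have [M yM] := uy _ e2.
rewrite (le_trans (nmB _ (u (maxn N M)) _))// (splitr e) lerD// ltW//.
  by rewrite xN// leq_maxl.
by rewrite nmBC yM// leq_maxr.
Qed.

Lemma closure_seq_lim X x : closure X x <->
  exists2 u : nat -> V, forall n, X (u n) & seq_lim u x.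
Proof.
split=> [/closureP clx|[u Xu ux]]; last first.
  by apply/closureP => e /ux[N xN]; exists (u N) => //; exact: xN.
have /choice[u Xu] : forall n : nat, exists y, X y /\ nm (x - y) < n.+1%:R^-1.
  by move=> n; have [|y] := clx n.+1%:R^-1; [rewrite invr_gt0|exists y].
exists u => [n|e e0]; first by case: (Xu n).
have [N NP] := small_invS e0; exists N => n /NP; apply: lt_trans.
by case: (Xu n).
Qed.

End RealNorm.

Section Lipschitz.
Variables (R : realType) (V W : normedModType R[i]).

(** The Lipschitz bound compares a point of the closure with a point of X only, and f is total:
    extended maps such as [closure_extension] are controlled on the closure and nowhere else. *)
Lemma closure_map (X : set V) (Y : set W) (f : V -> W) C :
  (forall x y, closure X x -> X y -> nm (f x - f y) <= C * nm (x - y)) ->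
  (forall x, X x -> closure Y (f x)) -> forall x, closure X x -> closure Y (f x).
Proof.
(* [C] has no sign hypothesis, hence the absolute value. *)
move=> fC XY x clx; have /closure_id -> := @closed_closure _ Y.
apply/closureP => e e0; have C0 : 0 < 1 + `|C| by rewrite ltr_wpDr.
have [|y Xy xy] := (closureP _ _).1 clx (e / (1 + `|C|)); first exact: divr_gt0.
exists (f y); first exact: XY.
rewrite (le_lt_trans (fC _ _ clx Xy))//.
rewrite ltr_pdivlMr// in xy; rewrite (le_lt_trans _ xy)// mulrC.
by rewrite ler_wpM2l ?nm_ge0// (le_trans (ler_norm C))// lerDr.
Qed.

(** The difference f - g maps X into {0}, hence the closure of X into the closure of {0}. *)
Lemma closure_eq (X : set V) (f g : V -> W) C D :
  (forall x y, closure X x -> X y -> nm (f x - f y) <= C * nm (x - y)) ->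
  (forall x y, closure X x -> X y -> nm (g x - g y) <= D * nm (x - y)) ->
  (forall x, X x -> f x = g x) -> forall x, closure X x -> f x = g x.
Proof.
move=> fC gD fg x clx.
have : closure [set (0 : W)] (f x - g x).
  apply: (@closure_map X _ (fun x => f x - g x) (C + D)) clx => // {x}.
    move=> x y clx Xy; rewrite opprD opprK addrACA (le_trans (nmD _ _))//.
    rewrite mulrDl; apply: lerD; first exact: fC.
    by rewrite addrC (nmBC (g y)); exact: gD.
  by move=> x /fg ->; rewrite subrr; exact: subset_closure.
move=> /closureP fgx; apply/eqP; rewrite -subr_eq0; apply/eqP/nm_le0 => e e0.
by have [_ ->] := fgx _ e0; rewrite subr0 => /ltW.
Qed.

End Lipschitz.

Lemma seq_complete (R : realType) (V : completeNormedModType R[i]) (u : nat -> V) :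
  (forall e : R, 0 < e -> exists N : nat, forall m n,
     (N <= m)%N -> (N <= n)%N -> nm (u m - u n) < e) -> exists x, seq_lim u x.
Proof.
move=> uC; suff /cauchy_cvg/cvg_ex[x] : cauchy (u n @[n --> \oo]).
  by move=> /seq_limP; exists x.
apply/cauchy_exP => e e0; have [|N uN] := uC (complex.Re e).
  by rewrite -ltcR -gt0_complex.
exists (u N), N => // n /= Nn; rewrite (gt0_complex e0); apply/nm_ball.
exact: uN.
Qed.

Lemma cauchy_geometric (R : realType) (V : normedModType R[i])
    (u : nat -> V) (C q : R) : 0 <= q < 1 ->
  (forall n, nm (u n.+1 - u n) <= C * q ^+ n) ->
  forall e : R, 0 < e -> exists N : nat, forall m n,
     (N <= m)%N -> (N <= n)%N -> nm (u m - u n) < e.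
Proof.
move=> /andP[q0 q1] uC e e0; have q10 : 0 < 1 - q by rewrite subr_gt0.
have C0 : 0 <= C by have := uC 0%N; rewrite expr0 mulr1; apply/le_trans/nm_ge0.
(* The exact partial sum of the geometric series closes the induction with equality. *)
have uD n k : nm (u (n + k)%N - u n) <= C * q ^+ n / (1 - q) * (1 - q ^+ k).
  elim: k => [|k IH]; first by rewrite addn0 subrr nm0 subrr mulr0.
  rewrite addnS (le_trans (nmB _ (u (n + k)%N) _))// (le_trans (lerD (uC _) IH))//.
  rewrite exprS exprD le_eqVlt; apply/orP; left; apply/eqP.
  by field; rewrite gt_eqF.
have [N NP] : exists N : nat, forall n, (N <= n)%N -> C * q ^+ n / (1 - q) < e / 2.
  have [|N NP] := @expr_small _ q (e / 2 * (1 - q) / (1 + C)) q0 q1.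
    by rewrite !(divr_gt0, mulr_gt0)// ltr_pwDl.
  exists N => n /NP; rewrite ltr_pdivlMr ?ltr_pwDl// -ltr_pdivrMr//; apply: le_lt_trans.
  apply: ler_wpM2r; first by rewrite invr_ge0 ltW.
  by rewrite mulrC ler_wpM2l ?exprn_ge0// lerDr.
have uN n : (N <= n)%N -> nm (u n - u N) < e / 2.
  move=> Nn; rewrite -(subnKC Nn); apply: le_lt_trans (uD _ _) _.
  rewrite (le_lt_trans _ (NP N _))//.
  rewrite -[leRHS]mulr1 ler_wpM2l ?gerBl ?exprn_ge0//.
  by rewrite divr_ge0 ?mulr_ge0 ?exprn_ge0 ?(ltW q10).
exists N => m n Nm Nn; rewrite (le_lt_trans (nmB _ (u N) _))// (splitr e) ltrD//.
  exact: uN.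
by rewrite nmBC; exact: uN.
Qed.

(** * Semi-inner products and the Riesz representation theorem *)

Lemma quadratic_ge0 (R : realType) (a b : R) : 0 <= a ->
  (forall t, 0 <= t ^+ 2 * a + 2 * t * b) -> b = 0.
Proof.
(* At this t the value is - b^2 (a + 2) / (1 + a)^2. The minimizer - b / a would exclude a = 0. *)
move=> a0 /(_ (- b / (1 + a))) ab; have a1 : 0 < 1 + a by rewrite ltr_pwDl.
have : 0 <= - (b ^+ 2 * (a + 2) / (1 + a) ^+ 2).
  apply: le_trans ab _; rewrite le_eqVlt; apply/orP; left; apply/eqP.
  by field; rewrite gt_eqF.
rewrite oppr_ge0 pmulr_lle0 ?invr_gt0 ?exprn_gt0// pmulr_lle0 ?ltr_wpDl//.
by move=> b2; apply/eqP; rewrite -sqrf_eq0 eq_le b2 sqr_ge0.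
Qed.

Section SemiInner.
Variables (R : realType) (V : lmodType R[i]) (B : V -> V -> R[i]).
Hypothesis Blin : forall (a : R[i]) (x y z : V), B (a *: x + y) z = a * B x z + B y z.
Hypothesis BC : forall x y, B x y = conjc (B y x).
Hypothesis B_ge0 : forall x, 0 <= B x x.

Lemma semi_Dl x y z : B (x + y) z = B x z + B y z.
Proof. by have := Blin 1 x y z; rewrite scale1r mul1r. Qed.

Lemma semi_0l z : B 0 z = 0.
Proof.
by have /eqP := semi_Dl 0 0 z; rewrite addr0 addrC -subr_eq subrr eq_sym => /eqP.
Qed.

Lemma semi_Zl a x z : B (a *: x) z = a * B x z.
Proof. by have := Blin a x 0 z; rewrite addr0 semi_0l addr0. Qed.

Lemma semi_Dr x y z : B z (x + y) = B z x + B z y.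
Proof. by rewrite BC semi_Dl conjcD -!BC. Qed.

Lemma semi_Zr a x z : B z (a *: x) = conjc a * B z x.
Proof. by rewrite BC semi_Zl conjcM -BC. Qed.

Lemma semi_real x : B x x = (complex.Re (B x x))%:C.
Proof. by rewrite RRe_real// ger0_real. Qed.

Lemma semi_ge0 x : 0 <= complex.Re (B x x).
Proof. by have := B_ge0 x; rewrite semi_real ler0c. Qed.

(** Stated for a bare form because the frame space needs the triangle inequality in order to obtain
    its norm. *)
Lemma semi_CS x y : cm (B x y) ^+ 2 <= complex.Re (B x x) * complex.Re (B y y).
Proof.
set a := complex.Re (B x x); set c := complex.Re (B y y).
set s := cm (B x y) ^+ 2.
(* The value of the form at x - t B(x, y) y; t = 1 / c is optimal when c > 0. *)
have q (t : R) : 0 <= a - 2 * t * s + t ^+ 2 * s * c.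
  have := semi_ge0 (x + (- (t%:C) * B x y) *: y).
  rewrite semi_Dl semi_Zl !semi_Dr !semi_Zr (BC y x).
  rewrite conjcM conjcN conjc_real.
  rewrite (_ : _ + _ = B x x - (2 * t)%:C * (B x y * conjc (B x y)) +
      (t ^+ 2)%:C * (B x y * conjc (B x y)) * B y y); last first.
    by rewrite (rmorphM (real_complex R)) (rmorphXn (real_complex R))
      (rmorph_nat (real_complex R)) /=; ring.
  by rewrite mul_conjc semi_real (semi_real y) -!rmorphM -rmorphB -rmorphD.
have s0 : 0 <= s by exact: sqr_ge0.
have [c0|c0] := ltrP 0 c.
  have := q c^-1; rewrite (_ : _ + _ = a - s / c); last by field; rewrite gt_eqF.
  by rewrite subr_ge0 ler_pdivrMr.
have {}c0 : c = 0 by apply/le_anti; rewrite c0 semi_ge0.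
rewrite c0 mulr0 -(mulr0 2) leNgt; apply/negP; rewrite mulr0 => {}s0.
(* When c = 0 the bound is affine in t, and this t makes it equal to -1. *)
have := q ((a + 1) / (2 * s)); rewrite c0 mulr0 addr0.
rewrite (_ : _ - _ = - 1); last by field; rewrite gt_eqF.
by rewrite oppr_ge0 ler10.
Qed.

Lemma semi_triangle x y :
  Num.sqrt (complex.Re (B (x + y) (x + y))) <=
  Num.sqrt (complex.Re (B x x)) + Num.sqrt (complex.Re (B y y)).
Proof.
rewrite -(@ler_pXn2r _ 2) ?nnegrE ?addr_ge0 ?sqrtr_ge0//.
rewrite sqr_sqrtr ?semi_ge0// sqrrD !sqr_sqrtr ?semi_ge0//.
rewrite semi_Dl !semi_Dr !ReD (BC y x) ReJ.
rewrite (_ : _ + _ + _ =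
  complex.Re (B x x) + complex.Re (B x y) *+ 2 + complex.Re (B y y)).
  rewrite lerD2r lerD2l lerMn2r/= (le_trans (ler_Re_cm _))//.
  rewrite -(@ler_pXn2r _ 2) ?nnegrE ?mulr_ge0 ?cm_ge0 ?sqrtr_ge0//.
  by rewrite exprMn !sqr_sqrtr ?semi_ge0 ?semi_CS.
by rewrite mulr2n; ring.
Qed.

End SemiInner.

Section Dot.
Variables (R : realType) (H : hilbertType R).
Implicit Types (x y z : H) (a : R[i]).

Let lin := @dotP R H.
Let sym := @dotC R H.

Lemma dot_nm x : dot x x = (nm x ^+ 2)%:C.
Proof. by rewrite dot_norm normE rmorphXn. Qed.

Let pos x : 0 <= dot x x.
Proof. by rewrite dot_nm ler0c sqr_ge0. Qed.

Lemma dotDl x y z : dot (x + y) z = dot x z + dot y z.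
Proof. exact: semi_Dl lin _ _ _. Qed.

Lemma dotZl a x z : dot (a *: x) z = a * dot x z.
Proof. exact: semi_Zl lin _ _ _. Qed.

Lemma dotDr x y z : dot x (y + z) = dot x y + dot x z.
Proof. exact: semi_Dr lin sym _ _ _. Qed.

Lemma dotZr a x z : dot x (a *: z) = conjc a * dot x z.
Proof. exact: semi_Zr lin sym _ _ _. Qed.

Lemma dotNl x z : dot (- x) z = - dot x z.
Proof. by rewrite -scaleN1r dotZl mulN1r. Qed.

Lemma dotNr x z : dot x (- z) = - dot x z.
Proof. by rewrite -scaleN1r dotZr conjcN conjc1 mulN1r. Qed.

Lemma dot0l z : dot 0 z = 0. Proof. by rewrite -(scale0r 0) dotZl mul0r. Qed.

Lemma dot0r z : dot z 0 = 0. Proof. by rewrite sym dot0l conjc0. Qed.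

Lemma dotBl x y z : dot (x - y) z = dot x z - dot y z.
Proof. by rewrite dotDl dotNl. Qed.

Lemma dotBr x y z : dot x (y - z) = dot x y - dot x z.
Proof. by rewrite dotDr dotNr. Qed.

Lemma dot_suml (I : Type) (r : seq I) (P : pred I) (F : I -> H) z :
  dot (\sum_(i <- r | P i) F i) z = \sum_(i <- r | P i) dot (F i) z.
Proof. by elim/big_rec2 : _ => [|i u v _ <-]; rewrite ?dot0l ?dotDl. Qed.

Lemma dot_sumr (I : Type) (r : seq I) (P : pred I) (F : I -> H) z :
  dot z (\sum_(i <- r | P i) F i) = \sum_(i <- r | P i) dot z (F i).
Proof. by elim/big_rec2 : _ => [|i u v _ <-]; rewrite ?dot0r ?dotDr. Qed.

Lemma dot_CS x y : cm (dot x y) <= nm x * nm y.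
Proof.
rewrite -(@ler_pXn2r _ 2) ?nnegrE ?mulr_ge0 ?cm_ge0 ?nm_ge0//.
by have := semi_CS lin sym pos x y; rewrite !dot_nm/= exprMn.
Qed.

Lemma dot_eq x y : (forall z, dot x z = dot y z) -> x = y.
Proof.
move=> xy; apply/eqP; rewrite -subr_eq0; apply/eqP/nm_eq0/eqP.
rewrite -sqrf_eq0; apply/eqP/complexI.
by rewrite -dot_nm dotBl xy subrr.
Qed.

Lemma nmD_sqr x y : nm (x + y) ^+ 2 = nm x ^+ 2 + 2 * complex.Re (dot x y) + nm y ^+ 2.
Proof.
apply: (@complexI R); rewrite -dot_nm dotDl !dotDr !dot_nm (dotC y) addrA.
rewrite !(rmorphD (real_complex R))/=.
by rewrite mul2C -addcJ addrA.
Qed.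

Lemma parallelogram x y :
  nm (x + y) ^+ 2 + nm (x - y) ^+ 2 = 2 * nm x ^+ 2 + 2 * nm y ^+ 2.
Proof. by rewrite !nmD_sqr dotNr nmN ReN; ring. Qed.

End Dot.

Section Riesz.
Variables (R : realType) (H : hilbertType R) (phi : H -> R[i]).
Hypothesis phi_lin : forall (a : R[i]) x y, phi (a *: x + y) = a * phi x + phi y.
Variable C : R.
Hypothesis phi_bnd : forall x, cm (phi x) <= C * nm x.

Let phiD x y : phi (x + y) = phi x + phi y.
Proof. by have := phi_lin 1 x y; rewrite scale1r mul1r. Qed.

Let phi0 : phi 0 = 0.
Proof. by have /eqP := phiD 0 0; rewrite addr0 addrC -subr_eq subrr eq_sym => /eqP. Qed.

Let phiZ a x : phi (a *: x) = a * phi x.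
Proof. by have := phi_lin a x 0; rewrite !addr0 phi0 addr0. Qed.

(* The representing vector minimizes this functional. *)
Let J x : R := nm x ^+ 2 - 2 * complex.Re (phi x).

Let J_ge x : - (C ^+ 2) <= J x.
Proof.
rewrite /J lerBrDr addrC -lerBrDr opprK.
have h1 : complex.Re (phi x) <= C * nm x by rewrite (le_trans (ler_Re_cm _)).
have h2 : 0 <= (nm x - C) ^+ 2 by exact: sqr_ge0.
by nra.
Qed.

Let m : R := inf (range J).

Let m_le x : m <= J x.
Proof. by apply: ge_inf; [exists (- (C ^+ 2)) => _ [y _ <-]|exists x]. Qed.

Let m_approx (e : R) : 0 < e -> exists x, J x < m + e.
Proof.
move=> e0; have : has_inf (range J).
  by split; [exists (J 0), 0|exists (- (C ^+ 2)) => _ [y _ <-]].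
by move=> /(inf_adherent e0)[_ [x _ <-]]; exists x.
Qed.

(** The parallelogram law, with the value of J at the midpoint bounded below by m. *)
Let J_parallelogram x y : nm (x - y) ^+ 2 <= 2 * (J x - m) + 2 * (J y - m).
Proof.
have := m_le (2^-1 *: (x + y)); rewrite /J nmZ phiZ phiD.
rewrite cm_natV.
have -> : (2^-1 : R[i]) = (2^-1)%:C by rewrite fmorphV/= (rmorph_nat (real_complex R)).
rewrite ReZ ReD; have := parallelogram x y.
by rewrite exprMn; nra.
Qed.

(** If y represents phi, then J x = |x - y|^2 - |y|^2. So a minimizing sequence must converge to y;
    it is Cauchy by [J_parallelogram], and the first variation of J vanishes at its limit. *)
Lemma riesz : exists y, forall x, phi x = dot x y.
Proof.
have /choice[u uJ] : forall n : nat, exists x, J x < m + n.+1%:R^-1.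
  by move=> n; apply: m_approx; rewrite invr_gt0.
have [|y uy] := @seq_complete _ _ u.
  move=> e e0; have [|N NP] := @small_invS R (e ^+ 2 / 4); first by rewrite divr_gt0 ?exprn_gt0.
  exists N => k l Nk Nl; rewrite -(@ltr_pXn2r _ 2) ?nnegrE ?nm_ge0 ?ltW//.
  apply: le_lt_trans (J_parallelogram _ _) _.
  have := uJ k; have := uJ l; have := NP _ Nk; have := NP _ Nl.
  by move: (J (u k)) (J (u l)) (k.+1%:R^-1) (l.+1%:R^-1) => *; lra.
exists y => z; apply/eqP; rewrite -subr_eq0; apply/eqP.
have Re0 w : complex.Re (phi w - dot w y) = 0.
  apply/eqP; rewrite -oppr_eq0 -ReN opprB; apply/eqP.
  apply: (@quadratic_ge0 _ (nm w ^+ 2)); first exact: sqr_ge0.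
  (* The inequality J(y + t w) >= J(y), up to e: the variation is computed at u k instead of y. One
     half of e pays for J(u k) - m, the other for replacing u k by y. *)
  move=> t; suff P (e : R) : 0 < e ->
      0 <= e + (t ^+ 2 * nm w ^+ 2 + 2 * t * complex.Re (dot w y - phi w)).
    by apply/ler_addgt0Pl => e; exact: P.
  move=> e0.
  have d0 : 0 < e / (2 * (1 + 2 * `|t| * nm w)).
    by rewrite divr_gt0 ?mulr_gt0// ltr_pwDl// !mulr_ge0 ?nm_ge0.
  have [N NP] := uy _ d0; have [|N' NP'] := @small_invS R (e / 2); first exact: divr_gt0.
  set k := maxn N N'; have := NP k (leq_maxl _ _); have := NP' k (leq_maxr _ _).
  have := uJ k; have := m_le (u k + t%:C *: w).
  rewrite /J nmD_sqr nmZ cm_real dotZr conjc_real phiD phiZ !ReD !(ReZ t) ReN.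
  rewrite (dotC (u k)) ReJ exprMn real_normK ?num_real// => h1 h2 h3 h4.
  have h5 : t * complex.Re (dot w (u k)) - t * complex.Re (dot w y) <= `|t| * nm w * nm (y - u k).
    rewrite -mulrBr (le_trans (ler_norm _))// normrM -mulrA ler_wpM2l//.
    by rewrite -ReN -ReD -dotBr nmBC (le_trans (ler_normRe_cm _))// dot_CS.
  have h6 : 2 * `|t| * nm w * nm (y - u k) <= e / 2.
    move: h4; rewrite ltr_pdivlMr; last first.
      by rewrite mulr_gt0// ltr_pwDl// !mulr_ge0 ?nm_ge0.
    by have := nm_ge0 (y - u k); lra.
  by move: (k.+1%:R^-1) h2 h3 => r h2 h3; lra.
apply: Re_eq0_complex; first exact: Re0.
by have := Re0 ('i *: z); rewrite phiZ dotZl -mulrBr.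
Qed.

End Riesz.

(** * Calculus of bounded operators and their adjoints *)

Section BopCalculus.
Variables (R : realType).
Implicit Types H K L : hilbertType R.

Lemma bopDE H K (S T : bop H K) x : (S + T) x = S x + T x. Proof. by []. Qed.
Lemma bopNE H K (T : bop H K) x : (- T) x = - T x. Proof. by []. Qed.
Lemma bopBE H K (S T : bop H K) x : (S - T) x = S x - T x. Proof. by []. Qed.
Lemma bopZE H K (a : R[i]) (T : bop H K) x : (a *: T) x = a *: T x.
Proof. by []. Qed.
Lemma bop0E H K x : (0 : bop H K) x = 0. Proof. by []. Qed.

Lemma bcompE H K L (T : bop K L) (S : bop H K) x : (T *o S) x = T (S x).
Proof. by []. Qed.
Lemma bidE H (x : H) : bid H x = x. Proof. by []. Qed.

Lemma bop_sumE H K (I : Type) (r : seq I) (P : pred I) (F : I -> bop H K) x :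
  (\sum_(i <- r | P i) F i) x = \sum_(i <- r | P i) F i x.
Proof. by elim/big_rec2 : _ => // i y T _ <-; rewrite bopDE. Qed.

Lemma bopD H K (T : bop H K) x y : T (x + y) = T x + T y.
Proof. by have := bop_linear T 1 x y; rewrite !scale1r. Qed.

Lemma bopZ H K (T : bop H K) (a : R[i]) x : T (a *: x) = a *: T x.
Proof. by have := bop_linear T a x 0; rewrite !addr0 bop0 addr0. Qed.

Lemma bopN H K (T : bop H K) x : T (- x) = - T x.
Proof. by rewrite -scaleN1r bopZ scaleN1r. Qed.

Lemma bopB H K (T : bop H K) x y : T (x - y) = T x - T y.
Proof. by rewrite bopD bopN. Qed.

Lemma bop_sum H K (T : bop H K) (I : Type) (r : seq I) (P : pred I) (F : I -> H) :
  T (\sum_(i <- r | P i) F i) = \sum_(i <- r | P i) T (F i).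
Proof. by elim/big_rec2 : _ => [|i x y _ <-]; rewrite ?bop0 ?bopD. Qed.

Lemma nm_bop H K (T : bop H K) x : nm (T x) <= nm T * nm x.
Proof. by have := opnormP T x; rewrite !normE -rmorphM lecR. Qed.

Lemma nm_bop_le H K (T : bop H K) (c : R) : 0 <= c ->
  (forall x, nm (T x) <= c * nm x) -> nm T <= c.
Proof.
move=> c0 cT; apply: opnorm_le; split=> // x.
by rewrite !normE -rmorphM lecR.
Qed.

Lemma exists_bop H K (f : H -> K) (c : R) :
  (forall (a : R[i]) x y, f (a *: x + y) = a *: f x + f y) -> 0 <= c ->
  (forall x, nm (f x) <= c * nm x) -> exists T : bop H K, forall x, T x = f x.
Proof.
move=> flin c0 cf.
have fb : f \in @bounded_linear R H K.
  apply/bounded_linearP; split=> // ; exists c; split=> // x.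
  by rewrite !normE -rmorphM lecR.
by exists (Bop fb).
Qed.

Lemma compDl H K L (S T : bop K L) (U : bop H K) : (S + T) *o U = S *o U + T *o U.
Proof. exact: bopP. Qed.

Lemma compDr H K L (S T : bop H K) (U : bop K L) : U *o (S + T) = U *o S + U *o T.
Proof. by apply: bopP => x /=; rewrite bopD. Qed.

Lemma compZl H K L (a : R[i]) (T : bop K L) (U : bop H K) :
  (a *: T) *o U = a *: (T *o U).
Proof. exact: bopP. Qed.

Lemma compZr H K L (a : R[i]) (T : bop H K) (U : bop K L) :
  U *o (a *: T) = a *: (U *o T).
Proof. by apply: bopP => x /=; rewrite bopZ. Qed.

Lemma compNl H K L (T : bop K L) (U : bop H K) : (- T) *o U = - (T *o U).
Proof. exact: bopP. Qed.

Lemma compNr H K L (T : bop H K) (U : bop K L) : U *o (- T) = - (U *o T).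
Proof. by apply: bopP => x /=; rewrite bopN. Qed.

Lemma compBl H K L (S T : bop K L) (U : bop H K) : (S - T) *o U = S *o U - T *o U.
Proof. by rewrite compDl compNl. Qed.

Lemma compBr H K L (S T : bop H K) (U : bop K L) : U *o (S - T) = U *o S - U *o T.
Proof. by rewrite compDr compNr. Qed.

Lemma comp0l H K L (U : bop H K) : (0 : bop K L) *o U = 0.
Proof. exact: bopP. Qed.

Lemma comp0r H K L (U : bop K L) : U *o (0 : bop H K) = 0.
Proof. by apply: bopP => x /=; rewrite bop0. Qed.

Lemma compA H K L L' (S : bop L L') (T : bop K L) (U : bop H K) :
  S *o (T *o U) = S *o T *o U.
Proof. exact: bopP. Qed.

Lemma comp1l H K (T : bop H K) : bid K *o T = T. Proof. exact: bopP. Qed.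
Lemma comp1r H K (T : bop H K) : T *o bid H = T. Proof. exact: bopP. Qed.

Lemma comp_suml H K L (I : Type) (r : seq I) (P : pred I) (F : I -> bop K L)
    (U : bop H K) :
  (\sum_(i <- r | P i) F i) *o U = \sum_(i <- r | P i) (F i *o U).
Proof. by elim/big_rec2 : _ => [|i x y _ <-]; rewrite ?comp0l ?compDl. Qed.

Lemma comp_sumr H K L (I : Type) (r : seq I) (P : pred I) (F : I -> bop H K)
    (U : bop K L) :
  U *o (\sum_(i <- r | P i) F i) = \sum_(i <- r | P i) (U *o F i).
Proof. by elim/big_rec2 : _ => [|i x y _ <-]; rewrite ?comp0r ?compDr. Qed.

Lemma nm_comp H K L (T : bop K L) (S : bop H K) : nm (T *o S) <= nm T * nm S.
Proof.
apply: nm_bop_le => [|x]; first by rewrite mulr_ge0 ?nm_ge0.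
apply: le_trans (nm_bop T (S x)) _.
by rewrite -mulrA ler_wpM2l ?nm_ge0 ?nm_bop.
Qed.

Lemma bop_dot_eq H K (S T : bop H K) :
  (forall x y, dot (S x) y = dot (T x) y) -> S = T.
Proof. by move=> ST; apply: bopP => x; apply: dot_eq => y. Qed.

(** By [riesz] each functional x |-> <T x, y> has a representing vector. The choice of it is linear
    in y by uniqueness and bounded by the norm of T, so the set from which [adj] chooses is
    nonempty. *)
Lemma adjP H K (T : bop H K) x y : dot (T x) y = dot x (adj T y).
Proof.
rewrite /adj; case: xgetP => [T' _ ->//|noT]; exfalso.
have /choice[f fP] : forall y, exists z, forall x, dot (T x) y = dot x z.
  move=> {}y; apply: (@riesz R H (fun x => dot (T x) y) _ (nm T * nm y)).
    by move=> a u v; rewrite bopD bopZ dotP.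
  move=> u; rewrite (le_trans (dot_CS _ _))// mulrAC.
  by rewrite ler_wpM2r ?nm_ge0 ?nm_bop.
have [a u v|u|T' T'f] := @exists_bop K H f (nm T) _ (nm_ge0 T).
- apply: dot_eq => z; rewrite dotC -fP dotDr dotZr !fP.
  by rewrite dotDl dotZl conjcD conjcM conjcK -!dotC.
- have [->|fu0] := eqVneq (f u) 0; first by rewrite nm0 mulr_ge0 ?nm_ge0.
  have {}fu0 : 0 < nm (f u).
    by rewrite lt_neqAle nm_ge0 andbT eq_sym; apply: contra_neq fu0 => /nm_eq0.
  (* |f u|^2 = <T (f u), u> <= |T| |f u| |u|, divided by |f u|. *)
  rewrite -(ler_pM2l fu0) -expr2 -lecR -dot_nm -fP.
  rewrite (le_trans (real_ler_norm _))//; last first.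
    by rewrite cmE lecR (le_trans (dot_CS _ _))// mulrA [nm (f u) * _]mulrC
      ler_wpM2r ?nm_ge0 ?nm_bop.
  by rewrite fP dot_nm complex_real.
by apply: (noT T') => u v; rewrite T'f.
Qed.

Lemma adjPl H K (T : bop H K) x y : dot (adj T x) y = dot x (T y).
Proof. by rewrite dotC -adjP -dotC. Qed.

Lemma adj_unique H K (T : bop H K) (S : bop K H) :
  (forall x y, dot (T x) y = dot x (S y)) -> adj T = S.
Proof.
by move=> TS; apply: bop_dot_eq => x y; rewrite adjPl dotC TS -dotC.
Qed.

Lemma adjK H K (T : bop H K) : adj (adj T) = T.
Proof. by apply: adj_unique => x y; rewrite adjPl. Qed.

Lemma adj_comp H K L (T : bop K L) (S : bop H K) : adj (T *o S) = adj S *o adj T.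
Proof. by apply: adj_unique => x y /=; rewrite !adjP. Qed.

Lemma adjD H K (S T : bop H K) : adj (S + T) = adj S + adj T.
Proof. by apply: adj_unique => x y; rewrite !bopDE dotDl dotDr !adjP. Qed.

Lemma adjZ H K a (T : bop H K) : adj (a *: T) = conjc a *: adj T.
Proof. by apply: adj_unique => x y; rewrite !bopZE dotZl dotZr conjcK adjP. Qed.

Lemma adjN H K (T : bop H K) : adj (- T) = - adj T.
Proof. by rewrite -scaleN1r adjZ conjcN conjc1 scaleN1r. Qed.

Lemma adjB H K (S T : bop H K) : adj (S - T) = adj S - adj T.
Proof. by rewrite adjD adjN. Qed.

Lemma adj0 H K : adj (0 : bop H K) = 0.
Proof. by apply: adj_unique => x y; rewrite !bop0E dot0l dot0r. Qed.

Lemma adj_bid H : adj (bid H) = bid H.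
Proof. exact: adj_unique. Qed.

Lemma adj_sum H K (I : Type) (r : seq I) (P : pred I) (F : I -> bop H K) :
  adj (\sum_(i <- r | P i) F i) = \sum_(i <- r | P i) adj (F i).
Proof. by elim/big_rec2 : _ => [|i x y _ <-]; rewrite ?adj0 ?adjD. Qed.

Lemma nm_adj_le H K (T : bop H K) : nm (adj T) <= nm T.
Proof.
apply: nm_bop_le => [|x]; first exact: nm_ge0.
set y := adj T x; have [->|y0] := eqVneq y 0; first by rewrite nm0 mulr_ge0 ?nm_ge0.
have {}y0 : 0 < nm y.
  by rewrite lt_neqAle nm_ge0 andbT eq_sym; apply: contra_neq y0 => /nm_eq0.
rewrite -(ler_pM2l y0) -expr2 -[leLHS]/(complex.Re (nm y ^+ 2)%:C) -dot_nm.
rewrite {1}/y adjPl (le_trans (ler_Re_cm _))// (le_trans (dot_CS _ _))//.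
rewrite (_ : nm y * _ = nm x * (nm T * nm y)); last by ring.
by rewrite ler_wpM2l ?nm_ge0 ?nm_bop.
Qed.

Lemma nm_adj H K (T : bop H K) : nm (adj T) = nm T.
Proof.
by apply/le_anti; rewrite nm_adj_le/=; have := nm_adj_le (adj T); rewrite adjK.
Qed.

Lemma nm_bid_le H : nm (bid H) <= 1.
Proof. by apply: nm_bop_le => // x; rewrite mul1r. Qed.

Lemma bop_complete H K (u : nat -> bop H K) :
  (forall e : R, 0 < e -> exists N : nat, forall m n,
     (N <= m)%N -> (N <= n)%N -> nm (u m - u n) < e) -> exists T, seq_lim u T.
Proof.
move=> uC.
have ux (e : R) : 0 < e -> exists N : nat, forall x m n, (N <= m)%N -> (N <= n)%N ->
    nm (u m x - u n x) <= e * nm x.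
  move=> /uC[N NP]; exists N => x m n Nm Nn; rewrite -bopBE.
  by rewrite (le_trans (nm_bop _ _))// ler_wpM2r ?nm_ge0// ltW// NP.
have /choice[f fP] : forall x, exists y, seq_lim (fun n => u n x) y.
  move=> x; apply: seq_complete => e e0.
  have nx : 0 < 1 + nm x by rewrite ltr_pwDl ?nm_ge0.
  have [N NP] := ux _ (divr_gt0 e0 nx); exists N => m n Nm Nn.
  rewrite (le_lt_trans (NP x m n Nm Nn))// -mulrA gtr_pMr//.
  by rewrite ltr_pdivrMl// mulr1 ltrDr.
(* The Cauchy estimate passes to the limit in one index, uniformly on the unit ball; linearity,
   boundedness and norm convergence all rest on this. *)
have fu (e : R) : 0 < e -> exists N : nat, forall x n, (N <= n)%N ->
    nm (f x - u n x) <= e * nm x.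
  move=> /ux[N NP]; exists N => x n Nn; apply/ler_addgt0Pl => d d0.
  have [M MP] := fP x _ d0; set k := maxn N M.
  rewrite (le_trans (nmB _ (u k x) _))// lerD//.
    by rewrite ltW// MP// leq_maxr.
  by apply: NP => //; exact: leq_maxl.
have flin (a : R[i]) x y : f (a *: x + y) = a *: f x + f y.
  apply/eqP; rewrite -subr_eq0; apply/eqP/nm_le0 => e e0.
  pose s := nm (a *: x + y) + cm a * nm x + nm y.
  have s0 : 0 <= s by rewrite !addr_ge0 ?mulr_ge0 ?nm_ge0 ?cm_ge0.
  have s1 : 0 < 1 + s by rewrite ltr_pwDl.
  have [N NP] := fu _ (divr_gt0 e0 s1); set d := e / (1 + s) in NP.
  have -> : f (a *: x + y) - (a *: f x + f y) = (f (a *: x + y) - u N (a *: x + y))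
      + (a *: (u N x - f x) + (u N y - f y)).
    rewrite bopD bopZ scalerBr !addrA; rewrite -!addrA; congr (_ + _).
    by rewrite (addrA (a *: u N x)) addrACA -opprD addKr.
  rewrite (le_trans (nmD _ _))// (le_trans (lerD (NP _ _ (leqnn N)) (nmD _ _)))//.
  rewrite nmZ nmBC (nmBC _ (f y)).
  have := NP x N (leqnn _); have := NP y N (leqnn _) => h1 h2.
  have h3 : cm a * nm (f x - u N x) <= cm a * (d * nm x).
    by rewrite ler_wpM2l ?cm_ge0.
  apply: (@le_trans _ _ (d * s)); first by rewrite /s; lra.
  by rewrite /d -mulrA ger_pMr// ler_pdivrMl// mulr1 lerDr.
have [N NP] := fu 1 ltr01.
have [|x|T Tf] := exists_bop flin (c := 1 + nm (u N)).
- by rewrite addr_ge0 ?nm_ge0.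
- rewrite -[f x](subrK (u N x)) (le_trans (nmD _ _))// mulrDl lerD//.
  + exact: NP.
  + exact: nm_bop.
exists T => e e0; have [|M MP] := fu (e / 2); first by rewrite divr_gt0.
exists M => n Mn; rewrite (@le_lt_trans _ _ (e / 2))//; last first.
  by rewrite ltr_pdivrMr// ltr_pMr// ltr1n.
by apply: nm_bop_le => [|x]; [rewrite ltW// divr_gt0|rewrite bopBE Tf MP].
Qed.

End BopCalculus.

(** * Frames of a nondegenerate TRO *)

Section SubspaceTheory.
Variables (R : realType) (V : normedModType R[i]).
Implicit Types (X Y : set V).

Lemma subspaceD X x y : subspace X -> X x -> X y -> X (x + y).
Proof. by case=> _ /(_ 1) sX Xx Xy; have := sX _ _ Xx Xy; rewrite scale1r. Qed.

Lemma subspaceZ X a x : subspace X -> X x -> X (a *: x).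
Proof. by case=> X0 sX Xx; have := sX a _ _ Xx X0; rewrite addr0. Qed.

Lemma subspaceN X x : subspace X -> X x -> X (- x).
Proof. by move=> sX Xx; rewrite -scaleN1r; exact: subspaceZ. Qed.

Lemma subspaceB X x y : subspace X -> X x -> X y -> X (x - y).
Proof. by move=> sX Xx Xy; apply: subspaceD => //; exact: subspaceN. Qed.

Lemma subspace_sum X (I : Type) (r : seq I) (P : pred I) (F : I -> V) :
  subspace X -> (forall i, P i -> X (F i)) -> X (\sum_(i <- r | P i) F i).
Proof.
move=> sX XF; elim/big_ind : _ => //; first by case: sX.
by move=> x y; exact: subspaceD.
Qed.

Lemma subspace_closure X : subspace X -> subspace (closure X).
Proof.
move=> sX; split; first by apply: subset_closure; case: sX.
move=> a x y /closureP clx /closureP cly; apply/closureP => e e0.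
have a0 : 0 < 1 + cm a by rewrite ltr_pwDl ?cm_ge0.
have [|x' Xx' xx'] := clx (e / 2 / (1 + cm a)); first by rewrite !divr_gt0.
have [|y' Xy' yy'] := cly (e / 2); first by rewrite divr_gt0.
exists (a *: x' + y'); first by case: sX => _; apply.
exact: nm_lin_lt.
Qed.

Lemma smallest_subspace X : subspace (smallest (@subspace R V) X).
Proof.
split=> [Y [[]]//|a x y Xx Xy Y [sY XY]].
by case: (sY) => _; apply; [exact: Xx|exact: Xy].
Qed.

Lemma clspan_subspace X : subspace (clspan X).
Proof. exact/subspace_closure/smallest_subspace. Qed.

Lemma clspan_closed X : closed (clspan X).
Proof. exact: closed_closure. Qed.

Lemma sub_clspan X : X `<=` clspan X.
Proof. by move=> x Xx; apply: subset_closure => Y [_]; exact. Qed.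

Lemma clspan_min X Y : subspace Y -> closed Y -> X `<=` Y -> clspan X `<=` Y.
Proof.
move=> sY cY XY x; rewrite /clspan => clx; rewrite (closure_id Y).1//.
by apply: closureS clx; move=> y; apply; split.
Qed.

End SubspaceTheory.

Section TROFrame.
Variables (R : realType) (H K : hilbertType R) (M : set (bop H K)).
Hypothesis troM : TRO M.

Let sM : subspace M. Proof. by case: troM. Qed.

Lemma span_TRO (x : bop K K) :
  smallest (@subspace R _) [set a *o adj b | a in M & b in M] x ->
  exists n (a b : 'I_n -> bop H K),
    [/\ forall i, M (a i), forall i, M (b i) & x = \sum_i a i *o adj (b i)].
Proof.
pose Y : set (bop K K) := [set x | exists n (a b : 'I_n -> bop H K),
    [/\ forall i, M (a i), forall i, M (b i) & x = \sum_i a i *o adj (b i)]].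
apply: (_ : _ `<=` Y); apply: smallest_sub; last first.
  move=> _ [a Ma [b Mb <-]]; exists 1%N, (fun=> a), (fun=> b).
  by split=> //; rewrite big_ord1.
split; first by exists 0%N, (fun=> 0), (fun=> 0); split=> [[]//|[]//|]; rewrite big_ord0.
move=> c _ _ [n [a [b [Ma Mb ->]]]] [m [a' [b' [Ma' Mb' ->]]]].
(* The two families are concatenated and the scalar is absorbed into the left factors. *)
exists (n + m)%N, (fun i => match fintype.split i with inl j => c *: a j | inr j => a' j end),
  (fun i => match fintype.split i with inl j => b j | inr j => b' j end); split.
- by move=> i; case: (fintype.split i) => j //; exact: subspaceZ.
- by move=> i; case: (fintype.split i).
rewrite big_split_ord scaler_sumr; congr (_ + _); apply: eq_bigr => i _.
  by rewrite -[lshift m i]/(unsplit (inl i)) unsplitK compZl.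
by rewrite -[rshift n i]/(unsplit (inr i)) unsplitK.
Qed.

Definition defect n (m : 'I_n -> bop H K) : bop K K :=
  bid K - \sum_i m i *o adj (m i).

Lemma defect_dot n (m : 'I_n -> bop H K) y :
  dot (defect m y) y = (nm y ^+ 2 - \sum_i nm (adj (m i) y) ^+ 2)%:C.
Proof.
rewrite bopBE dotBl dot_nm rmorphB/= bop_sumE dot_suml rmorph_sum/=; congr (_ - _).
by apply: eq_bigr => i _ /=; rewrite adjP dot_nm.
Qed.

Lemma adj_defect n (m : 'I_n -> bop H K) : adj (defect m) = defect m.
Proof.
rewrite adjB adj_bid adj_sum; congr (_ - _); apply: eq_bigr => i _.
by rewrite adj_comp adjK.
Qed.

(* An approximation of 1 by \sum_i a_i b_i^* bounds \sum_i a_i a_i^* below. *)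
Lemma TRO_lower_bound : rprod M (bid K) ->
  exists n (a : 'I_n -> bop H K), (forall i, M (a i)) /\
    exists2 d : R, 0 < d & forall y, d * nm y ^+ 2 <= \sum_i nm (adj (a i) y) ^+ 2.
Proof.
move=> /closureP/(_ 2^-1)[|x /span_TRO[n [a [b [Ma Mb xE]]]] x2]; first by rewrite invr_gt0.
exists n, a; split=> //; pose c := \sum_i nm (b i) ^+ 2.
have c0 : 0 <= c by rewrite sumr_ge0// => i _; exact: sqr_ge0.
exists ((4 * (1 + c))^-1) => [|y]; first by rewrite invr_gt0 mulr_gt0// ltr_pwDl.
have ay0 : 0 <= \sum_i nm (adj (a i) y) ^+ 2 by rewrite sumr_ge0// => i _; exact: sqr_ge0.
(* y = (1 - x)^* y + x^* y, and the first summand has norm at most |y| / 2. *)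
have h1 : nm y <= 2 * \sum_i nm (b i) * nm (adj (a i) y).
  have : nm y <= 2^-1 * nm y + \sum_i nm (b i) * nm (adj (a i) y).
    have {1}-> : y = adj (bid K - x) y + adj x y.
      by rewrite -bopDE -adjD subrK adj_bid.
    rewrite (le_trans (nmD _ _))// lerD//.
      rewrite (le_trans (nm_bop _ _))// ler_wpM2r ?nm_ge0//.
      by rewrite nm_adj ltW.
    rewrite xE adj_sum bop_sumE (le_trans (nm_sum _ _ _))// ler_sum// => i _.
    by rewrite adj_comp adjK/= nm_bop.
  by lra.
(* Young's inequality with weight k = 2 (1 + c), term by term. The coefficient c / k of |y|^2 is
   below 1/2 and gets absorbed, which leaves the constant 4 (1 + c). *)
have h2 : 2 * nm y * (\sum_i nm (b i) * nm (adj (a i) y)) <=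
    (2 * (1 + c))^-1 * c * nm y ^+ 2 + (2 * (1 + c)) * \sum_i nm (adj (a i) y) ^+ 2.
  rewrite /c [_ * (\sum_i nm (b i) ^+ 2)]mulr_sumr mulr_suml !mulr_sumr -big_split/=.
  apply: ler_sum => i _; rewrite -/c.
  set k := 2 * (1 + c); have k0 : 0 < k by rewrite mulr_gt0// ltr_pwDl.
  set t := nm (adj _ y); set z := nm y; set u := nm (b i).
  rewrite -subr_ge0 (_ : _ - _ = k^-1 * (u * z - k * t) ^+ 2); last first.
    by field; rewrite gt_eqF.
  by rewrite mulr_ge0 ?sqr_ge0// invr_ge0 ltW.
have h3 : nm y ^+ 2 <= 2 * nm y * \sum_i nm (b i) * nm (adj (a i) y).
  move: h1; set t := \sum_i _ => h1.
  by rewrite expr2 (_ : 2 * _ * t = nm y * (2 * t)) ?ler_wpM2l ?nm_ge0//; ring.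
have k0 : 0 < 1 + c by rewrite ltr_pwDl.
rewrite ler_pdivrMl ?mulr_gt0//.
have := le_trans h3 h2.
rewrite (_ : (2 * (1 + c))^-1 * c * nm y ^+ 2 =
  nm y ^+ 2 / 2 - (2 * (1 + c))^-1 * nm y ^+ 2); last first.
  by field; rewrite gt_eqF.
have : 0 <= (2 * (1 + c))^-1 * nm y ^+ 2.
  by rewrite mulr_ge0 ?sqr_ge0// invr_ge0 mulr_ge0// ltW.
set A := (2 * (1 + c))^-1 * _; set B := \sum_i _ => h4 h5.
by lra.
Qed.

(** The starting point of the iteration: a rescaling of the a_i brings \sum_i a_i a_i^* within
    distance q < 1 of the identity. *)
Lemma TRO_contractive_defect : rprod M (bid K) ->
  exists n (m : 'I_n -> bop H K), (forall i, M (m i)) /\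
    exists2 q : R, 0 <= q < 1 & nm (defect m) <= q.
Proof.
move=> /TRO_lower_bound[n [a [Ma [d d0 dP]]]].
pose h := \sum_i a i *o adj (a i); pose L := nm h.
have L0 : 0 <= L ^+ 2 := sqr_ge0 _.
(* Since h >= d and |h| = L, |y - s h y|^2 <= (1 - 2 s d + s^2 L^2) |y|^2. This s satisfies s L^2 <=
   d, which leaves 1 - s d; the summand d^2 keeps the denominator positive and gives s d <= 1. *)
pose s := d / (L ^+ 2 + d ^+ 2).
have D0 : 0 < L ^+ 2 + d ^+ 2 by rewrite ltr_wpDl// exprn_gt0.
have s0 : 0 < s by rewrite divr_gt0.
exists n, (fun i => (Num.sqrt s)%:C *: a i); split=> [i|]; first exact: subspaceZ.
have sd1 : s * d <= 1.
  by rewrite /s mulrAC ler_pdivrMr// mul1r -expr2 lerDr.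
exists (Num.sqrt (1 - s * d)).
  rewrite sqrtr_ge0/= -[ltRHS]sqrtr1 ltr_sqrt ?ltr01//.
  by rewrite gtrBl mulr_gt0.
have -> : defect (fun i => (Num.sqrt s)%:C *: a i) = bid K - s%:C *: h.
  rewrite /defect scaler_sumr; congr (_ - _); apply: eq_bigr => i _.
  rewrite adjZ compZl compZr scalerA conjc_real -rmorphM -expr2 sqr_sqrtr//.
  exact: ltW.
apply: nm_bop_le => [|y]; first exact: sqrtr_ge0.
rewrite -(@ler_pXn2r _ 2) ?nnegrE ?mulr_ge0 ?nm_ge0 ?sqrtr_ge0//.
rewrite exprMn sqr_sqrtr ?subr_ge0// bopBE bopZE nmD_sqr nmN nmZ cm_real.
rewrite dotNr ReN dotZr conjc_real ReZ exprMn real_normK ?num_real//.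
have -> : complex.Re (dot y (h y)) = \sum_i nm (adj (a i) y) ^+ 2.
  rewrite bop_sumE dot_sumr Re_sum; apply: eq_bigr => i _ /=.
  by rewrite -adjPl dot_nm.
have h1 := dP y; have h2 : nm (h y) ^+ 2 <= L ^+ 2 * nm y ^+ 2.
  by rewrite -exprMn ler_pXn2r ?nnegrE ?mulr_ge0 ?nm_ge0// nm_bop.
have h3 : s ^+ 2 * nm (h y) ^+ 2 <= s * d * nm y ^+ 2.
  apply: (@le_trans _ _ (s ^+ 2 * (L ^+ 2 * nm y ^+ 2))).
    by rewrite ler_wpM2l// sqr_ge0.
  rewrite (_ : s ^+ 2 * _ = s * (s * L ^+ 2) * nm y ^+ 2); last by ring.
  rewrite ler_wpM2r ?sqr_ge0// ler_wpM2l ?(ltW s0)//.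
  by rewrite /s mulrAC ler_pdivrMr// ler_wpM2l ?(ltW d0)// lerDl sqr_ge0.
have h4 : s * (d * nm y ^+ 2) <= s * \sum_i nm (adj (a i) y) ^+ 2.
  by rewrite ler_wpM2l// ltW.
rewrite bidE.
by lra.
Qed.

Let TRO_mul a b c : M a -> M b -> M c -> M (a *o adj b *o c).
Proof. by case: troM => _; apply. Qed.

(* With e = defect m this is m' = (1 + e / 2) m, one step of the Newton
   iteration for the inverse square root of \sum_i m_i m_i^*.  It stays in M, its
   defect is 3/4 e^2 + 1/4 e^3, and no functional calculus is needed. *)
Definition frame_step n (m : 'I_n -> bop H K) (i : 'I_n) : bop H K :=
  m i + 2^-1 *: (defect m *o m i).

Lemma frame_step_in n (m : 'I_n -> bop H K) :
  (forall i, M (m i)) -> forall i, M (frame_step m i).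
Proof.
move=> Mm i; apply: subspaceD => //; apply: subspaceZ => //.
rewrite compBl comp1l comp_suml; apply: subspaceB => //.
by apply: subspace_sum => // j _; exact: TRO_mul.
Qed.

Lemma defect_step n (m : 'I_n -> bop H K) (e := defect m) :
  defect (frame_step m) = (3 / 4) *: (e *o e) + 4^-1 *: (e *o e *o e).
Proof.
pose G := bid K + 2^-1 *: e.
have -> : defect (frame_step m) = bid K - G *o (bid K - e) *o G.
  have -> : bid K - e = \sum_i m i *o adj (m i) by rewrite /e /defect subKr.
  rewrite comp_sumr comp_suml; congr (_ - _); apply: eq_bigr => i _.
  have -> : frame_step m i = G *o m i by rewrite compDl comp1l compZl.
  rewrite adj_comp adjD adjZ adj_bid adj_defect conjc_inv conjc_nat.
  by rewrite !compA.
(* Tested on vectors, the operator identity becomes one between scalars, which [field] settles. *)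
apply: bop_dot_eq => x z; rewrite {}/G.
move: (e) => {}e; rewrite !(bcompE, bidE, bopDE, bopNE, bopZE, bopD, bopZ, bopN).
rewrite !(dotDl, dotZl, dotNl).
by field.
Qed.

(** As |e| <= 1, the new defect is at most 3/4 |e|^2 + 1/4 |e|^3 <= |e|^2. The convergence is
    quadratic, but a geometric rate is enough for the limit. *)
Lemma nm_defect_step n (m : 'I_n -> bop H K) q : q <= 1 ->
  nm (defect m) <= q -> nm (defect (frame_step m)) <= q * nm (defect m).
Proof.
move=> q1; rewrite defect_step; set e := defect m => eq.
have e0 := nm_ge0 e; have h1 := nm_comp e e.
have h2 : nm (e *o e *o e) <= nm e * nm e.
  rewrite (le_trans (nm_comp _ _))//.
  rewrite -[leRHS]mulr1 ler_pM ?nm_ge0//; exact: le_trans q1.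
have h3 : nm e * nm e <= q * nm e by rewrite ler_wpM2r.
rewrite (le_trans (nmD _ _))// !nmZ cmM cm_natV.
have -> : cm (3 : R[i]) = 3.
  by rewrite -(rmorph_nat (real_complex R))/= cm_real ger0_norm.
by lra.
Qed.

(** With e the defect, m_i m_i^* <= 1 - e <= 2. The bound 2 instead of its square root keeps the
    later constants rational. *)
Lemma frame_bound n (m : 'I_n -> bop H K) i :
  nm (defect m) <= 1 -> nm (m i) <= 2.
Proof.
move=> e1; rewrite -nm_adj; apply: nm_bop_le => // y.
rewrite -(@ler_pXn2r _ 2) ?nnegrE ?mulr_ge0 ?nm_ge0// exprMn.
have h1 : nm (adj (m i) y) ^+ 2 <= \sum_j nm (adj (m j) y) ^+ 2.
  by rewrite (bigD1 i)//= lerDl sumr_ge0// => j _; exact: sqr_ge0.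
have h2 : - complex.Re (dot (defect m y) y) <= nm y ^+ 2.
  rewrite (le_trans (ler_nRe_cm _))// (le_trans (dot_CS _ _))//.
  rewrite expr2 ler_wpM2r ?nm_ge0//.
  by rewrite (le_trans (nm_bop _ _))// -[leRHS]mul1r ler_wpM2r ?nm_ge0.
move: h2; rewrite defect_dot/= => h2.
have := sqr_ge0 (nm y).
by lra.
Qed.

Lemma TRO_frame : rprod M (bid K) -> exists n (m : 'I_n -> bop H K),
  (forall i, closure M (m i)) /\ \sum_i m i *o adj (m i) = bid K.
Proof.
move=> /TRO_contractive_defect[n [m0 [Mm0 [q /andP[q0 q1] m0q]]]].
pose m k := iter k (@frame_step n) m0.
have Mm k i : M (m k i).
  by elim: k i => [|k IH]//=; exact: frame_step_in.
have mq k : nm (defect (m k)) <= q ^+ k * q.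
  elim: k => [|k IH]; first by rewrite expr0 mul1r.
  apply: (@le_trans _ _ (q * nm (defect (m k)))).
    apply: nm_defect_step; first exact: ltW.
    by rewrite (le_trans IH)// ler_piMl// exprn_ile1// ltW.
  by rewrite exprS -mulrA ler_wpM2l.
have m1 k : nm (defect (m k)) <= 1.
  by rewrite (le_trans (mq k))// mulr_ile1 ?exprn_ge0 ?exprn_ile1// ltW.
(* The increments e m_i / 2 have norm at most q^k, because |m_i| <= 2. *)
have /choice[w wP] i : exists w, seq_lim (fun k => m k i) w.
  apply: bop_complete; apply: (@cauchy_geometric _ _ _ 1 q); first by rewrite q0.
  move=> k; rewrite mul1r [m k.+1]/= /frame_step addrC addKr nmZ.
  rewrite cm_natV.
  rewrite ler_pdivrMl// (le_trans (nm_comp _ _))// mulrC.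
  rewrite ler_pM ?nm_ge0// ?frame_bound// (le_trans (mq k))//.
  by rewrite ler_piMr ?exprn_ge0 ?(ltW q1).
exists n, w; split=> [i|].
  apply/closureP => e /(wP i)[N NP]; exists (m N i) => //; exact: NP.
apply/eqP; rewrite -subr_eq0 -oppr_eq0 opprB; apply/eqP/nm_le0 => e e0.
have w2 i : nm (w i) <= 2.
  apply/ler_addgt0Pr => d /(wP i)[N NP].
  rewrite -[w i](subrK (m N i)) (le_trans (nmD _ _))// addrC lerD//.
    by rewrite frame_bound.
  by rewrite ltW// NP.
(* Each of the n summands below costs four times this amount; the extra 1 covers n = 0. *)
have d0 : 0 < e / 2 / (4 * n%:R + 1).
  by rewrite !divr_gt0// ltr_wpDl// mulr_ge0.
have /choice[N NP] := fun i => wP i _ d0.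
have [N' NP'] := expr_small q0 q1 (divr_gt0 e0 (ltr0n R 2)).
pose k := maxn (\max_i N i)%N N'.
have wk i : nm (w i - m k i) <= e / 2 / (4 * n%:R + 1).
  by rewrite ltW// NP// (leq_trans _ (leq_maxl _ _))// leq_bigmax.
rewrite -/(defect w).
have -> : defect w = defect (m k) -
    \sum_i ((w i - m k i) *o adj (w i) + m k i *o adj (w i - m k i)).
  rewrite /defect -addrA -opprD -big_split/=; congr (_ - _); apply: eq_bigr => i _.
  by rewrite compBl adjB compBr [X in _ + X]addrA subrK addrC subrK.
rewrite [leRHS]splitr (le_trans (nmD _ _))// nmN lerD//.
  rewrite (le_trans (mq k))// (le_trans _ (ltW (NP' k (leq_maxr _ _))))//.
  by rewrite ler_piMr ?exprn_ge0 ?(ltW q1).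
rewrite (le_trans (nm_sum _ _ _))//.
apply: (@le_trans _ _ (\sum_(i < n) 4 * (e / 2 / (4 * n%:R + 1)))).
  apply: ler_sum => i _; rewrite (le_trans (nmD _ _))//.
  have h1 : nm ((w i - m k i) *o adj (w i)) <= e / 2 / (4 * n%:R + 1) * 2.
    by rewrite (le_trans (nm_comp _ _))// ler_pM ?nm_ge0// nm_adj.
  have h2 : nm (m k i *o adj (w i - m k i)) <= 2 * (e / 2 / (4 * n%:R + 1)).
    by rewrite (le_trans (nm_comp _ _))// ler_pM ?nm_ge0// ?nm_adj// frame_bound.
  by move: h1 h2; set d := e / 2 / _; lra.
rewrite sumr_const card_ord -[leLHS]mulr_natl.
rewrite (_ : n%:R * _ = e / 2 * (4 * n%:R / (4 * n%:R + 1))); last by ring.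
rewrite ger_pMr ?divr_gt0// ler_pdivrMr ?mul1r ?lerDl//.
by rewrite ltr_wpDl// mulr_ge0.
Qed.

End TROFrame.

(* Otherwise [/=] unfolds the vector space structure of the operators. *)
Local Arguments bval : simpl never.

(** * Unital completely positive maps *)

Section MatrixPositivity.
Variable R : realType.
Implicit Types H K : hilbertType R.

(** Two vector arguments allow polarization. The index type is an arbitrary [finType] because the
    amplified frame representation is indexed by pairs. *)
Definition mxform H (I : finType) (X : I -> I -> bop H H) (xi zeta : I -> H) : R[i] :=
  \sum_i \sum_j dot (X i j (xi j)) (zeta i).

Lemma mxformDl H (I : finType) (X : I -> I -> bop H H) (a : R[i]) x y z :
  mxform X (fun i => a *: x i + y i) z = a * mxform X x z + mxform X y z.
Proof.
rewrite /mxform mulr_sumr -big_split/=; apply: eq_bigr => i _.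
rewrite mulr_sumr -big_split/=; apply: eq_bigr => j _.
by rewrite bopD bopZ dotP.
Qed.

Lemma mxformDr H (I : finType) (X : I -> I -> bop H H) (a : R[i]) x y z :
  mxform X z (fun i => a *: x i + y i) = conjc a * mxform X z x + mxform X z y.
Proof.
rewrite /mxform mulr_sumr -big_split/=; apply: eq_bigr => i _.
rewrite mulr_sumr -big_split/=; apply: eq_bigr => j _.
by rewrite dotDr dotZr.
Qed.

Lemma mxform_delta H (I : finType) (X : I -> I -> bop H H) i j x y :
  mxform X (fun k => if k == j then x else 0) (fun k => if k == i then y else 0)
  = dot (X i j x) y.
Proof.
rewrite /mxform (bigD1 i)//= eqxx [X in _ + X]big1 ?addr0 => [|k /negPf ki].
  rewrite (bigD1 j)//= eqxx big1 ?addr0// => k /negPf kj.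
  by rewrite kj bop0 dot0l.
by rewrite big1// => l _; rewrite ki dot0r.
Qed.

Lemma mxform_adj H (I : finType) (X : I -> I -> bop H H) :
  (forall xi, 0 <= mxform X xi xi) -> forall i j, adj (X i j) = X j i.
Proof.
move=> X0 i j; apply: adj_unique => x y; rewrite [RHS]dotC.
rewrite -(mxform_delta X i j) -(mxform_delta X j i).
set u := fun k => _; set v := fun k => _.
(* The cross terms of the form at a v + u. The form is real there and at u and v, so their imaginary
   part vanishes; a = 1 and a = 'i then give hermitian symmetry. *)
have q (a : R[i]) : complex.Im (conjc a * mxform X u v + a * mxform X v u) = 0.
  have := ger0_Im (X0 (fun i => a *: v i + u i)).
  rewrite mxformDl !mxformDr; have := ger0_Im (X0 u); have := ger0_Im (X0 v).
  case: a => a a'; case: (mxform X u u) (mxform X v v) => [b b'] [c c'] /= -> ->.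
  case: (mxform X u v) (mxform X v u) => [d d'] [e e'] /=.
  by rewrite !mulr0; lra.
have := q 1; have := q 'i.
case: (mxform X u v) (mxform X v u) => [d d'] [e e'] /= h1 h2.
by congr (_ +i* _); move: h1 h2; rewrite !mulNr !(mul0r, mul1r, oppr0); lra.
Qed.

Lemma mxposE H n (X : 'M[bop H H]_n) :
  mxpos X <-> forall xi, 0 <= mxform (fun i j => X i j) xi xi.
Proof. by []. Qed.

Lemma mxpos_map_form H K n (X : 'M[bop H H]_n) (f : bop H H -> bop K K) :
  mxpos (map_mx f X) <-> forall xi, 0 <= mxform (fun i j => f (X i j)) xi xi.
Proof.
have E xi : \sum_i \sum_j dot (map_mx f X i j (xi j)) (xi i) =
    mxform (fun i j => f (X i j)) xi xi.
  by apply: eq_bigr => i _; apply: eq_bigr => j _; rewrite mxE.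
by split=> X0 xi; have := X0 xi; rewrite E.
Qed.

End MatrixPositivity.

Section UCP.
Variables (R : realType) (H K : hilbertType R).
Variables (E : set (bop H H)) (f : bop H H -> bop K K).
Hypothesis osE : operator_system E.
Hypothesis f_ucp : ucp E f.

Let sE : subspace E. Proof. by case: osE. Qed.
Let Eadj s : E s -> E (adj s). Proof. by case: osE => _ /(_ s). Qed.
Let E1 : E (bid H). Proof. by case: osE. Qed.

Lemma ucpD s t : E s -> E t -> f (s + t) = f s + f t.
Proof. by case: f_ucp => /(_ 1 s t) + _ _ => fl /fl /[apply]; rewrite !scale1r. Qed.

Lemma ucp0 : f 0 = 0.
Proof.
have E0 : E 0 by case: sE.
by have /eqP := ucpD E0 E0; rewrite addr0 addrC -subr_eq subrr eq_sym => /eqP.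
Qed.

Lemma ucpZ a s : E s -> f (a *: s) = a *: f s.
Proof.
move=> Es; have E0 : E 0 by case: sE.
by case: f_ucp => /(_ a s 0 Es E0) + _ _; rewrite ucp0 !addr0.
Qed.

Lemma ucp1 : f (bid H) = bid K. Proof. by case: f_ucp. Qed.

Lemma ucpB s t : E s -> E t -> f (s - t) = f s - f t.
Proof.
move=> Es Et; rewrite ucpD//; last exact: subspaceN.
by rewrite -scaleN1r ucpZ// scaleN1r.
Qed.

(** The matrix with rows (c, s) and (s^*, c) is positive as soon as |s| <= c. Positivity of its
    image yields both that f commutes with adjoints and that f is contractive. *)
Let pos2 s (c : R) : E s -> nm s <= c ->
  forall xi : 'I_2 -> K, 0 <= mxform (fun i j => if i == j then c%:C *: bid K else
    if i == ord0 then f s else f (adj s)) xi xi.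
Proof.
move=> Es sc; pose X : 'M[bop H H]_2 := \matrix_(i, j)
  if i == j then c%:C *: bid H else if i == ord0 then s else adj s.
have [_ f1 /(_ 2%N X)] := f_ucp.
have EX i j : E (X i j).
  rewrite mxE; case: eqP => _; first exact: subspaceZ.
  by case: eqP => _ //; exact: Eadj.
move=> /(_ EX) fX; have /fX : mxpos X.
  move=> xi.
  rewrite !big_ord_recl !big_ord0 !mxE/= !addr0.
  set x := xi ord0; set y := xi (lift ord0 ord0).
  rewrite !bopZE !bidE adjPl !dotZl !dot_nm (dotC x (s y)).
  rewrite [leRHS](_ : _ = (c * nm x ^+ 2 + 2 * complex.Re (dot (s y) x)
      + c * nm y ^+ 2)%:C); last first.
    by rewrite !realcD mul2C -addcJ !(realcM c) !addrA.
  rewrite ler0c; have := ler_nRe_cm (dot (s y) x).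
  have : cm (dot (s y) x) <= c * nm y * nm x.
    rewrite (le_trans (dot_CS _ _))// ler_wpM2r ?nm_ge0//.
    by rewrite (le_trans (nm_bop _ _))// ler_wpM2r ?nm_ge0.
  have := sqr_ge0 (nm x - nm y); have := le_trans (nm_ge0 s) sc.
  by nra.
move=> /mxpos_map_form {}fX xi.
rewrite (_ : mxform _ _ _ = mxform (fun i j => f (X i j)) xi xi); first exact: fX.
apply: eq_bigr => i _; apply: eq_bigr => j _; congr (dot (bval _ _) _); rewrite mxE.
by case: ifP => _; [rewrite ucpZ// f1|case: ifP].
Qed.

Lemma ucp_adj s : E s -> f (adj s) = adj (f s).
Proof.
move=> Es; have /mxform_adj/(_ ord0 (lift ord0 ord0)) := pos2 Es (lexx _).
by rewrite /=.
Qed.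

Lemma ucp_contractive s : E s -> nm (f s) <= nm s.
Proof.
(* The e > 0 makes c invertible even if s = 0. *)
move=> Es; apply/ler_addgt0Pr => e e0; set c := nm s + e.
have c0 : 0 < c by rewrite ltr_wpDl ?nm_ge0.
apply: nm_bop_le => [|y]; first exact: ltW.
have sc : nm s <= c by rewrite lerDl ltW.
(* The first coordinate minimizes the form for the given y; the minimum is (c^2 |y|^2 - |f(s) y|^2)
   / c. *)
have := pos2 Es sc (fun i => if i == ord0 then (- c^-1)%:C *: f s y else y).
rewrite /mxform !big_ord_recl !big_ord0/= !addr0 ucp_adj// adjPl.
rewrite !(bopZE, bidE, dotZl, dotZr, conjc_real, dot_nm) -!realcM -!realcD.
rewrite ler0c; set w := nm (f s y); set v := nm y.
rewrite [leRHS](_ : _ = c^-1 * ((c * v) ^+ 2 - w ^+ 2)); last by field; rewrite gt_eqF.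
rewrite pmulr_rge0 ?invr_gt0// subr_ge0 ler_pXn2r ?nnegrE ?mulr_ge0 ?nm_ge0//.
exact: ltW.
Qed.

(* The complete positivity of [f] is tested on the matrix [r_i^* r_j] for the
   row r = (1, a^*, s), with s^* s replaced by its upper bound (nm s)^2, which
   keeps the entries in E. *)
Lemma ucp_multiplicative a s : E a -> E s -> E (a *o s) -> E (a *o adj a) ->
  f (a *o adj a) = f a *o adj (f a) -> f (a *o s) = f a *o f s.
Proof.
move=> Ea Es Eas Eaa faa; pose c := (nm s ^+ 2)%:C.
pose X : 'M[bop H H]_3 := \matrix_(i, j) nth 0 (nth [::]
  [:: [:: bid H; adj a; s]; [:: a; a *o adj a; a *o s];
      [:: adj s; adj s *o adj a; c *: bid H]] i) j.
have EX i j : E (X i j).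
  rewrite mxE; have Esa : E (adj s *o adj a) by rewrite -adj_comp; exact: Eadj.
  case: i => [[|[|[|//]]] ?]; case: j => [[|[|[|//]]] ?] //=;
    by [exact: Eadj|exact: subspaceZ].
have [_ f1 /(_ 3%N X EX) fX] := f_ucp.
have /fX : mxpos X.
  move=> xi; rewrite !big_ord_recl !big_ord0 !mxE/= !addr0.
  set x := xi ord0; set y := xi (lift ord0 ord0).
  set z := xi (lift ord0 (lift ord0 ord0)).
  rewrite [leRHS](_ : _ = dot (x + adj a y + s z) (x + adj a y + s z)
      + (c * dot z z - dot (s z) (s z))).
    rewrite !dot_nm -rmorphM/= -rmorphB/= -rmorphD/= ler0c addr_ge0 ?sqr_ge0//.
    by rewrite subr_ge0 -exprMn ler_pXn2r ?nnegrE ?mulr_ge0 ?nm_ge0 ?nm_bop.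
  rewrite !(bcompE, bopZE, bidE, adjPl s, adjP a, dotDl, dotDr, dotZl).
  by ring.
move=> /mxpos_map_form {}fX.
have key x y : complex.Re (dot ((f (a *o s) - f a *o f s) x) y) = 0.
  apply: (@quadratic_ge0 _ (nm s ^+ 2 * nm x ^+ 2)).
    by rewrite mulr_ge0 ?sqr_ge0.
  (* With - f(a)^* y in the first place, the terms in y alone cancel by f(a a^* ) = f(a) f(a)^*.
     What remains is a quadratic in t without constant term, so its linear coefficient vanishes. *)
  move=> t; have := fX (fun i => nth 0 [:: - adj (f a) y; y; t%:C *: x] i).
  rewrite /mxform !big_ord_recl !big_ord0 !mxE/= !addr0.
  rewrite -adj_comp !ucp_adj// ucpZ// f1 faa.
  set u := adj (f a) y; set g := f s; set h := f (a *o s); set w := (h - f a *o g) x.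
  rewrite [leRHS](_ : _ = (t ^+ 2 * (nm s ^+ 2 * nm x ^+ 2))%:C +
      (t%:C * dot w y + conjc (t%:C * dot w y))).
    by rewrite addcJ ReZ -mul2C -realcD ler0c (mulrA 2).
  have wE : dot w y = dot (h x) y - dot (g x) u.
    by rewrite /w bopBE bcompE dotBl (adjP (f a)).
  have aE v : dot (f a v) y = dot v u by rewrite adjP.
  have aE' v : dot y (f a v) = dot u v by rewrite -adjPl.
  have tE (r r' : R) : (t ^+ 2 * (r * r'))%:C = t%:C * t%:C * (r%:C * r'%:C).
    by rewrite expr2 !realcM.
  rewrite conjcM conjc_real wE conjcD conjcN -!dotC tE -dot_nm -/c !bcompE -/u.
  clearbody u; rewrite !(bopZE, bidE, adjPl g, adjPl h, bopN, dotNl, dotNr, bopZ).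
  rewrite !(dotZl, dotZr, conjc_real, aE, aE', adjPl g, adjPl h, bopN, dotNl, dotNr, bopZ).
  by ring.
apply: bop_dot_eq => x y; apply/eqP; rewrite -subr_eq0 -dotBl -bopBE; apply/eqP.
apply: Re_eq0_complex; first exact: key.
by rewrite -dotZl -bopZ; exact: key.
Qed.

End UCP.

(** * Extension of completely positive maps to norm closures *)

Section CPClosure.
Variable R : realType.
Implicit Types H K : hilbertType R.

Lemma complex_ge0_lim (w : R[i]) :
  (forall e : R, 0 < e -> exists2 z : R[i], 0 <= z & cm (w - z) <= e) -> 0 <= w.
Proof.
move=> wz; suff : complex.Im w = 0 /\ 0 <= complex.Re w.
  by case: w {wz} => a b /= [-> a0]; rewrite ler0c.
have ImRe (z : R[i]) : `|complex.Im z| <= cm z.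
  have i1 : cm ('i : R[i]) = 1.
    by rewrite /cm normc_def/= expr0n expr1n add0r sqrtr1.
  rewrite -[cm z]mul1r -i1 -cmM (le_trans _ (ler_normRe_cm _))//.
  by case: z => a b /=; rewrite mul0r mul1r sub0r normrN.
split.
  apply/eqP; rewrite -normr_le0; apply/ler_addgt0Pr => e /wz[z z0 wze].
  rewrite add0r (le_trans _ wze)// (le_trans _ (ImRe _))//.
  have := ger0_Im z0; case: w {wz wze} => a b; case: z {z0} => c d /= ->.
  by rewrite oppr0 addr0.
apply/ler_addgt0Pr => e /wz[z z0 wze].
have := le_trans (ler_nRe_cm _) wze; rewrite ReD ReN.
have : 0 <= complex.Re z by move: z0; rewrite lecE => /andP[].
by lra.
Qed.

Lemma mxformB H (I : finType) (X Y : I -> I -> bop H H) x y :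
  mxform (fun i j => X i j - Y i j) x y = mxform X x y - mxform Y x y.
Proof.
rewrite /mxform -sumrB; apply: eq_bigr => i _; rewrite -sumrB.
by apply: eq_bigr => j _; rewrite bopBE dotBl.
Qed.

Lemma cm_mxform H (I : finType) (X : I -> I -> bop H H) (c : R) x :
  (forall i j, nm (X i j) <= c) ->
  cm (mxform X x x) <= c * #|I|%:R * \sum_i nm (x i) ^+ 2.
Proof.
move=> Xc; rewrite (le_trans (cm_sum _ _ _))//.
apply: (@le_trans _ _ (\sum_i \sum_j c * ((nm (x i) ^+ 2 + nm (x j) ^+ 2) / 2))).
  apply: ler_sum => i _; rewrite (le_trans (cm_sum _ _ _))// ler_sum// => j _.
  have c0 : 0 <= c := le_trans (nm_ge0 _) (Xc i j).
  rewrite (le_trans (dot_CS _ _))//.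
  apply: (@le_trans _ _ (c * nm (x j) * nm (x i))).
    by rewrite ler_wpM2r ?nm_ge0// (le_trans (nm_bop _ _))// ler_wpM2r ?nm_ge0.
  rewrite -mulrA ler_wpM2l// -subr_ge0.
  rewrite (_ : _ - _ = (nm (x i) - nm (x j)) ^+ 2 / 2); last by field.
  by rewrite divr_ge0 ?sqr_ge0.
rewrite le_eqVlt; apply/orP; left; apply/eqP.
under eq_bigr do rewrite -mulr_sumr -mulr_suml big_split/= sumr_const -[_ *+ #|_|]mulr_natl.
rewrite -mulr_sumr -mulr_suml big_split/= sumr_const -[_ *+ #|_|]mulr_natl -mulr_sumr.
by set s := \sum_i _; field.
Qed.

Lemma mxform_real H (I : finType) (X : I -> I -> bop H H) :
  (forall i j, adj (X i j) = X j i) ->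
  forall x, complex.Im (mxform X x x) = 0.
Proof.
move=> XC x; have : conjc (mxform X x x) = mxform X x x.
  rewrite /mxform (raddf_sum (@conjc R)) [RHS]exchange_big/=.
  apply: eq_bigr => i _; rewrite (raddf_sum (@conjc R))/=.
  by apply: eq_bigr => j _; rewrite -dotC -adjPl XC.
by case: (mxform X x x) => a b [] /=; lra.
Qed.

(** Approximating the entries of a positive matrix over the closure destroys positivity. It is
    restored by symmetrizing the approximation and adding a small multiple of the identity that
    dominates the error. *)
Lemma cp_closure H K (E : set (bop H H)) (p : bop H H -> bop K K) :
  operator_system E -> ucp E p -> linear_on (closure E) p ->
  (forall x, closure E x -> nm (p x) <= nm x) -> ucp (closure E) p.
Proof.
move=> [sE Eadj E1] [pl p1 pcp] plin pc; split=> // n X EX X0.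
have Xadj : forall i j, adj (X i j) = X j i.
  exact: (@mxform_adj R H 'I_n (fun i j => X i j) X0).
apply/mxpos_map_form => xi; apply: complex_ge0_lim => e e0.
pose s := \sum_i nm (xi i) ^+ 2.
have s0 : 0 <= s by rewrite sumr_ge0// => i _; exact: sqr_ge0.
pose N : R := n%:R; have N0 : 0 <= N by [].
(* The entries of X - Z will have norm at most (1 + N) d, so by [cm_mxform] the total error is (1 +
   N) d N s <= e. *)
pose d := e / ((1 + N) * N * s + 1).
have D0 : 0 < (1 + N) * N * s + 1 by rewrite ltr_wpDl// !mulr_ge0// addr_ge0.
have d0 : 0 < d by rewrite divr_gt0.
have YP (ij : 'I_n * 'I_n) : exists y, E y /\ nm (X ij.1 ij.2 - y) < d.
  by have /closureP/(_ d d0)[y] := EX ij.1 ij.2; exists y.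
have /choice[Y {}YP] := YP.
(* The error W of the symmetrized approximation has entries of norm at most d, hence its form is at
   most N d times the sum of the |eta_i|^2: this is the multiple of 1 put on the diagonal. *)
pose Z : 'M[bop H H]_n := \matrix_(i, j)
  (2^-1 *: (Y (i, j) + adj (Y (j, i))) + (N * d * (i == j)%:R)%:C *: bid H).
have EZ i j : E (Z i j).
  rewrite mxE; apply: subspaceD => //; apply: subspaceZ => //.
  apply: subspaceD => //; first by case: (YP (i, j)).
  by apply: Eadj; case: (YP (j, i)).
pose W i j := X i j - 2^-1 *: (Y (i, j) + adj (Y (j, i))).
have Wd i j : nm (W i j) <= d.
  have -> : W i j = 2^-1 *: ((X i j - Y (i, j)) + adj (X j i - Y (j, i))).
    rewrite adjB Xadj addrACA -opprD scalerBr; congr (_ - _).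
    by rewrite -[X in _ = _ *: (X + X)]scale1r -scalerDl scalerA mulVf ?scale1r// pnatr_eq0.
  rewrite nmZ cm_natV ler_pdivrMl// (le_trans (nmD _ _))// nm_adj mulr_natl mulr2n.
  by apply: lerD; apply: ltW; [case: (YP (i, j))|case: (YP (j, i))].
have Wadj i j : adj (W i j) = W j i.
  rewrite adjB adjZ adjD adjK Xadj conjc_inv conjc_nat; congr (_ - _ *: _).
  exact: addrC.
have ZE i j : Z i j = X i j - (W i j - (N * d * (i == j)%:R)%:C *: bid H).
  by rewrite mxE opprB addrCA subKr addrC.
have Z0 : mxpos Z.
  apply/mxposE => eta.
  have -> : mxform (fun i j => Z i j) eta eta = mxform (fun i j => X i j) eta eta
      + ((N * d * \sum_i nm (eta i) ^+ 2)%:C - mxform W eta eta).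
    rewrite /mxform (_ : (N * d * _)%:C = \sum_i \sum_j
        dot (((N * d * (i == j)%:R)%:C *: bid H) (eta j)) (eta i)).
      rewrite -sumrB -big_split/=; apply: eq_bigr => i _.
      rewrite -sumrB -big_split/=; apply: eq_bigr => j _.
      by rewrite ZE !bopBE !dotBl opprB.
    rewrite mulr_sumr (raddf_sum (real_complex R))/=; apply: eq_bigr => i _.
    rewrite (bigD1 i)//= eqxx mulr1 bopZE dotZl bidE dot_nm -realcM.
    rewrite big1 ?addr0// => j; rewrite eq_sym => /negPf ->.
    by rewrite mulr0 bopZE scale0r dot0l.
  rewrite addr_ge0//; first exact: X0.
  have := cm_mxform eta Wd; rewrite card_ord -/N (mulrC d).
  have := ler_Re_cm (mxform W eta eta); have := mxform_real Wadj eta.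
  case: (mxform W eta eta) => a b /= -> ab ba.
  by rewrite lecE/= oppr0 addr0 eqxx subr_ge0 (le_trans ab).
exists (mxform (fun i j => p (Z i j)) xi xi).
  by have /mxpos_map_form := pcp _ _ EZ Z0; exact.
rewrite -mxformB.
apply: (@le_trans _ _ (((1 + N) * d) * #|'I_n|%:R * s)).
  apply: cm_mxform => i j.
  have -> : p (X i j) - p (Z i j) = p (X i j - Z i j).
    have Zc : closure E (Z i j) by exact: subset_closure.
    by have := plin (-1) _ _ Zc (EX i j); rewrite !scaleN1r !(addrC (- _)) => ->.
  rewrite (le_trans (pc _ _))//.
    apply: (@subspaceB _ _ (closure E)); [exact: subspace_closure|exact: EX|].
    exact: subset_closure.
  rewrite ZE subKr (le_trans (nmD _ _))// nmN mulrDl mul1r lerD//.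
  have Nd : 0 <= N * d by rewrite mulr_ge0// ltW.
  rewrite nmZ cm_real; case: (i == j); rewrite ?mulr1 ?mulr0 ?normr0 ?mul0r//.
  by rewrite (ger0_norm Nd) -[leRHS]mulr1 ler_wpM2l ?nm_bid_le.
rewrite card_ord -/N /d.
rewrite (_ : _ * s = e * ((1 + N) * N * s / ((1 + N) * N * s + 1))); last by ring.
by rewrite ler_piMr ?(ltW e0)// ler_pdivrMr// mul1r lerDl.
Qed.

End CPClosure.

Section ClosureExtension.
Variables (R : realType) (S : opsys R) (I : injective_envelope S) (H : hilbertType R).
Variables (f : bop (os_space S) (os_space S) -> bop H H).
Hypothesis fP : unital_complete_order_embedding S f.

Let sS : subspace S. Proof. by case: (os_axiom S). Qed.

Lemma embedding_ucp : ucp S f.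
Proof. by case: fP => fl f1 _ fc; split=> // n X SX /(fc n X SX). Qed.

Let osS := os_axiom S.

Lemma embedding_operator_system : operator_system (f @` S).
Proof.
split; last by exists (bid _); [case: osS|case: fP].
  split; first by exists 0; [case: sS|exact: ucp0 osS embedding_ucp].
  move=> a _ _ [s Ss <-] [t St <-]; exists (a *: s + t).
    by case: sS => _; apply.
  by case: fP => + _ _ _; apply.
move=> _ [s Ss <-]; exists (adj s); last exact: ucp_adj osS embedding_ucp _ Ss.
by case: osS => _ + _; apply.
Qed.

Let osE := embedding_operator_system.
Let sE : subspace (f @` S). Proof. by case: osE. Qed.

Variable X : crep I.

Let g (e : bop H H) : bop (os_space S) (os_space S) := xget 0 [set s | os_set S s /\ f s = e].

Let fK s : os_set S s -> g (f s) = s.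
Proof.
move=> Ss; rewrite /g; case: xgetP => [t _ [St]|/(_ s)[]//].
by case: fP => _ _ finj _; apply: finj; rewrite inE.
Qed.

Let phi e := rep_map X (g e).

(** Positivity passes through the inverse of f because a complete order embedding also reflects
    positivity of matrices. *)
Let phi_ucp : ucp (f @` S) phi.
Proof.
have [rl r1 rc] := rep_ucp X; have [fl f1 finj fc] := fP.
split.
- move=> a _ _ [s Ss <-] [t St <-]; rewrite /phi !fK// -fl// fK ?rl//.
  by case: sS => _; apply.
- by rewrite /phi -f1 fK ?r1//; case: osS.
move=> n Y SY Y0; pose Z : 'M[bop (os_space S) (os_space S)]_n := map_mx g Y.
have SZ i j : os_set S (Z i j) by rewrite mxE; have [s Ss <-] := SY i j; rewrite fK.
have -> : map_mx phi Y = map_mx (rep_map X) Z by apply/matrixP => i j; rewrite !mxE.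
apply: rc => //; apply/(fc n Z SZ).
have -> : map_mx f Z = Y; last exact: Y0.
by apply/matrixP => i j; rewrite !mxE; have [s Ss <-] := SY i j; rewrite fK.
Qed.

Lemma rep_contractive s : os_set S s -> nm (rep_map X s) <= nm (f s).
Proof.
move=> Ss; have := ucp_contractive osE phi_ucp (s := f s).
by rewrite /phi fK//; apply; exists s.
Qed.

Lemma rep_lipschitz s t : os_set S s -> os_set S t ->
  nm (rep_map X s - rep_map X t) <= nm (f s - f t).
Proof.
move=> Ss St; rewrite -(ucpB osS (rep_ucp X))// -(ucpB osS embedding_ucp)//.
by apply: rep_contractive; exact: subspaceB.
Qed.

(** The limit does not depend on the approximating sequence, as the universally quantified
    definition of [closure_extension] demands. *)
Let rep_lim (u v : nat -> bop (os_space S) (os_space S)) x y :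
  (forall n, os_set S (u n)) -> (forall n, os_set S (v n)) ->
  seq_lim (fun n => f (u n)) x -> seq_lim (fun n => f (v n)) x ->
  seq_lim (fun n => rep_map X (v n)) y -> seq_lim (fun n => rep_map X (u n)) y.
Proof.
move=> Su Sv ux vx vy e e0; have e3 : 0 < e / 3 by rewrite divr_gt0.
have [N1 P1] := ux _ e3; have [N2 P2] := vx _ e3; have [N3 P3] := vy _ e3.
exists (maxn N1 (maxn N2 N3)) => n; rewrite !geq_max => /and3P[n1 n2 n3].
apply: (le_lt_trans (nmB _ (rep_map X (v n)) _)).
have h : nm (rep_map X (v n) - rep_map X (u n)) <= nm (x - f (v n)) + nm (x - f (u n)).
  apply: (le_trans (rep_lipschitz (Sv n) (Su n))).
  by apply: (le_trans (nmB _ x _)); rewrite (nmBC _ x).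
apply: (le_lt_trans (lerD (lexx _) h)).
apply: (lt_le_trans (ltrD (P3 _ n3) (ltrD (P2 _ n2) (P1 _ n1)))).
by rewrite [leRHS](_ : _ = e / 3 + (e / 3 + e / 3))//; field.
Qed.

Let ce := closure_extension f X.

Let closure_lift x : closure (f @` S) x ->
  exists2 v, forall n, os_set S (v n) & seq_lim (fun n => f (v n)) x.
Proof.
move=> /closure_seq_lim[v0 Sv0 v0x].
have /choice[v vP] : forall n, exists s, os_set S s /\ f s = v0 n.
  by move=> n; have [s] := Sv0 n; exists s.
exists v => [n|e /v0x[N NP]]; first by case: (vP n).
by exists N => n /NP; case: (vP n) => _ ->.
Qed.

(** Along one lift v of x the images under phi are Cauchy. By [rep_lim] their limit has the defining
    property, so the default value of [closure_extension] is not taken on the closure. *)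
Lemma closure_extensionP x : closure (f @` S) x ->
  forall u, (forall n, os_set S (u n)) -> seq_lim (fun n => f (u n)) x ->
    seq_lim (fun n => rep_map X (u n)) (ce x).
Proof.
move=> /closure_lift[v Sv vx].
have [|y vy] := @bop_complete _ _ _ (fun n => rep_map X (v n)).
  move=> e e0; have [|N NP] := vx (e / 2); first by rewrite divr_gt0.
  exists N => m n Nm Nn; rewrite (le_lt_trans (rep_lipschitz _ _))//.
  rewrite (le_lt_trans (nmB _ x _))// [ltRHS]splitr ltrD ?NP//.
  by rewrite nmBC NP.
have ceE : ce x = y.
  rewrite /ce /closure_extension; case: xgetP => [z _ zP|/(_ y)[]].
    apply: seq_lim_unique vy; apply/seq_limP; apply: zP => //.
    exact/seq_limP.
  by move=> u Su /seq_limP ux; apply/seq_limP; exact: rep_lim Su Sv ux vx vy.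
by rewrite ceE => u Su ux; exact: rep_lim Su Sv ux vx vy.
Qed.

Lemma closure_extensionE s : os_set S s -> ce (f s) = rep_map X s.
Proof.
move=> Ss; have sc (V : normedModType R[i]) (x : V) : seq_lim (fun=> x) x.
  by move=> e e0; exists 0%N => n _; rewrite subrr nm0.
apply: (@seq_lim_unique _ _ (fun=> rep_map X s)); last exact: sc.
by apply: (closure_extensionP _ (u := fun=> s)) => //; apply: subset_closure; exists s.
Qed.

Let limP x : closure (f @` S) x -> exists2 u, forall n, os_set S (u n) &
  seq_lim (fun n => f (u n)) x /\ seq_lim (fun n => rep_map X (u n)) (ce x).
Proof.
move=> clx; have [v Sv vx] := closure_lift clx.
by exists v => //; split=> //; exact: closure_extensionP.
Qed.

Let ce_contr x : closure (f @` S) x -> nm (ce x) <= nm x.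
Proof.
move=> /limP[u Su [ux uy]]; apply/ler_addgt0Pr => e e0.
have e2 : 0 < e / 2 by rewrite divr_gt0.
have [N1 P1] := ux _ e2; have [N2 P2] := uy _ e2.
have := P1 (maxn N1 N2) (leq_maxl _ _); have := P2 (maxn N1 N2) (leq_maxr _ _).
set n := maxn _ _; have := rep_contractive (Su n).
have := nmD (ce x - rep_map X (u n)) (rep_map X (u n)).
have := nmD (f (u n) - x) x; rewrite !subrK (nmBC _ x).
by lra.
Qed.

Let ce_linear : linear_on (closure (f @` S)) ce.
Proof.
move=> a x y clx cly; have [u Su [ux ux']] := limP clx; have [v Sv [vy vy']] := limP cly.
have lim (V : normedModType R[i]) (w z : nat -> V) p q :
    seq_lim w p -> seq_lim z q -> seq_lim (fun n => a *: w n + z n) (a *: p + q).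
  move=> wp zq e e0; have a0 : 0 < 1 + cm a by rewrite ltr_pwDl ?cm_ge0.
  have [|N1 P1] := wp (e / 2 / (1 + cm a)); first by rewrite !divr_gt0.
  have [|N2 P2] := zq (e / 2); first by rewrite divr_gt0.
  exists (maxn N1 N2) => n; rewrite geq_max => /andP[/P1 n1 /P2 n2].
  exact: nm_lin_lt.
apply: (@seq_lim_unique _ _ (fun n => rep_map X (a *: u n + v n))).
  apply: closure_extensionP.
  - by have [_] := subspace_closure sE; apply.
  - by move=> n; case: sS => _; apply.
  - have := lim _ _ _ _ _ ux vy => h e /h[N NP]; exists N => n /NP.
    by case: fP => fl _ _ _; rewrite fl.
have := lim _ _ _ _ _ ux' vy' => h e /h[N NP]; exists N => n /NP.
by case: (rep_ucp X) => rl _ _; rewrite rl.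
Qed.

Lemma closure_extension_ucp : ucp (closure (f @` S)) ce.
Proof.
apply: cp_closure => //.
have ceE e : (f @` S) e -> ce e = phi e.
  by move=> [s Ss <-]; rewrite closure_extensionE// /phi fK.
have [pl p1 pc] := phi_ucp; split.
- by move=> a x y Ex Ey; rewrite !ceE ?pl//; case: sE => _; apply.
- by rewrite ceE//; case: osE.
move=> n Y SY Y0; rewrite (_ : map_mx ce Y = map_mx phi Y); first exact: pc.
by apply/matrixP => i j; rewrite !mxE ceE.
Qed.

End ClosureExtension.

(** * The range of a projection in X^n *)

(** The balls of radius 1 / (n + 1) form a countable basis: their centres, chosen so that the balls
    belong to F, form a Cauchy sequence, and F converges to its limit. *)
Lemma seq_complete_cauchy_cvg (R : realType) (V : normedModType R[i]) :
  (forall u : nat -> V, (forall e : R, 0 < e -> exists N : nat, forall m n,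
     (N <= m)%N -> (N <= n)%N -> nm (u m - u n) < e) -> exists x, seq_lim u x) ->
  forall F : set_system V, ProperFilter F -> cauchy F -> cvg F.
Proof.
move=> Vc F PF /cauchyP Fc.
have /choice[u Fu] : forall n : nat, exists x : V, F (ball x (n.+1%:R^-1 : R)%:C).
  by move=> n; apply: Fc; rewrite ltcR invr_gt0.
(* Two members of a proper filter meet. *)
have uD m n : nm (u m - u n) < m.+1%:R^-1 + n.+1%:R^-1.
  have [z [/nm_ball mz /nm_ball nz]] := filter_ex (filterI (Fu m) (Fu n)).
  by rewrite (le_lt_trans (nmB _ z _))// ltrD// nmBC.
have [|x ux] := Vc u.
  move=> e e0; have [|N NP] := @small_invS _ (e / 2); first by rewrite divr_gt0.
  exists N => m n Nm Nn; apply: lt_trans (uD m n) _.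
  by rewrite [ltRHS]splitr ltrD// NP.
apply/cvg_ex; exists x => B /near_nm[e e0 eB].
have e2 : 0 < e / 2 by rewrite divr_gt0.
have [N NP] := ux _ e2; have [N' NP'] := small_invS e2.
pose k := maxn N N'; apply: filterS (Fu k) => z /nm_ball kz; apply: eB.
rewrite (le_lt_trans (nmB _ (u k) _))// [ltRHS]splitr ltrD//.
  by rewrite NP// leq_maxl.
by rewrite (lt_trans kz)// NP'// leq_maxr.
Qed.

Section FrameSpace.
Variables (R : realType) (X : hilbertType R) (n : nat).
Variable P : 'I_n -> 'I_n -> bop X X.

(** Fixed vectors instead of a range: they form a closed subspace for every matrix P, so the Hilbert
    space exists before P is shown to be a projection. *)
Definition fixed_vec : {pred {ffun 'I_n -> X}} :=
  [pred v : {ffun 'I_n -> X} | `[< forall i, \sum_j P i j (v j) = v i >]].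

Lemma fixed_vecP (v : {ffun 'I_n -> X}) :
  reflect (forall i, \sum_j P i j (v j) = v i) (v \in fixed_vec).
Proof. by rewrite inE; exact: asboolP. Qed.

Record frame_space := FrameSpace {
  fs_val :> {ffun 'I_n -> X}; _ : fs_val \in fixed_vec }.

Local Arguments fs_val : simpl never.

HB.instance Definition _ := [isSub for fs_val].
HB.instance Definition _ := [Choice of frame_space by <:].

Fact fixed_vec_submod : submod_closed fixed_vec.
Proof.
split=> [|a v w /fixed_vecP Pv /fixed_vecP Pw].
  by apply/fixed_vecP => i; rewrite big1 ?ffunE// => j _; rewrite ffunE bop0.
apply/fixed_vecP => i; rewrite !ffunE -Pv -Pw scaler_sumr -big_split/=.
by apply: eq_bigr => j _; rewrite !ffunE bopD bopZ.
Qed.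

HB.instance Definition _ :=
  GRing.isSubmodClosed.Build R[i] {ffun 'I_n -> X} fixed_vec fixed_vec_submod.
HB.instance Definition _ := [SubChoice_isSubLmodule of frame_space by <:].

Implicit Types v w : frame_space.

Lemma fs_fixed v i : \sum_j P i j (v j) = v i.
Proof. by have /fixed_vecP := valP v; apply. Qed.

Lemma fs_eq v w : (forall i, v i = w i) -> v = w.
Proof. by move=> vw; apply/val_inj/ffunP. Qed.

Lemma fsDE v w i : fs_val (v + w) i = v i + w i. Proof. exact: ffunE. Qed.
Lemma fsNE v i : fs_val (- v) i = - v i. Proof. exact: ffunE. Qed.
Lemma fsBE v w i : fs_val (v - w) i = v i - w i.
Proof. by rewrite fsDE fsNE. Qed.
Lemma fsZE (a : R[i]) v i : fs_val (a *: v) i = a *: v i. Proof. exact: ffunE. Qed.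

Lemma exists_fs (F : 'I_n -> X) : (forall i, \sum_j P i j (F j) = F i) ->
  exists v, forall i, v i = F i.
Proof.
move=> PF; have Fv : [ffun i => F i] \in fixed_vec.
  by apply/fixed_vecP => i; rewrite ffunE -PF; apply: eq_bigr => j _; rewrite ffunE.
by exists (FrameSpace Fv) => i; rewrite /= ffunE.
Qed.

Definition fs_dot v w : R[i] := \sum_i dot (v i) (w i).

Fact fs_dotP (a : R[i]) (x y z : frame_space) :
  fs_dot (a *: x + y) z = a * fs_dot x z + fs_dot y z.
Proof.
rewrite /fs_dot mulr_sumr -big_split/=; apply: eq_bigr => i _.
by rewrite fsDE fsZE dotP.
Qed.

Fact fs_dotC v w : fs_dot v w = conjc (fs_dot w v).
Proof.
rewrite /fs_dot (raddf_sum (@conjc R)); apply: eq_bigr => i _; exact: dotC.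
Qed.

Lemma fs_dot_nm v : fs_dot v v = (\sum_i nm (v i) ^+ 2)%:C.
Proof.
rewrite (raddf_sum (real_complex R)); apply: eq_bigr => i _; exact: dot_nm.
Qed.

Fact fs_dot_ge0 v : 0 <= fs_dot v v.
Proof. by rewrite fs_dot_nm ler0c sumr_ge0// => i _; exact: sqr_ge0. Qed.

Definition fs_norm v : R := Num.sqrt (complex.Re (fs_dot v v)).

Fact fs_normD v w : (fs_norm (v + w))%:C <= (fs_norm v)%:C + (fs_norm w)%:C.
Proof. by rewrite -realcD lecR; exact: semi_triangle fs_dotP fs_dotC fs_dot_ge0 _ _. Qed.

Fact fs_normZ (a : R[i]) v : (fs_norm (a *: v))%:C = `|a| * (fs_norm v)%:C.
Proof.
rewrite cmE -realcM; congr (_%:C); rewrite /fs_norm !fs_dot_nm/=.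
rewrite -[cm a]ger0_norm ?cm_ge0// -sqrtr_sqr -sqrtrM ?sqr_ge0// mulr_sumr.
by congr Num.sqrt; apply: eq_bigr => i _; rewrite fsZE nmZ exprMn.
Qed.

Fact fs_norm0_eq0 v : (fs_norm v)%:C = 0 -> v = 0.
Proof.
move=> /complexI/eqP; rewrite sqrtr_eq0 fs_dot_nm/= => v0.
apply: fs_eq => i; rewrite -[RHS]/((0 : {ffun 'I_n -> X}) i) ffunE; apply/nm_eq0/eqP.
rewrite -sqrf_eq0 eq_le sqr_ge0 andbT (le_trans _ v0)// (bigD1 i)//= lerDl.
by rewrite sumr_ge0// => j _; exact: sqr_ge0.
Qed.

HB.instance Definition _ := @Lmodule_isNormed.Build R[i] frame_space
  (fun v => (fs_norm v)%:C) fs_normD fs_normZ fs_norm0_eq0.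

Lemma nm_fs v : nm v ^+ 2 = \sum_i nm (v i) ^+ 2.
Proof.
rewrite -[nm v]/(fs_norm v) /fs_norm sqr_sqrtr fs_dot_nm//=.
by rewrite sumr_ge0// => i _; exact: sqr_ge0.
Qed.

Lemma nm_fs_coord v i : nm (v i) <= nm v.
Proof.
rewrite -(@ler_pXn2r _ 2) ?nnegrE ?nm_ge0// nm_fs (bigD1 i)//= lerDl.
by rewrite sumr_ge0// => j _; exact: sqr_ge0.
Qed.

Lemma nm_fs_le v (e : R) : 0 <= e -> (forall i, nm (v i) <= e) -> nm v <= n%:R * e.
Proof.
move=> e0 ve; rewrite -(@ler_pXn2r _ 2) ?nnegrE ?nm_ge0 ?mulr_ge0// nm_fs.
apply: (@le_trans _ _ (\sum_(i < n) e ^+ 2)).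
  by apply: ler_sum => i _; rewrite ler_pXn2r ?nnegrE ?nm_ge0.
rewrite sumr_const card_ord exprMn -[leLHS]mulr_natl ler_wpM2r ?sqr_ge0//.
by rewrite -natrX ler_nat; case: n => // k; rewrite expnS leq_pmulr.
Qed.

(** Limits are taken coordinatewise, and the equations of fixed vectors survive because the P i j
    are bounded. *)
Fact fs_complete (F : set_system frame_space) : ProperFilter F -> cauchy F -> cvg F.
Proof.
apply: seq_complete_cauchy_cvg => u uC.
have /choice[x ux] : forall i, exists x, seq_lim (fun k => u k i) x.
  move=> i; apply: seq_complete => e /uC[N NP]; exists N => k l Nk Nl.
  by rewrite -fsBE (le_lt_trans (nm_fs_coord _ _))// NP.
have [v vx] : exists v, forall i, v i = x i.
  apply: exists_fs => i.
  apply: (@seq_lim_unique _ _ (fun k => u k i)); last exact: ux.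
  move=> e e0; pose c := \sum_j nm (P i j).
  have c0 : 0 < 1 + c by rewrite ltr_wpDr// sumr_ge0// => j _; exact: nm_ge0.
  have /choice[N NP] := fun j => ux j _ (divr_gt0 e0 c0).
  exists (\max_j N j)%N => k Nk; rewrite -fs_fixed -sumrB.
  rewrite (le_lt_trans (nm_sum _ _ _))//.
  apply: (@le_lt_trans _ _ (c * (e / (1 + c)))).
    rewrite /c mulr_suml ler_sum// => j _; rewrite -bopB (le_trans (nm_bop _ _))//.
    by rewrite ler_wpM2l ?nm_ge0// ltW// NP// (leq_trans (leq_bigmax j)).
  by rewrite mulrCA -[ltRHS]mulr1 ltr_pM2l// ltr_pdivrMr// mul1r ltrDr.
exists v => e e0; have c0 : 0 < 1 + n%:R :> R by rewrite ltr_wpDr.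
have /choice[N NP] := fun j => ux j _ (divr_gt0 e0 c0).
exists (\max_j N j)%N => k Nk.
apply: (@le_lt_trans _ _ (n%:R * (e / (1 + n%:R)))).
  apply: nm_fs_le => [|i]; first by rewrite ltW// divr_gt0.
  by rewrite fsBE vx ltW// NP// (leq_trans (leq_bigmax i)).
by rewrite mulrCA -[ltRHS]mulr1 ltr_pM2l// ltr_pdivrMr// mul1r ltrDr.
Qed.

HB.instance Definition _ := Uniform_isComplete.Build frame_space fs_complete.

Fact fs_dot_norm v : fs_dot v v = `|v| ^+ 2.
Proof. by rewrite normE fs_dot_nm -nm_fs rmorphXn. Qed.

HB.instance Definition _ :=
  isHilbert.Build R frame_space fs_dotP fs_dotC fs_dot_norm.

End FrameSpace.

Local Arguments fs_val : simpl never.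

Section MatrixOperator.
Variables (R : realType) (X Y : hilbertType R) (n : nat).
Variables (P : 'I_n -> 'I_n -> bop X X) (P' : 'I_n -> 'I_n -> bop Y Y).
Variable Q : 'I_n -> 'I_n -> bop X Y.

(** The choice operator lets the definition do without a proof that Q sends fixed vectors to fixed
    vectors; [mxopE] asks for it. *)
Definition mxop : bop (frame_space P) (frame_space P') :=
  xget 0 [set T : bop (frame_space P) (frame_space P') |
    forall (v : frame_space P) i, T v i = \sum_j Q i j (v j)].

Lemma mxopE : (forall (v : frame_space P) i,
    \sum_k P' i k (\sum_j Q k j (v j)) = \sum_j Q i j (v j)) ->
  forall v i, mxop v i = \sum_j Q i j (v j).
Proof.
move=> PQ; rewrite /mxop; case: xgetP => [T _ //|noT]; exfalso.
have /choice[f fP] : forall v : frame_space P, exists w : frame_space P',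
    forall i, w i = \sum_j Q i j (v j).
  by move=> v; apply: exists_fs; exact: PQ.
pose c := \sum_i \sum_j nm (Q i j).
have c0 : 0 <= c.
  by rewrite sumr_ge0// => i _; rewrite sumr_ge0// => j _; exact: nm_ge0.
have [a v w||v|T Tf] := @exists_bop R _ _ f (n%:R * c).
- apply: fs_eq => i; rewrite fsDE fsZE !fP scaler_sumr -big_split.
  by apply: eq_bigr => j _; rewrite fsDE fsZE bopD bopZ.
- by rewrite mulr_ge0.
- rewrite -mulrA; apply: nm_fs_le => [|i]; first by rewrite mulr_ge0 ?nm_ge0.
  have ci : \sum_j nm (Q i j) <= c.
    rewrite /c [leRHS](bigD1 i)//= lerDl sumr_ge0// => k _.
    by rewrite sumr_ge0// => j _; exact: nm_ge0.
  rewrite fP (le_trans (nm_sum _ _ _))//.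
  apply: (@le_trans _ _ ((\sum_j nm (Q i j)) * nm v)); last by rewrite ler_wpM2r ?nm_ge0.
  rewrite mulr_suml ler_sum// => j _; rewrite (le_trans (nm_bop _ _))//.
  by rewrite ler_wpM2l ?nm_ge0// nm_fs_coord.
by apply: (noT T) => v i; rewrite Tf fP.
Qed.

End MatrixOperator.

Section MxformReindex.
Variables (R : realType) (H K : hilbertType R).

Lemma ucp_mxform (E : set (bop H H)) (p : bop H H -> bop K K) (I : finType)
    (Y : I -> I -> bop H H) : ucp E p -> (forall i j, E (Y i j)) ->
  (forall x, 0 <= mxform Y x x) -> forall x, 0 <= mxform (fun i j => p (Y i j)) x x.
Proof.
move=> [_ _ pcp] EY Y0 x; pose e : 'I_#|I| -> I := enum_val.
have ebij : bijective e by exact: enum_val_bij.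
have reE (L : hilbertType R) (Z : I -> I -> bop L L) y : mxform Z y y =
    mxform (fun i j => Z (e i) (e j)) (fun i => y (e i)) (fun i => y (e i)).
  rewrite /mxform (reindex e) /=; last exact: onW_bij.
  apply: eq_bigr => i _; rewrite (reindex e) //; exact: onW_bij.
pose Z : 'M[bop H H]_#|I| := \matrix_(i, j) Y (e i) (e j).
have EZ i j : E (Z i j) by rewrite mxE.
have Z0 : mxpos Z.
  have [e' eK e'K] := ebij => y.
  have := Y0 (fun i => y (e' i)); rewrite reE /mxform => h.
  rewrite [leRHS](_ : _ = \sum_i \sum_j dot (Y (e i) (e j) (y (e' (e j)))) (y (e' (e i))))//.
  by apply: eq_bigr => i _; apply: eq_bigr => j _; rewrite mxE !eK.
have /mxpos_map_form pZ := pcp _ _ EZ Z0.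
have := pZ (fun i => x (e i)); rewrite reE; congr (0 <= _).
by apply: eq_bigr => i _; apply: eq_bigr => j _; rewrite mxE.
Qed.

Lemma mxform_pair (I J : finType) (W : I * J -> I * J -> bop H H) x :
  mxform W x x =
  \sum_a \sum_b \sum_i \sum_j dot (W (a, i) (b, j) (x (b, j))) (x (a, i)).
Proof.
under [RHS]eq_bigr do rewrite exchange_big/=.
rewrite /mxform [RHS]pair_bigA/=; apply: eq_bigr => -[a i] _ /=.
by rewrite [RHS]pair_bigA/=; apply: eq_bigr => -[b j] _.
Qed.

End MxformReindex.

(** What the frame construction uses of a representation, once extended to the closure E of the
    image of S. *)
Record module_ucp (R : realType) (H X : hilbertType R) (A E : set (bop H H))
    (p : bop H H -> bop X X) : Prop := ModuleUcp {
  mu_ucp : ucp E p;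
  mu_mul : forall a x, A a -> E x -> p (a *o x) = p a *o p x
}.

(** In the application A is the image of the multiplier algebra, E the closure of the image of S, E'
    the image of T and N the closure of M. The computations below rest on these properties and
    mention no closures or generators. *)
Record frame_data (R : realType) (H K : hilbertType R) (A E : set (bop H H))
    (E' : set (bop K K)) (N : set (bop H K)) n (m : 'I_n -> bop H K) : Prop :=
  FrameData {
  fd_E : operator_system E;
  fd_E' : operator_system E';
  fd_N : subspace N;
  fd_AE : A `<=` E;
  fd_Aadj : forall a, A a -> A (adj a);
  fd_mul : forall a x, A a -> E x -> E (a *o x);
  fd_NN : forall a b, N a -> N b -> A (adj a *o b);
  fd_NEN : forall a t b, N a -> E' t -> N b -> E (adj a *o t *o b);
  fd_m : forall i, N (m i);
  fd_frame : \sum_i m i *o adj (m i) = bid K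
}.

(** * The representation induced by a frame *)

Section FrameModule.
Variables (R : realType) (H K : hilbertType R) (A E : set (bop H H)).
Variables (E' : set (bop K K)) (N : set (bop H K)) (n : nat) (m : 'I_n -> bop H K).
Hypothesis fd : frame_data A E E' N m.
Variables (X : hilbertType R) (p : bop H H -> bop X X).
Hypothesis mu : module_ucp A E p.

Let sE : subspace E. Proof. by case: (fd_E fd). Qed.
Let osE := fd_E fd.
Let pu := mu_ucp mu.

Lemma mu_adj x : E x -> p (adj x) = adj (p x).
Proof. exact: ucp_adj osE pu _. Qed.

(** E and A are selfadjoint, so right multiplication is left multiplication after taking
    adjoints. *)
Lemma fd_mulr x a : E x -> A a -> E (x *o a).
Proof.
move=> Ex Aa; have Eadj s : E s -> E (adj s) by case: osE => _ + _; apply.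
rewrite -(adjK (x *o a)) adj_comp; apply: (Eadj); apply: (fd_mul fd).
  exact: fd_Aadj fd _ Aa.
exact: Eadj.
Qed.

Lemma mu_mulr x a : E x -> A a -> p (x *o a) = p x *o p a.
Proof.
move=> Ex Aa; have Eadj s : E s -> E (adj s) by case: osE => _ + _; apply.
have EA b : A b -> E b by exact: fd_AE fd b.
rewrite -(adjK (x *o a)) mu_adj; last by apply: Eadj; exact: fd_mulr.
rewrite adj_comp (mu_mul mu); [|exact: fd_Aadj fd _ Aa|exact: Eadj].
by rewrite adj_comp !mu_adj ?adjK//; exact: EA.
Qed.

Lemma mu_sum (I : Type) (r : seq I) (F : I -> bop H H) : (forall i, E (F i)) ->
  p (\sum_(i <- r) F i) = \sum_(i <- r) p (F i).
Proof.
move=> EF; suff [] : E (\sum_(i <- r) F i) /\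
  p (\sum_(i <- r) F i) = \sum_(i <- r) p (F i) by [].
elim/big_rec2 : _ => [|i x y _ [Ey <-]].
  by split; [case: sE|exact: ucp0 osE pu].
by split; [exact: subspaceD|rewrite (ucpD pu)].
Qed.

Lemma frame_sum (L L' : hilbertType R) (x : bop K L) (y : bop L' K) :
  \sum_i x *o m i *o (adj (m i) *o y) = x *o y.
Proof.
rewrite -[in RHS](comp1l y) -(fd_frame fd) comp_suml comp_sumr.
by apply: eq_bigr => i _; rewrite !compA.
Qed.

(** p is multiplicative when a factor lies in A. Writing a^* y as the sum of the (a^* m_j) (m_j^* y)
    produces such a factor on the left. *)
Lemma frame_insertl a (y : bop H K) : N a -> (forall b, N b -> E (adj b *o y)) ->
  \sum_j p (adj a *o m j) *o p (adj (m j) *o y) = p (adj a *o y).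
Proof.
move=> Na Ey; rewrite -[in RHS]frame_sum mu_sum => [|i].
  apply: eq_bigr => j _; rewrite (mu_mul mu)//; last exact/Ey/(fd_m fd).
  by apply: (fd_NN fd) => //; exact: (fd_m fd).
apply: (fd_mul fd); last exact/Ey/(fd_m fd).
by apply: (fd_NN fd) => //; exact: (fd_m fd).
Qed.

Lemma frame_insertr a (y : bop K H) : N a -> (forall b, N b -> E (y *o b)) ->
  \sum_j p (y *o m j) *o p (adj (m j) *o a) = p (y *o a).
Proof.
move=> Na Ey; rewrite -[in RHS]frame_sum mu_sum => [|i].
  apply: eq_bigr => j _; rewrite mu_mulr//; first exact/Ey/(fd_m fd).
  by apply: (fd_NN fd) => //; exact: (fd_m fd).
apply: fd_mulr; first exact/Ey/(fd_m fd).
by apply: (fd_NN fd) => //; exact: (fd_m fd).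
Qed.

Let NM a b : N a -> N b -> E (adj a *o b).
Proof. by move=> Na Nb; apply: (fd_AE fd); exact: fd_NN fd _ _ Na Nb. Qed.

Let Nm i : N (m i). Proof. exact: (fd_m fd). Qed.

Let E'D (c : R[i]) s t : E' s -> E' t -> E' (c *: s + t).
Proof. by move=> Es Et; case: (fd_E' fd) => [[_ +] _ _]; apply. Qed.

Definition frame_proj i j := p (adj (m i) *o m j).

Local Notation Y := (frame_space frame_proj).

Definition frame_tau (a : bop H K) (xi : X) : Y :=
  xget 0 [set v : Y | forall i, v i = p (adj (m i) *o a) xi].

(** By [frame_insertl] the vector with coordinates p(m_i^* a) xi is fixed by [frame_proj], so the
    default value is not taken. *)
Lemma frame_tauE a xi i : N a -> frame_tau a xi i = p (adj (m i) *o a) xi.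
Proof.
move=> Na; rewrite /frame_tau; case: xgetP => [v _ //|nov]; exfalso.
have [j|v vE] := @exists_fs _ _ _ frame_proj (fun i => p (adj (m i) *o a) xi).
  rewrite -(@frame_insertl (m j) a)// => [|b Nb]; last exact: NM.
  by rewrite bop_sumE.
exact: (nov v).
Qed.

Lemma frame_tau_linl (c : R[i]) a b xi : N a -> N b ->
  frame_tau (c *: a + b) xi = c *: frame_tau a xi + frame_tau b xi.
Proof.
move=> Na Nb; have sN := fd_N fd.
have Nab : N (c *: a + b) by case: sN => _; apply.
apply: fs_eq => i; rewrite fsDE fsZE !frame_tauE//.
have Ea := NM (Nm i) Na; have Eb := NM (Nm i) Nb.
by rewrite compDr compZr (ucpD pu) ?(ucpZ osE pu)//; exact: subspaceZ.
Qed.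

Lemma frame_tau_linr a : N a -> linear (frame_tau a).
Proof.
move=> Na c x y; apply: fs_eq => i.
by rewrite fsDE fsZE !frame_tauE// bopD bopZ.
Qed.

Lemma frame_tau_balanced a s xi : N a -> A s -> N (a *o s) ->
  frame_tau (a *o s) xi = frame_tau a (p s xi).
Proof.
move=> Na As Nas; apply: fs_eq => i; rewrite !frame_tauE// compA mu_mulr//.
exact: NM.
Qed.

Let dot_frame (F : 'I_n -> bop X X) b xi eta : N b ->
  \sum_i dot (F i xi) (p (adj (m i) *o b) eta) =
  dot ((\sum_i p (adj b *o m i) *o F i) xi) eta.
Proof.
move=> Nb; rewrite bop_sumE dot_suml; apply: eq_bigr => i _; rewrite bcompE.
rewrite -[in RHS](adjK (m i)) -adj_comp mu_adj ?adjPl//.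
by apply: NM => //; exact: Nm.
Qed.

Lemma frame_tau_dot a b xi eta : N a -> N b ->
  dot (frame_tau a xi) (frame_tau b eta) = dot (p (adj b *o a) xi) eta.
Proof.
move=> Na Nb; rewrite -[LHS]/(fs_dot _ _) /fs_dot.
under eq_bigr do rewrite !frame_tauE//.
rewrite (dot_frame (fun i => p (adj (m i) *o a)))// frame_insertl//.
by move=> c Nc; exact: NM.
Qed.

Lemma nm_frame_tau a xi : N a -> nm (frame_tau a xi) <= nm a * nm xi.
Proof.
move=> Na; rewrite -(@ler_pXn2r _ 2) ?nnegrE ?mulr_ge0 ?nm_ge0//.
rewrite -[leLHS]/(complex.Re (nm (frame_tau a xi) ^+ 2)%:C) -dot_nm frame_tau_dot//.
rewrite (le_trans (ler_Re_cm _))// (le_trans (dot_CS _ _))// exprMn.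
rewrite [nm xi ^+ 2]expr2 mulrA ler_wpM2r ?nm_ge0// (le_trans (nm_bop _ _))//.
rewrite ler_wpM2r ?nm_ge0// (le_trans (ucp_contractive osE pu (NM Na Na)))//.
by rewrite (le_trans (nm_comp _ _))// nm_adj expr2.
Qed.

(** A fixed vector v is the sum of the tensors of m_j and v_j. Since m_j is only in the closure of
    M, it is approximated from M, with [nm_frame_tau] controlling the error. *)
Lemma frame_tau_dense (M : set (bop H K)) : M `<=` N -> N `<=` closure M ->
  clspan [set frame_tau a xi | a in M & xi in [set: X]] = [set: Y].
Proof.
move=> MN NM'; apply/seteqP; split=> // v _.
have -> : v = \sum_j frame_tau (m j) (v j).
  have fs_sumE (F : 'I_n -> Y) i : fs_val (\sum_j F j) i = \sum_j F j i.
    elim/big_rec2 : _ => [|j x y _ <-]; last by rewrite fsDE.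
    by rewrite -[fs_val 0]/(0 : {ffun 'I_n -> X}) ffunE.
  apply: fs_eq => i; rewrite fs_sumE -fs_fixed.
  by apply: eq_bigr => j _; rewrite frame_tauE.
apply: subspace_sum => [|j _]; first exact: clspan_subspace.
have /closure_id -> := @clspan_closed R Y [set frame_tau a xi | a in M & xi in [set: X]].
apply/closureP => e e0; have d0 : 0 < 1 + nm (v j) by rewrite ltr_wpDr ?nm_ge0.
have /closureP/(_ _ (divr_gt0 e0 d0))[a Ma ma] := NM' _ (Nm j).
exists (frame_tau a (v j)).
  by apply: sub_clspan; exists a => //; exists (v j).
have Na : N a by exact: MN.
have -> : frame_tau (m j) (v j) - frame_tau a (v j) = frame_tau (m j - a) (v j).
  by rewrite -scaleN1r addrC -frame_tau_linl// scaleN1r addrC.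
have Nma : N (m j - a).
  by apply: (@subspaceB _ _ N) => //; exact: fd_N fd.
rewrite (le_lt_trans (nm_frame_tau _ Nma))//.
apply: (@le_lt_trans _ _ (e / (1 + nm (v j)) * nm (v j))).
  by rewrite ler_wpM2r ?nm_ge0// ltW.
by rewrite mulrAC ltr_pdivrMr// ltr_pM2l// ltrDr.
Qed.

Definition frame_rep (t : bop K K) : bop Y Y :=
  mxop frame_proj frame_proj (fun i j => p (adj (m i) *o t *o m j)).

Lemma frame_repE t v i : E' t ->
  frame_rep t v i = \sum_j p (adj (m i) *o t *o m j) (v j).
Proof.
move=> Et; apply: mxopE => {}v {}i; under eq_bigr do rewrite bop_sum.
rewrite exchange_big; apply: eq_bigr => j _; rewrite -compA.
rewrite -(@frame_insertl (m i) (t *o m j))//; last first.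
  by move=> b Nb; rewrite compA; exact: fd_NEN fd _ _ _ Nb Et (Nm j).
by rewrite bop_sumE; apply: eq_bigr => k _; rewrite bcompE compA.
Qed.

Lemma frame_rep_ucp : ucp E' frame_rep.
Proof.
have MEM i j t : E' t -> E (adj (m i) *o t *o m j).
  by move=> Et; exact: fd_NEN fd _ _ _ (Nm i) Et (Nm j).
split.
- move=> c s t Es Et; apply: bopP => v; apply: fs_eq => i.
  rewrite bopDE bopZE fsDE fsZE !frame_repE//; last exact: E'D.
  rewrite scaler_sumr -big_split; apply: eq_bigr => j _.
  rewrite compDr compZr compDl compZl (ucpD pu) ?(ucpZ osE pu)//.
  - exact: MEM.
  - by apply: subspaceZ => //; exact: MEM.
  - exact: MEM.
- apply: bopP => v; apply: fs_eq => i.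
  (* The unit acts by the matrix [frame_proj], which is the identity on its fixed vectors. *)
  rewrite frame_repE ?bidE -?fs_fixed; last by case: (fd_E' fd).
  by apply: eq_bigr => j _; rewrite comp1r.
move=> k Z EZ Z0; apply/mxpos_map_form => v.
(* W is the compression of Z by the row (m_i), hence positive; the complete positivity of p is then
   applied to W as a single matrix indexed by pairs. *)
pose W (a b : 'I_k * 'I_n) := adj (m a.2) *o Z a.1 b.1 *o m b.2.
have W0 : forall x, 0 <= mxform W x x.
  move=> x; rewrite mxform_pair.
  have := Z0 (fun a => \sum_i m i (x (a, i))); congr (0 <= _).
  apply: eq_bigr => a _; apply: eq_bigr => b _.
  rewrite dot_sumr; apply: eq_bigr => i _; rewrite bop_sum dot_suml.
  by apply: eq_bigr => j _; rewrite /W !bcompE adjPl.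
have := ucp_mxform pu (fun a b => MEM _ _ _ (EZ _ _)) W0 (fun a => v a.1 a.2).
rewrite mxform_pair; congr (0 <= _).
apply: eq_bigr => a _; apply: eq_bigr => b _.
rewrite -[RHS]/(fs_dot _ _); apply: eq_bigr => i _ /=.
by rewrite frame_repE// dot_suml.
Qed.

(** When t^* maps N into itself, (t^* m_i)^* m_k lies in A, and the frame can be inserted between t
    and u. *)
Lemma frame_rep_mul t u : E' t -> E' u -> E' (t *o u) ->
  (forall a, N a -> N (adj t *o a)) ->
  frame_rep (t *o u) = frame_rep t *o frame_rep u.
Proof.
move=> Et Eu Etu Nt; apply: bopP => v; apply: fs_eq => i.
rewrite bcompE !frame_repE//; under [RHS]eq_bigr do rewrite frame_repE// bop_sum.
rewrite exchange_big; apply: eq_bigr => j _.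
have -> : adj (m i) *o (t *o u) *o m j = adj (adj t *o m i) *o (u *o m j).
  by rewrite adj_comp adjK !compA.
rewrite -(@frame_insertl (adj t *o m i) (u *o m j)); last 2 first.
- exact: Nt.
- by move=> b Nb; rewrite compA; exact: fd_NEN fd _ _ _ Nb Eu (Nm j).
rewrite bop_sumE; apply: eq_bigr => k _.
by rewrite bcompE adj_comp adjK !compA.
Qed.

Lemma frame_rep_tau t a b xi eta : E' t -> N a -> N b ->
  dot (frame_rep t (frame_tau a xi)) (frame_tau b eta) =
  dot (p (adj b *o t *o a) xi) eta.
Proof.
move=> Et Na Nb; rewrite -[LHS]/(fs_dot _ _) /fs_dot.
have NEN c d : N c -> N d -> E (adj c *o t *o d).
  by move=> Nc Nd; exact: fd_NEN fd _ _ _ Nc Et Nd.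
have repE i : frame_rep t (frame_tau a xi) i = p (adj (m i) *o t *o a) xi.
  rewrite frame_repE// -(@frame_insertr a (adj (m i) *o t))//; last first.
    by move=> c Nc; exact: NEN.
  by rewrite bop_sumE; apply: eq_bigr => j _; rewrite frame_tauE.
under eq_bigr do rewrite repE frame_tauE//.
rewrite (dot_frame (fun i => p (adj (m i) *o t *o a)))//.
under eq_bigr do rewrite -compA; rewrite frame_insertl -?compA// => c Nc.
by rewrite compA; exact: NEN.
Qed.

End FrameModule.

Section FrameMorphism.
Variables (R : realType) (H K : hilbertType R) (A E : set (bop H H)).
Variables (E' : set (bop K K)) (N : set (bop H K)) (n : nat) (m : 'I_n -> bop H K).
Hypothesis fd : frame_data A E E' N m.
Variables (X Y : hilbertType R) (p : bop H H -> bop X X) (q : bop H H -> bop Y Y).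
Hypotheses (pA : module_ucp A E p) (qA : module_ucp A E q).
Variable h : bop X Y.
Hypothesis hp : forall x, E x -> h *o p x = q x *o h.

Let NM i a : N a -> E (adj (m i) *o a).
Proof.
by move=> Na; apply: (fd_AE fd); apply: (fd_NN fd) => //; exact: (fd_m fd).
Qed.

Let Nm i : N (m i). Proof. exact: (fd_m fd). Qed.

Definition frame_mor : bop (frame_space (frame_proj m p)) (frame_space (frame_proj m q)) :=
  mxop _ _ (fun i j => if i == j then h else 0).

Let diagE (F : 'I_n -> X) i : \sum_j (if i == j then h else 0 : bop X Y) (F j) = h (F i).
Proof.
rewrite (bigD1 i)//= eqxx big1 ?addr0// => j; rewrite eq_sym => /negPf ->.
by [].
Qed.

Lemma frame_morE v i : frame_mor v i = h (v i).
Proof.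
rewrite mxopE ?diagE// => {}v {}i; rewrite diagE -fs_fixed bop_sum.
apply: eq_bigr => j _; rewrite diagE -!bcompE hp//; exact: NM.
Qed.

Lemma frame_mor_rep t : E' t ->
  frame_mor *o frame_rep m p t = frame_rep m q t *o frame_mor.
Proof.
move=> Et; apply: bopP => v; apply: fs_eq => i; rewrite !bcompE frame_morE.
rewrite (frame_repE fd pA)// (frame_repE fd qA)// bop_sum; apply: eq_bigr => j _.
rewrite frame_morE -!bcompE hp//.
exact: (fd_NEN fd).
Qed.

Lemma frame_mor_tau a xi : N a ->
  frame_mor (frame_tau m p a xi) = frame_tau m q a (h xi).
Proof.
move=> Na; apply: fs_eq => i.
rewrite frame_morE (frame_tauE fd pA)// (frame_tauE fd qA)// -!bcompE hp//.
exact: NM.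
Qed.

End FrameMorphism.

(** * Unitaries from Gram matrices *)

Section Density.
Variables (R : realType) (X Y : hilbertType R).

Lemma bop_preimage_closed_subspace (T : bop X Y) (V : set Y) :
  subspace V -> closed V ->
  subspace [set x | V (T x)] /\ closed [set x | V (T x)].
Proof.
move=> sV cV; split.
  split; first by rewrite /= bop0; case: sV.
  by move=> a x y /= Vx Vy; rewrite bopD bopZ; case: sV => _; apply.
move=> x clx; have VE := (closure_id V).1 cV; rewrite /= VE.
apply: (@closure_map _ _ _ [set x | V (T x)] _ T (nm T)) clx.
  by move=> {}x y _ _; rewrite -bopB nm_bop.
by move=> y Vy; exact: subset_closure.
Qed.

Lemma dense_bop_eq (D : set X) (S T : bop X Y) : clspan D = [set: X] ->
  (forall x, D x -> S x = T x) -> S = T.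
Proof.
move=> Dd DST; apply: bopP => x; apply/eqP; rewrite -subr_eq0 -bopBE; apply/eqP.
have s0 : subspace [set (0 : Y)].
  by split=> // a u v /= -> ->; rewrite scaler0 addr0.
have c0 : closed [set (0 : Y)].
  move=> y /closureP y0; apply: nm_le0 => e /y0[_ ->]; rewrite subr0; exact: ltW.
have [sP cP] := bop_preimage_closed_subspace (S - T) s0 c0.
have : [set: X] x by [].
rewrite -Dd; apply: (clspan_min sP cP) => z /DST /= ST.
by rewrite bopBE ST subrr.
Qed.

Lemma dense_dot_eq (D : set X) (x y : X) : clspan D = [set: X] ->
  (forall z, D z -> dot x z = dot y z) -> x = y.
Proof.
move=> Dd Dxy; suff : [set z | dot x z = dot y z] = [set: X].
  by move=> h; apply: dot_eq => z; have : [set: X] z by []; rewrite -h.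
apply/seteqP; split=> // z; rewrite -Dd; apply: clspan_min => // {z}.
  split; first by rewrite /= !dot0r.
  by move=> a u v /= xu xv; rewrite !dotDr !dotZr xu xv.
move=> z /closureP clz; apply/eqP; rewrite -subr_eq0 -dotBl; apply/eqP/cm_le0 => e e0.
have c0 : 0 < 1 + nm (x - y) by rewrite ltr_wpDr ?nm_ge0.
have [w /= xyw zw] := clz _ (divr_gt0 e0 c0).
rewrite -[z](subrK w) dotDr [X in _ + X]dotBl xyw subrr addr0.
rewrite (le_trans (dot_CS _ _))//.
apply: (@le_trans _ _ (nm (x - y) * (e / (1 + nm (x - y))))).
  by rewrite ler_wpM2l ?nm_ge0// ltW.
rewrite mulrCA -[leRHS]mulr1 ler_wpM2l ?(ltW e0)// ler_pdivrMr// mul1r.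
by rewrite lerDr.
Qed.

End Density.

Section Gram.
Variables (R : realType) (X Y : hilbertType R) (T : Type) (D : set T).

Section OneSide.
Variables (U V : hilbertType R) (x : T -> U) (y : T -> V).
Hypothesis xy : forall s t, D s -> D t -> dot (x s) (x t) = dot (y s) (y t).

(** Pairs of linear combinations with equal coefficients. It is a relation because sending x t to y
    t is known to extend to a well-defined linear map only after norms have been compared. *)
Inductive gram_span : U -> V -> Prop :=
| GramSpan0 : gram_span 0 0
| GramSpanD a t u v : D t -> gram_span u v ->
    gram_span (a *: x t + u) (a *: y t + v).

Lemma gram_span_lin a u v u' v' : gram_span u v -> gram_span u' v' ->
  gram_span (a *: u + u') (a *: v + v').
Proof.
elim=> {u v}[|b t u v Dt _ IH] uv'; first by rewrite !scaler0 !add0r.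
by rewrite !scalerDr !scalerA -!addrA; apply: GramSpanD => //; exact: IH.
Qed.

Lemma gram_span_dot u v u' v' : gram_span u v -> gram_span u' v' ->
  dot u u' = dot v v'.
Proof.
elim=> {u v}[|b t u v Dt _ IH] uv'; first by rewrite !dot0l.
rewrite !dotDl !dotZl IH//; congr (_ * _ + _).
elim: uv' => {u' v' IH}[|c s u' v' Ds _ IH]; first by rewrite !dot0r.
by rewrite !dotDr !dotZr IH xy.
Qed.

Lemma gram_span_nm u v : gram_span u v -> nm u = nm v.
Proof.
move=> uv; apply/eqP; rewrite -(@eqrXn2 _ 2) ?nm_ge0//; apply/eqP/complexI.
by rewrite -!dot_nm; exact: gram_span_dot.
Qed.

(** The closure of [gram_span] in the product U x V. *)
Definition gram_graph u v : Prop := forall e : R, 0 < e ->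
  exists u' v', [/\ gram_span u' v', nm (u - u') < e & nm (v - v') < e].

Lemma gram_graph_nm u v : gram_graph u v -> nm u = nm v.
Proof.
move=> uv; suff h e : 0 < e -> nm u <= nm v + e /\ nm v <= nm u + e.
  apply/le_anti/andP; split; apply/ler_addgt0Pr => e e0;
    by have [] := h e e0.
move=> e0; have [|u' [v' [/gram_span_nm uv' uu' vv']]] := uv (e / 2).
  by rewrite divr_gt0.
have := nmD (u - u') u'; have := nmD (v - v') v'.
have := nmD (u' - u) u; have := nmD (v' - v) v.
by rewrite !subrK (nmBC u' u) (nmBC v' v) uv'; lra.
Qed.

Lemma gram_graph_lin a u v u' v' : gram_graph u v -> gram_graph u' v' ->
  gram_graph (a *: u + u') (a *: v + v').
Proof.
move=> uv uv' e e0; have a0 : 0 < 1 + cm a by rewrite ltr_pwDl ?cm_ge0.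
have [|p [q [pq up vq]]] := uv (e / 2 / (1 + cm a)); first by rewrite !divr_gt0.
have [|p' [q' [pq' up' vq']]] := uv' (e / 2); first by rewrite divr_gt0.
exists (a *: p + p'), (a *: q + q'); split; first exact: gram_span_lin.
  exact: nm_lin_lt.
exact: nm_lin_lt.
Qed.

(** By linearity 0 is related to v' - v, and the relation preserves norms. *)
Lemma gram_graph_fun u v v' : gram_graph u v -> gram_graph u v' -> v = v'.
Proof.
move=> uv /(gram_graph_lin (-1) uv)/gram_graph_nm.
rewrite !scaleN1r addNr nm0 => /esym/nm_eq0/eqP; rewrite addrC subr_eq0.
by move=> /eqP.
Qed.

Lemma gram_graph_gen t : D t -> gram_graph (x t) (y t).
Proof.
move=> Dt e e0; exists (x t), (y t); rewrite !subrr !nm0; split=> //.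
by have := GramSpanD 1 Dt GramSpan0; rewrite !scale1r !addr0.
Qed.

Lemma gram_bop : clspan (x @` D) = [set: U] ->
  exists w : bop U V, forall u, gram_graph u (w u).
Proof.
move=> xd.
have sub u : smallest (@subspace R U) (x @` D) u -> exists v, gram_span u v.
  apply: (_ : _ `<=` [set u | exists v, gram_span u v]); apply: smallest_sub.
    split; first by exists 0; exact: GramSpan0.
    move=> a p q [v pv] [v' pv']; exists (a *: v + v'); exact: gram_span_lin.
  move=> _ [t Dt <-]; exists (y t).
  by have := GramSpanD 1 Dt GramSpan0; rewrite !scale1r !addr0.
have /choice[w wP] : forall u, exists v, gram_graph u v.
  move=> u; have : clspan (x @` D) u by rewrite xd.
  move=> /closure_seq_lim[p Dp pu].
  have /choice[q pq] : forall k, exists v, gram_span (p k) v.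
    by move=> k; exact: sub (Dp k).
  (* Combinations approximating u have partners with the same mutual distances, hence a limit in
     V. *)
  have [|v qv] := @seq_complete _ _ q.
    move=> e e0; have [|N NP] := pu (e / 2); first by rewrite divr_gt0.
    exists N => k l Nk Nl.
    have := gram_span_lin (-1) (pq l) (pq k).
    rewrite !scaleN1r ![- _ + _]addrC => /gram_span_nm <-.
    rewrite (le_lt_trans (nmB _ u _))// [ltRHS]splitr ltrD ?NP//.
    by rewrite nmBC NP.
  exists v => e e0; have [N NP] := pu e e0; have [N' NP'] := qv e e0.
  exists (p (maxn N N')), (q (maxn N N')); split=> //.
    by rewrite NP// leq_maxl.
  by rewrite NP'// leq_maxr.
have [|||W WE] := @exists_bop R _ _ w 1 => //.
- move=> a u u'; apply: gram_graph_fun (wP _) _.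
  exact: gram_graph_lin.
- by move=> u; rewrite mul1r (gram_graph_nm (wP u)).
by exists W => u; rewrite WE.
Qed.

End OneSide.

Variables (x : T -> X) (y : T -> Y).
Hypothesis xy : forall s t, D s -> D t -> dot (x s) (x t) = dot (y s) (y t).
Hypothesis xd : clspan (x @` D) = [set: X].
Hypothesis yd : clspan (y @` D) = [set: Y].

Lemma gram_unitary : exists (u : bop X Y) (v : bop Y X),
  [/\ v *o u = bid X, u *o v = bid Y,
      forall a b, dot (u a) (u b) = dot a b &
      forall t, D t -> u (x t) = y t].
Proof.
have yx s t : D s -> D t -> dot (y s) (y t) = dot (x s) (x t).
  by move=> Ds Dt; rewrite xy.
(* Exchanging x and y transposes the relation, so the two operators have transposed graphs and are
   inverse to each other. *)
have swap (p : X) (q : Y) : gram_span y x q p -> gram_span x y p q.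
  by elim=> [|a t q' p' Dt _ IH]; [exact: GramSpan0|exact: GramSpanD].
have swap' (p : X) (q : Y) : gram_graph y x q p -> gram_graph x y p q.
  by move=> qp e /qp[q' [p' [/swap ? ? ?]]]; exists p', q'.
have [u uP] := gram_bop xy xd; have [v vP] := gram_bop yx yd.
have uv : u *o v = bid Y.
  by apply: bopP => q; apply: gram_graph_fun (uP _) (swap' _ _ (vP q)).
have ux t : D t -> u (x t) = y t.
  by move=> Dt; apply: gram_graph_fun (uP _) (gram_graph_gen _ _ Dt).
have vu : v *o u = bid X.
  apply: (dense_bop_eq xd) => _ [t Dt <-]; rewrite bcompE ux// bidE.
  exact: gram_graph_fun (vP _) (gram_graph_gen _ _ Dt).
exists u, v; split=> // a b.
have : adj u *o u = bid X.
  apply: (dense_bop_eq xd) => _ [t Dt <-]; rewrite bcompE bidE ux//.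
  apply: (dense_dot_eq xd) => _ [s Ds <-].
  by rewrite adjPl ux// xy.
by move=> /(congr1 (fun T => bval T a)); rewrite bcompE bidE => h; rewrite -{2}h adjPl.
Qed.

End Gram.

(** * The induced functors *)

Lemma operator_system_closure (R : realType) (H : hilbertType R) (E : set (bop H H)) :
  operator_system E -> operator_system (closure E).
Proof.
move=> [sE Eadj E1]; split; [exact: subspace_closure| |exact: subset_closure].
apply: (@closure_map _ _ _ E E (@adj R H H) 1) => [x y _ _|x Ex].
  by rewrite mul1r -adjB nm_adj.
by apply: subset_closure; exact: Eadj.
Qed.

Lemma ucp_comp (R : realType) (H K L : hilbertType R) (E : set (bop H H))
    (E' : set (bop K K)) (f : bop H H -> bop K K) (p : bop K K -> bop L L) :
  ucp E f -> ucp E' p -> f @` E `<=` E' -> ucp E (fun x => p (f x)).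
Proof.
move=> [fl f1 fc] [pl p1 pc] fE; have Ef x : E x -> E' (f x).
  by move=> Ex; apply: fE; exists x.
split; [by move=> a x y Ex Ey; rewrite fl// pl//; exact: Ef|by rewrite f1 p1|].
move=> n X EX X0; have -> : map_mx (fun x => p (f x)) X = map_mx p (map_mx f X).
  by apply/matrixP => i j; rewrite !mxE.
apply: pc; last exact: fc.
by move=> i j; rewrite mxE; exact: Ef.
Qed.

Section EnvelopeProducts.
Variables (R : realType) (S : opsys R) (I : injective_envelope S) (H : hilbertType R).
Variables (f : bop (os_space S) (os_space S) -> bop H H).
Hypothesis fenv : generates_cstar_envelope I f.

Let gen s : os_set S s -> cstar_generated (f @` S) (f s).
Proof. by move=> Ss B [_]; apply; exists s. Qed.

Let genM x y : cstar_generated (f @` S) x -> cstar_generated (f @` S) y ->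
  cstar_generated (f @` S) (x *o y).
Proof.
move=> Gx Gy B [cB fB]; case: (cB) => _ _; apply; [exact: Gx|exact: Gy].
Qed.

Let gen_adj x : cstar_generated (f @` S) x -> cstar_generated (f @` S) (adj x).
Proof.
move=> Gx B [cB fB]; case: (cB) => [[_ + _] _ _]; apply; exact: Gx.
Qed.

(** [crep] speaks of products in the injective envelope, whereas M acts on H. The *-isomorphism
    between the generated C*-algebras makes the two notions of product agree; [envelope_adj] does
    the same for adjoints. *)
Lemma envelope_mul a b c : os_set S a -> os_set S b -> os_set S c ->
  ie_emb I c = ie_emb I a *o ie_emb I b <-> f c = f a *o f b.
Proof.
move=> Sa Sb Sc; have [g [[_ gM _ [_ ginj _]] gE]] := fenv.
have gab : g (f a *o f b) = ie_emb I a *o ie_emb I b.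
  by rewrite gM ?gE//; exact: gen.
split=> [|fc]; last by rewrite -gab -fc gE.
rewrite -gab -gE// => /ginj; apply; rewrite inE; first exact: gen.
by apply: genM; exact: gen.
Qed.

Lemma envelope_adj a c : os_set S a -> os_set S c ->
  ie_emb I c = adj (ie_emb I a) <-> f c = adj (f a).
Proof.
move=> Sa Sc; have [g [[_ _ gA [_ ginj _]] gE]] := fenv.
have ga : g (adj (f a)) = adj (ie_emb I a) by rewrite gA ?gE//; exact: gen.
split=> [|fc]; last by rewrite -ga -fc gE.
rewrite -ga -gE// => /ginj; apply; rewrite inE; first exact: gen.
by apply: gen_adj; exact: gen.
Qed.

Lemma multiplier_mul a s : multipliers I a -> os_set S s ->
  (f @` S) (f a *o f s).
Proof.
move=> [Sa [_ /(_ s)]] + Ss => /(_ Ss)[[t St tE] _].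
by exists t => //; exact/(envelope_mul Sa Ss St).
Qed.

End EnvelopeProducts.

Section RepModule.
Variables (R : realType) (S : opsys R) (I : injective_envelope S) (H : hilbertType R).
Variables (f : bop (os_space S) (os_space S) -> bop H H).
Hypothesis fP : unital_complete_order_embedding S f.
Hypothesis fenv : generates_cstar_envelope I f.

Local Notation A := (f @` multipliers I).
Local Notation E := (closure (f @` S)).
Hypothesis A_adj : forall a, A a -> A (adj a).
Hypothesis A_mul : forall a b, A a -> A b -> A (a *o b).

Lemma multipliers_sub : A `<=` E.
Proof. by move=> _ [a [Sa _] <-]; apply: subset_closure; exists a. Qed.

Lemma multipliers_module a x : A a -> E x -> E (a *o x).
Proof.
move=> [s As <-].
apply: (@closure_map _ _ _ (f @` S) (f @` S) (fun x => f s *o x) (nm (f s))).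
  by move=> {}x y _ _; rewrite -compBr nm_comp.
move=> _ [t St <-]; apply: subset_closure; exact: (multiplier_mul fenv As St).
Qed.

Lemma rep_module (X : crep I) : module_ucp A E (closure_extension f X).
Proof.
have pu := closure_extension_ucp fP X; split=> // a x Aa Ex.
have osE := operator_system_closure (embedding_operator_system fP).
apply: (ucp_multiplicative osE pu) => //.
- exact: multipliers_sub.
- exact: multipliers_module.
- by apply: multipliers_sub; apply: A_mul => //; exact: A_adj.
(* s, d and c are the multipliers with images a, a^* and a a^*. On these [rep_mul] and [rep_adj]
   give the identity that puts a into the multiplicative domain. *)
case: (Aa) => s ms fs; have [d md fd] := A_adj Aa.
have [c mc fc] := A_mul Aa (A_adj Aa).
have [Ss Sd Sc] : [/\ os_set S s, os_set S d & os_set S c].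
  by case: ms => ? _; case: md => ? _; case: mc.
rewrite -fc -fs !closure_extensionE//.
rewrite -(@rep_adj _ _ _ X _ _ ms md); last by apply/(envelope_adj fenv) => //; rewrite fd fs.
by apply: rep_mul => //; apply/(envelope_mul fenv) => //; rewrite fc fs fd.
Qed.

Lemma intertwiner_closure (X Y : crep I) (h : intertwiner X Y) x : E x ->
  ival h *o closure_extension f X x = closure_extension f Y x *o ival h.
Proof.
have osE := embedding_operator_system fP.
have osC := operator_system_closure osE.
have lip (Z : crep I) x' y : E x' -> (f @` S) y ->
    nm (closure_extension f Z x' - closure_extension f Z y) <= nm (x' - y).
  move=> Ex Ey; have pu := closure_extension_ucp fP Z.
  have {}Ey : E y by exact: subset_closure.
  rewrite -(ucpB osC pu)// (ucp_contractive osC pu)//.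
  by apply: (@subspaceB _ _ E) => //; case: osC.
apply: (@closure_eq _ _ _ (f @` S) (fun x => ival h *o closure_extension f X x)
  (fun x => closure_extension f Y x *o ival h) (nm (ival h)) (nm (ival h))).
- move=> x' y Ex Ey; rewrite -compBr (le_trans (nm_comp _ _))//.
  by rewrite ler_wpM2l ?nm_ge0// lip.
- move=> x' y Ex Ey; rewrite -compBl (le_trans (nm_comp _ _))// mulrC.
  by rewrite ler_wpM2l ?nm_ge0// lip.
by move=> _ [s Ss <-]; rewrite !closure_extensionE// ivalP.
Qed.

End RepModule.

(** The existential scalar admits conjugate linear maps such as [adj]. *)
Lemma clspan_map (R : realType) (V W : normedModType R[i]) (X : set V) (Z : set W)
    (f : V -> W) (C : R) :
  subspace Z -> closed Z -> f 0 = 0 ->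
  (forall a x y, exists b, f (a *: x + y) = b *: f x + f y) ->
  (forall x y, nm (f x - f y) <= C * nm (x - y)) ->
  (forall x, X x -> Z (f x)) -> forall x, clspan X x -> Z (f x).
Proof.
move=> sZ cZ f0 fl fC XZ; apply: (_ : _ `<=` [set x | Z (f x)]).
apply: clspan_min => //.
  split; first by rewrite /= f0; case: sZ.
  by move=> a x y /= Zx Zy; have [b ->] := fl a x y; case: sZ => _; apply.
move=> x clx; rewrite /= ((closure_id Z).1 cZ).
apply: (@closure_map _ _ _ [set x | Z (f x)] _ f C) clx => [{}x y _ _|y Zy].
  exact: fC.
exact: subset_closure.
Qed.

Section LProd.
Variables (R : realType) (H K : hilbertType R) (M : set (bop H K)).
Hypothesis troM : TRO M.

Lemma lprod_subspace : subspace (lprod M). Proof. exact: clspan_subspace. Qed.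
Lemma lprod_closed : closed (lprod M). Proof. exact: clspan_closed. Qed.

Lemma lprod_gen a b : M a -> M b -> lprod M (adj a *o b).
Proof. by move=> Ma Mb; apply: sub_clspan; exists a => //; exists b. Qed.

Lemma closure_sandwich (Z : set (bop H H)) (t : bop K K) : closed Z ->
  (forall a b, M a -> M b -> Z (adj a *o t *o b)) ->
  forall a b, closure M a -> closure M b -> Z (adj a *o t *o b).
Proof.
move=> cZ MZ a b Na Nb; have ZE := (closure_id Z).1 cZ; rewrite ZE.
have {}MZ a' b' : M a' -> M b' -> closure Z (adj a' *o t *o b').
  by rewrite -ZE; exact: MZ.
apply: (@closure_map _ _ _ M Z (fun b => adj a *o t *o b)
  (nm (adj a *o t))) Nb => [x y _ _|{}b Mb].
  by rewrite -compBr nm_comp.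
apply: (@closure_map _ _ _ M Z (fun a => adj a *o t *o b)
  (nm t * nm b)) Na => [x y _ _|{}a Ma].
  rewrite -compBl -compBl -adjB (le_trans (nm_comp _ _))// mulrAC.
  rewrite ler_wpM2r ?nm_ge0// (le_trans (nm_comp _ _))// nm_adj.
  by rewrite mulrC.
exact: MZ.
Qed.

Lemma closure_lprod a b : closure M a -> closure M b -> lprod M (adj a *o b).
Proof.
move=> Na Nb; rewrite -[adj a](comp1r (adj a)).
apply: closure_sandwich => // [|a' b']; first exact: lprod_closed.
by rewrite comp1r; exact: lprod_gen.
Qed.

Lemma lprod_adj x : lprod M x -> lprod M (adj x).
Proof.
apply: (@clspan_map _ _ _ _ _ (@adj R H H) 1 lprod_subspace lprod_closed).
- exact: adj0.
- by move=> a y z; exists (conjc a); rewrite adjD adjZ.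
- by move=> y z; rewrite mul1r -adjB nm_adj.
by move=> _ [a Ma [b Mb <-]]; rewrite adj_comp adjK; exact: lprod_gen.
Qed.

Lemma rprod_adj x : rprod M x -> rprod M (adj x).
Proof.
have sZ : subspace (rprod M) := clspan_subspace _.
have cZ : closed (rprod M) := @clspan_closed _ _ _.
apply: (@clspan_map _ _ _ _ _ (@adj R K K) 1 sZ cZ).
- exact: adj0.
- by move=> a y z; exists (conjc a); rewrite adjD adjZ.
- by move=> y z; rewrite mul1r -adjB nm_adj.
move=> _ [a Ma [b Mb <-]]; rewrite adj_comp adjK; apply: sub_clspan.
by exists b => //; exists a.
Qed.

Let comp_mapl (L1 L2 L3 : hilbertType R) (Z : set (bop L1 L3)) (X : set (bop L2 L3))
    (y : bop L1 L2) : subspace Z -> closed Z ->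
  (forall x, X x -> Z (x *o y)) -> forall x, clspan X x -> Z (x *o y).
Proof.
move=> sZ cZ; apply: (@clspan_map _ _ _ _ _ (fun x => x *o y) (nm y) sZ cZ).
- exact: comp0l.
- by move=> a u v; exists a; rewrite compDl compZl.
by move=> u v; rewrite -compBl mulrC nm_comp.
Qed.

Let comp_mapr (L1 L2 L3 : hilbertType R) (Z : set (bop L1 L3)) (X : set (bop L1 L2))
    (y : bop L2 L3) : subspace Z -> closed Z ->
  (forall x, X x -> Z (y *o x)) -> forall x, clspan X x -> Z (y *o x).
Proof.
move=> sZ cZ; apply: (@clspan_map _ _ _ _ _ (fun x => y *o x) (nm y) sZ cZ).
- exact: comp0r.
- by move=> a u v; exists a; rewrite compDr compZr.
by move=> u v; rewrite -compBr nm_comp.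
Qed.

Let M_mul a b c : M a -> M b -> M c -> M (a *o adj b *o c).
Proof. by case: troM => _; apply. Qed.

(** On generators (a^* b) (c^* d) = a^* (b c^* d), and b c^* d lies in M. *)
Lemma lprod_mul x y : lprod M x -> lprod M y -> lprod M (x *o y).
Proof.
move=> + My; apply: (comp_mapl lprod_subspace lprod_closed) => _ [a Ma [b Mb <-]].
move: y My; apply: (comp_mapr lprod_subspace lprod_closed) => _ [c Mc [d Md <-]].
by rewrite compA -(compA (adj a)) -compA; apply: lprod_gen => //; exact: M_mul.
Qed.

Lemma rprod_closure x a : rprod M x -> closure M a -> closure M (x *o a).
Proof.
have sN : subspace (closure M) by apply: subspace_closure; case: troM.
move=> + Na; apply: (comp_mapl sN (@closed_closure _ M)) => _ [b Mb [c Mc <-]].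
apply: (@closure_map _ _ _ M M (fun a => b *o adj c *o a) (nm (b *o adj c))) Na.
  by move=> y z _ _; rewrite -compBr nm_comp.
by move=> d Md; apply: subset_closure; exact: M_mul.
Qed.

End LProd.

Section InducedFunctor.
Variables (R : realType) (S T : opsys R).
Variables (I : injective_envelope S) (J : injective_envelope T).
Variable D : morita_data I J.

Local Notation f := (md_S D).
Local Notation g := (md_T D).
Local Notation M := (md_M D).
Local Notation A := (f @` multipliers I).
Local Notation E := (closure (f @` S)).

Let fP := md_SP D.
Let gP := md_TP D.

Lemma md_tro : TRO M. Proof. by case: (md_MP D). Qed.

Lemma md_adj a : A a -> A (adj a).
Proof. by rewrite md_lprod; exact: lprod_adj. Qed.

Lemma md_mul a b : A a -> A b -> A (a *o b).
Proof. by rewrite md_lprod; exact: lprod_mul md_tro _ _. Qed.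

Definition md_module (X : crep I) : module_ucp A E (closure_extension f X) :=
  rep_module fP (md_S_env D) md_adj md_mul X.

Lemma md_frame : exists n (m : 'I_n -> bop (md_H D) (md_K D)),
  frame_data A E (g @` T) (closure M) m.
Proof.
have [_ [_ rM] MTM _] := md_MP D.
have [n [m [Mm m1]]] := TRO_frame md_tro rM; exists n, m; split=> //.
- exact: operator_system_closure (embedding_operator_system fP).
- exact: embedding_operator_system gP.
- by apply: subspace_closure; case: md_tro.
- exact: multipliers_sub.
- exact: md_adj.
- exact: multipliers_module (md_S_env D).
- by move=> a b Na Nb; rewrite md_lprod; exact: closure_lprod.
move=> a t b Na Tt Nb; apply: (closure_sandwich (M := M) (@closed_closure _ _)) => //.
by move=> c d Mc Md; exact: MTM.
Qed.

(* The coordinates V X i stand for m_i^* (x) 1, where (m_i) is a frame. *)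
Definition parseval_coordinates (F : functor (Hmod I) (Hmod J)) n
    (V : forall X : crep I, 'I_n -> bop (F X : crep J) X) : Prop :=
  (forall X v, nm v ^+ 2 = \sum_i nm (V X i v) ^+ 2) /\
  (forall (X Y : crep I) (h : intertwiner X Y) v i,
    V Y i ((fmor F h : intertwiner (F X) (F Y)) v) = h (V X i v)).

(** The coordinates V come with the functor because complete contractivity is read off from them. *)
Lemma md_exists_functor : exists (F : functor (Hmod I) (Hmod J)) n
  (V : forall X : crep I, 'I_n -> bop (F X : crep J) X),
  induced_by_TRO D F /\ parseval_coordinates V.
Proof.
have [n [m fd]] := md_frame; have mu := md_module.
have osE' := embedding_operator_system gP.
pose p (X : crep I) := closure_extension f X.
pose sp (X : crep I) := frame_space (frame_proj m (p X)).
pose r (X : crep I) t := frame_rep m (p X) (g t).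
have E'g t : os_set T t -> (g @` T) (g t) by move=> Tt; exists t.
have ru X : ucp T (r X).
  by apply: ucp_comp (embedding_ucp gP) (frame_rep_ucp fd (mu X)) _.
have JT t : multipliers J t -> os_set T t by case.
have rM X a b c : multipliers J a -> multipliers J b -> multipliers J c ->
    ie_emb J c = ie_emb J a *o ie_emb J b -> r X c = r X a *o r X b.
  move=> Ja Jb Jc /(envelope_mul (md_T_env D) (JT _ Ja) (JT _ Jb) (JT _ Jc)) gc.
  rewrite /r gc (frame_rep_mul fd (mu X))//; try exact/E'g/JT.
    by rewrite -gc; exact/E'g/JT.
  (* The image of a lies in [M M^* ], which is selfadjoint and maps the closure of M into itself. *)
  move=> d Nd; apply: (rprod_closure md_tro) => //; apply: rprod_adj.
  by rewrite -md_rprod; exists a.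
have rA X a c : multipliers J a -> multipliers J c ->
    ie_emb J c = adj (ie_emb J a) -> r X c = adj (r X a).
  move=> Ja Jc /(envelope_adj (md_T_env D) (JT _ Ja) (JT _ Jc)) gc.
  by rewrite /r gc (ucp_adj osE' (frame_rep_ucp fd (mu X)))//; exact/E'g/JT.
pose ob X : crep J := @Crep R T J (sp X) (r X) (ru X) (rM X) (rA X).
have hp (X Y : crep I) (h : intertwiner X Y) x : E x -> ival h *o p X x = p Y x *o ival h.
  exact: intertwiner_closure.
pose fm (X Y : crep I) (h : intertwiner X Y) : bop (ob X) (ob Y) :=
  frame_mor m (p X) (p Y) (ival h).
have morP (X Y : crep I) (h : intertwiner X Y) t : os_set T t ->
    fm X Y h *o rep_map (ob X) t = rep_map (ob Y) t *o fm X Y h.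
  move=> Tt; apply: (frame_mor_rep fd (mu X) (mu Y)) => [x|].
    exact: hp.
  exact: E'g.
pose mor (X Y : crep I) (h : intertwiner X Y) : intertwiner (ob X) (ob Y) :=
  @Intertwiner R T J (ob X) (ob Y) (fm X Y h) (morP X Y h).
have morE (X Y : crep I) (h : intertwiner X Y) (v : sp X) i :
    (mor X Y h v : sp Y) i = h (v i).
  by apply: (frame_morE fd) => x; exact: hp.
have F1 (X : Hmod I) : mor X X (idm X) = idm (ob X : Hmod J).
  by apply: intertwiner_inj => v; apply: fs_eq => i; rewrite morE.
have FM (X Y Z : Hmod I) (h : hom Y Z) (k : hom X Y) :
    mor X Z (compm h k) = compm (mor Y Z h : hom (ob Y : Hmod J) (ob Z)) (mor X Y k).
  apply: intertwiner_inj => v; apply: fs_eq => i; rewrite morE.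
  by rewrite -[RHS]/((mor Y Z h (mor X Y k v) : sp Z) i) !morE.
have coordP (X : crep I) (i : 'I_n) : exists c : bop (ob X) X, forall v : sp X, c v = v i.
  apply: (@exists_bop _ _ _ (fun v : sp X => v i) 1) => [a v w||v] //.
    by rewrite fsDE fsZE.
  by rewrite mul1r; exact: nm_fs_coord.
pose V (X : crep I) i := projT1 (cid (coordP X i)).
have VE (X : crep I) i (v : sp X) : V X i v = v i := projT2 (cid (coordP X i)) v.
exists (@Functor (Hmod I) (Hmod J) ob mor F1 FM), n, V; split; last first.
  split=> [X v|X Y h v i]; last by rewrite !VE morE.
  by rewrite (nm_fs (v : sp X)); apply: eq_bigr => i _; rewrite VE.
exists (fun X => frame_tau m (p X)); split.
  move=> X; split.
  - move=> c a b xi Ma Mb; apply: (frame_tau_linl fd (mu X)); exact: subset_closure.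
  - move=> a Ma; apply: (frame_tau_linr fd (mu X)); exact: subset_closure.
  - move=> a s xi Ma Is Mas.
    rewrite (frame_tau_balanced fd (mu X)); try exact: subset_closure.
      by rewrite /p closure_extensionE//; case: Is.
    by exists s.
  - move=> a b xi eta Ma Mb; apply: (frame_tau_dot fd (mu X)); exact: subset_closure.
  - apply: (frame_tau_dense fd (mu X)) => //; exact: subset_closure.
  - move=> t a b xi eta Tt Ma Mb.
    apply: (frame_rep_tau fd (mu X)); [exact: E'g|exact: subset_closure|exact: subset_closure].
move=> X Y h a xi Ma; apply: (frame_mor_tau fd (mu X) (mu Y)) => [x|].
  exact: hp.
exact: subset_closure.
Qed.

End InducedFunctor.

(** * Complete contractivity of the induced functors *)

Section MxOpNorm.
Variables (R : realType) (H K H' K' : hilbertType R).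

Definition mxopbound (H1 K1 : hilbertType R) n (X : 'I_n -> 'I_n -> bop H1 K1) (c : R) : Prop :=
  forall xi : 'I_n -> H1,
    \sum_i nm (\sum_j X i j (xi j)) ^+ 2 <= c ^+ 2 * \sum_j nm (xi j) ^+ 2.

Lemma mxopboundP (H1 K1 : hilbertType R) n (X : 'I_n -> 'I_n -> bop H1 K1) (c : R) :
  mxopbound X c <-> forall xi : 'I_n -> H1,
    \sum_i `|\sum_j X i j (xi j)| ^+ 2 <= (c ^+ 2)%:C * \sum_j `|xi j| ^+ 2.
Proof.
have sumE (V : normedModType R[i]) (x : 'I_n -> V) :
    \sum_i `|x i| ^+ 2 = (\sum_i nm (x i) ^+ 2)%:C.
  rewrite (raddf_sum (real_complex R)); apply: eq_bigr => i _.
  by rewrite normE -(rmorphXn (real_complex R)).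
by split=> Xc xi; have := Xc xi; rewrite !sumE -realcM lecR.
Qed.

(** Ensures that [mxopnorm] is the infimum of a nonempty set. The witness comes from bounding each
    |xi j| by the norm of the whole vector. *)
Lemma mxopbound_exists (H1 K1 : hilbertType R) n (X : 'I_n -> 'I_n -> bop H1 K1) :
  exists2 c, 0 <= c & mxopbound X c.
Proof.
pose d i := \sum_j nm (X i j).
have d2 : 0 <= \sum_i d i ^+ 2 by rewrite sumr_ge0// => i _; exact: sqr_ge0.
exists (Num.sqrt (\sum_i d i ^+ 2)); first exact: sqrtr_ge0.
move=> xi; rewrite sqr_sqrtr// mulr_suml ler_sum// => i _.
set s := \sum_j nm (xi j) ^+ 2.
have s0 : 0 <= s by rewrite sumr_ge0// => j _; exact: sqr_ge0.
have xs j : nm (xi j) <= Num.sqrt s.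
  rewrite -(@ler_pXn2r _ 2) ?nnegrE ?nm_ge0 ?sqrtr_ge0// sqr_sqrtr//.
  by rewrite /s (bigD1 j)//= lerDl sumr_ge0// => k _; exact: sqr_ge0.
rewrite -[s]sqr_sqrtr// -exprMn ler_pXn2r ?nnegrE ?nm_ge0//; last first.
  by rewrite mulr_ge0 ?sqrtr_ge0// sumr_ge0// => j _; exact: nm_ge0.
rewrite (le_trans (nm_sum _ _ _))// mulr_suml ler_sum// => j _.
by rewrite (le_trans (nm_bop _ _))// ler_wpM2l ?nm_ge0.
Qed.

Lemma mxopnorm_le n (X : 'I_n -> 'I_n -> bop H K) (Y : 'I_n -> 'I_n -> bop H' K') :
  (forall c, 0 <= c -> mxopbound X c -> mxopbound Y c) -> mxopnorm Y <= mxopnorm X.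
Proof.
move=> XY; apply: lb_le_inf.
  have [c c0 Xc] := mxopbound_exists X; exists c; split=> //.
  exact/mxopboundP.
move=> c [c0 /mxopboundP Xc]; apply: ge_inf; first by exists 0 => d [].
by split=> //; apply/mxopboundP; exact: XY.
Qed.

End MxOpNorm.

Section InducedFunctorTheory.
Variables (R : realType) (S T : opsys R).
Variables (I : injective_envelope S) (J : injective_envelope T).
Variable D : morita_data I J.

Local Notation f := (md_S D).
Local Notation g := (md_T D).
Local Notation M := (md_M D).
Local Notation A := (f @` multipliers I).
Local Notation E := (closure (f @` S)).

(** In each coordinate F(h) acts as h, so a bound for [h_ij] holds coordinate by coordinate and
    Parseval's identity adds these up. Linearity of F follows since a vector whose coordinates
    vanish is 0. *)
Lemma parseval_contractive (F : functor (Hmod I) (Hmod J)) n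
    (V : forall X : crep I, 'I_n -> bop (F X : crep J) X) :
  parseval_coordinates V -> completely_contractive F.
Proof.
move=> [Vnm VF] X Y; split.
  move=> a h k l lE; apply: bopP => v; apply/eqP; rewrite -subr_eq0; apply/eqP/nm_eq0/eqP.
  rewrite -sqrf_eq0 Vnm big1// => i _; apply/eqP; rewrite sqrf_eq0; apply/eqP.
  rewrite bopDE bopZE bopB bopD bopZ !VF lE bopDE bopZE subrr; exact: nm0.
move=> k h; apply: mxopnorm_le => c c0 hc v.
have -> : \sum_i nm (\sum_j (fmor F (h i j) : intertwiner (F X) (F Y)) (v j)) ^+ 2 =
    \sum_l \sum_i nm (\sum_j h i j (V X l (v j))) ^+ 2.
  rewrite exchange_big; apply: eq_bigr => i _; rewrite Vnm; apply: eq_bigr => l _.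
  by rewrite bop_sum; congr (nm _ ^+ 2); apply: eq_bigr => j _; rewrite VF.
have -> : \sum_j nm (v j) ^+ 2 = \sum_l \sum_j nm (V X l (v j)) ^+ 2.
  by rewrite exchange_big; apply: eq_bigr => j _; rewrite Vnm.
by rewrite mulr_sumr ler_sum// => l _; exact: hc.
Qed.

Section TwoFunctors.
Variables F G : functor (Hmod I) (Hmod J).
Hypotheses (FD : induced_by_TRO D F) (GD : induced_by_TRO D G).

Lemma induced_unitary : exists u : forall X : crep I, bop (F X : crep J) (G X : crep J),
  (forall X v, nm (u X v) = nm v) /\
  (forall (X Y : crep I) (h : intertwiner X Y) v,
    u Y ((fmor F h : intertwiner (F X) (F Y)) v) =
    (fmor G h : intertwiner (G X) (G Y)) (u X v)).
Proof.
have [tau [tauP tauF]] := FD; have [tau' [tauP' tauF']] := GD.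
pose dom (X : crep I) : set (bop (md_H D) (md_K D) * rep_space X) := [set p | M p.1].
pose x (X : crep I) (p : bop (md_H D) (md_K D) * X) := tau X p.1 p.2.
pose y (X : crep I) (p : bop (md_H D) (md_K D) * X) := tau' X p.1 p.2.
have domE (X : crep I) (V : Type) (s : bop (md_H D) (md_K D) -> X -> V) :
    [set s a xi | a in M & xi in [set: X]] = (fun p => s p.1 p.2) @` dom X.
  apply/seteqP; split=> [_ [a Ma [xi _ <-]]|_ [[a xi] /= Ma <-]].
    by exists (a, xi).
  by exists a => //; exists xi.
have uP (X : crep I) : exists u : bop (F X : crep J) (G X : crep J),
    (forall v, nm (u v) = nm v) /\ forall a xi, M a -> u (tau X a xi) = tau' X a xi.
  have [||| u [v [_ _ udot ux]]] := @gram_unitary _ _ _ _ (dom X) (x X) (y X).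
  - move=> [a xi] [b eta] /= Ma Mb.
    by rewrite /x /y (tau_dot (tauP X))// (tau_dot (tauP' X)).
  - by rewrite -domE; exact: tau_dense (tauP X).
  - by rewrite -domE; exact: tau_dense (tauP' X).
  exists u; split=> [w|a xi Ma]; last exact: (ux (a, xi)).
  apply/eqP; rewrite -(@eqrXn2 _ 2) ?nm_ge0//; apply/eqP/complexI.
  by rewrite -!dot_nm.
pose u (X : crep I) := projT1 (cid (uP X)).
have [unm ut] : (forall X v, nm (u X v) = nm v) /\
    forall X a xi, M a -> u X (tau X a xi) = tau' X a xi.
  by split=> X; have [] := projT2 (cid (uP X)).
exists u; split=> // X Y h v.
have := @dense_bop_eq _ _ _ _ (u Y *o ival (fmor F h : intertwiner (F X) (F Y)))
  (ival (fmor G h : intertwiner (G X) (G Y)) *o u X) (tau_dense (tauP X)).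
move=> h'; have := congr1 (fun T => bval T v) (h' _); rewrite !bcompE; apply.
move=> _ [a Ma [xi _ <-]].
by rewrite !bcompE tauF// !ut// tauF'.
Qed.

End TwoFunctors.

(** The Parseval coordinates of the frame model are pulled back along the natural isometry. *)
Lemma induced_contractive (F : functor (Hmod I) (Hmod J)) :
  induced_by_TRO D F -> completely_contractive F.
Proof.
move=> FD; have [F0 [n [V [F0D [Vnm VF]]]]] := md_exists_functor D.
have [u [unm uF]] := induced_unitary FD F0D.
apply: (@parseval_contractive F n (fun X i => V X i *o u X)); split.
  by move=> X v; rewrite -unm Vnm.
by move=> X Y h v i; rewrite !bcompE uF VF.
Qed.

End InducedFunctorTheory.

(** * The composition of the two functors *)

Section Composition.
Variables (R : realType) (S T : opsys R).
Variables (I : injective_envelope S) (J : injective_envelope T).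
Variable D : morita_data I J.

Local Notation f := (md_S D).
Local Notation g := (md_T D).
Local Notation M := (md_M D).
Local Notation A := (f @` multipliers I).
Local Notation E := (closure (f @` S)).
Local Notation E' := (closure (g @` T)).

Let fP := md_SP D.
Let gP := md_TP D.
Let osE : operator_system E := operator_system_closure (embedding_operator_system fP).
Let osE' : operator_system E' := operator_system_closure (embedding_operator_system gP).

Let rprod_T x : rprod M x -> exists2 t, os_set T t & g t = x.
Proof. by rewrite -md_rprod => -[t [Tt _] <-]; exists t. Qed.

Let lprod_A a b : M a -> M b -> A (adj a *o b).
Proof. by move=> Ma Mb; rewrite md_lprod; exact: lprod_gen. Qed.

Let rprod_gen a b : M a -> M b -> rprod M (a *o adj b).
Proof. by move=> Ma Mb; apply: sub_clspan; exists a => //; exists b. Qed.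

Let AE : A `<=` E. Proof. exact: multipliers_sub. Qed.

Let ME'M a z b : M a -> E' z -> M b -> E (adj a *o z *o b).
Proof.
move=> Ma + Mb; apply: (@closure_map _ _ _ (g @` T) (f @` S)
  (fun z => adj a *o z *o b) (nm a * nm b)) => [x y _ _|t Tt].
  rewrite -compBl -compBr (le_trans (nm_comp _ _))// [leRHS]mulrAC.
  by rewrite ler_wpM2r ?nm_ge0// (le_trans (nm_comp _ _))// nm_adj.
by case: (md_MP D) => _ _ MTM _; exact: MTM.
Qed.

Section OneRepresentation.
Variables (X : crep I) (Y : crep J) (tau : bop (md_H D) (md_K D) -> X -> Y).
Hypothesis tauP : induced_object f g M tau.

Local Notation p := (closure_extension f X).
Local Notation q := (closure_extension g Y).
Let pu := closure_extension_ucp fP X.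
Let qu := closure_extension_ucp gP Y.
Let mu := md_module D X.

(** [tau_rep] covers T, but n s m^* lies only in its closure. Both sides are Lipschitz in z, with
    constants adding up to the c of the proof. *)
Lemma tau_rep_closure z a b xi eta : E' z -> M a -> M b ->
  dot (q z (tau a xi)) (tau b eta) = dot (p (adj b *o z *o a) xi) eta.
Proof.
move=> E'z Ma Mb; apply/eqP; rewrite -subr_eq0; apply/eqP/cm_le0 => e e0.
pose c := nm (tau a xi) * nm (tau b eta) + nm a * nm b * nm xi * nm eta.
have c0 : 0 <= c by rewrite addr_ge0 ?mulr_ge0 ?nm_ge0.
have c1 : 0 < 1 + c by rewrite ltr_wpDr.
have /closureP/(_ _ (divr_gt0 e0 c1))[_ [t Tt <-] zt] := E'z.
have Et : E' (g t) by apply: subset_closure; exists t.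
have : dot (q (g t) (tau a xi)) (tau b eta) = dot (p (adj b *o g t *o a) xi) eta.
  by rewrite closure_extensionE// (tau_rep tauP).
move=> /eqP; rewrite -subr_eq0 => /eqP h.
rewrite -[X in cm X]subr0 -h opprD opprK addrACA -dotBl -bopBE.
rewrite [- dot _ eta + _]addrC -dotBl -bopBE.
rewrite -(ucpB osE' qu)// -(ucpB osE pu); [|exact: ME'M|exact: ME'M].
rewrite -compBl -compBr.
have Ez : E' (z - g t) by apply: (@subspaceB _ _ E') => //; case: osE'.
have Ez' : E (adj b *o (g t - z) *o a).
  by apply: ME'M => //; apply: (@subspaceB _ _ E') => //; case: osE'.
set r := nm (z - g t); have r0 : 0 <= r := nm_ge0 _.
apply: (@le_trans _ _ (r * c)).
  rewrite (le_trans (cmD _ _))// /c mulrDr lerD//.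
    rewrite (le_trans (dot_CS _ _))// mulrA ler_wpM2r ?nm_ge0//.
    rewrite (le_trans (nm_bop _ _))// ler_wpM2r ?nm_ge0//.
    exact: ucp_contractive osE' qu _ Ez.
  rewrite (le_trans (dot_CS _ _))// mulrA ler_wpM2r ?nm_ge0//.
  rewrite (le_trans (nm_bop _ _))// mulrA ler_wpM2r ?nm_ge0//.
  rewrite (le_trans (ucp_contractive osE pu Ez'))// (le_trans (nm_comp _ _))//.
  rewrite (mulrC (nm a)) (mulrA r) ler_wpM2r ?nm_ge0// (le_trans (nm_comp _ _))//.
  by rewrite nm_adj nmBC mulrC.
have c1n : 1 + c != 0 by rewrite gt_eqF.
rewrite -[e](divfK c1n) ler_pM ?(ltW zt)//.
by rewrite lerDr.
Qed.

(** Since 1 lies in [M^* M], xi = p(1) xi is a limit of combinations of the vectors p(m^* a) xi. *)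
Lemma rep_dense : clspan [set p (adj ma.1 *o ma.2.1) ma.2.2 |
  ma in [set ma : bop (md_H D) (md_K D) * (bop (md_H D) (md_K D) * X) |
    M ma.1 /\ M ma.2.1]] = [set: X].
Proof.
set V := clspan _; apply/seteqP; split=> // xi _.
have sV : subspace V := clspan_subspace _.
have cV : closed V := @clspan_closed _ _ _.
(* Membership in E is part of Q because p is linear and contractive on E only. *)
pose Q := [set b | E b /\ V (p b xi)].
have sE : subspace E by case: osE.
suff : Q (bid (md_H D)) by case=> _; rewrite (ucp1 pu) bidE.
case: (md_MP D) => _ [+ _] _ _; apply: clspan_min.
- split; first by split; [case: sE|rewrite (ucp0 osE pu) bop0E; case: sV].
  move=> a x y [Ex Vx] [Ey Vy]; split; first by case: sE => _; apply.
  rewrite (ucpD pu) ?(ucpZ osE pu)//; last by apply: (@subspaceZ _ _ E).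
  by rewrite bopDE bopZE; case: sV => _; apply.
- have QE : closure Q `<=` E.
    move=> b; rewrite [E]((closure_id _).1 (@closed_closure _ (f @` S))).
    by apply: closureS => x [].
  move=> b Qb; split; first exact: QE.
  rewrite ((closure_id V).1 cV).
  apply: (@closure_map _ _ _ Q V (fun b => p b xi) (nm xi)) Qb => [x y Qx [Ey _]|x [_ Vx]].
    have Ex := QE _ Qx; rewrite -bopBE -(ucpB osE pu)// (le_trans (nm_bop _ _))//.
    rewrite mulrC ler_wpM2l ?nm_ge0// (ucp_contractive osE pu)//.
    by apply: (@subspaceB _ _ E).
  exact: subset_closure.
move=> _ [a Ma [b Mb <-]]; split; first by apply: AE; exact: lprod_A.
by apply: sub_clspan; exists (a, (b, xi)).
Qed.

Variables (Z : crep I) (sigma : bop (md_K D) (md_H D) -> Y -> Z).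
Hypothesis sigmaP : induced_object g f [set adj m | m in M] sigma.

Let Madj m : M m -> [set adj m | m in M] (adj m). Proof. by exists m. Qed.

(** For fixed m the map y |-> sigma(m^*, y) is bounded, so the density of the tensors in Y carries
    over to its image. *)
Lemma sigma_tau_dense : clspan [set sigma (adj ma.1) (tau ma.2.1 ma.2.2) |
  ma in [set ma : bop (md_H D) (md_K D) * (bop (md_H D) (md_K D) * X) |
    M ma.1 /\ M ma.2.1]] = [set: Z].
Proof.
set V := clspan _; apply/seteqP; split=> // z _.
have sV : subspace V := clspan_subspace _.
have cV : closed V := @clspan_closed _ _ _.
have : [set: Z] z by []; rewrite -(tau_dense sigmaP).
apply: clspan_min => // _ [_ [m Mm <-] [y _ <-]].
have [|y' | s sE] := @exists_bop _ _ _ (sigma (adj m)) (nm m) _ (nm_ge0 m).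
- exact: (tau_linear_r sigmaP (Madj Mm)).
- rewrite -(@ler_pXn2r _ 2) ?nnegrE ?mulr_ge0 ?nm_ge0//.
  rewrite -[leLHS]/(complex.Re (nm (sigma (adj m) y') ^+ 2)%:C) -dot_nm.
  rewrite (tau_dot sigmaP) ?adjK; [|exact: Madj|exact: Madj].
  rewrite (le_trans (ler_Re_cm _))// (le_trans (dot_CS _ _))// exprMn.
  rewrite [nm y' ^+ 2]expr2 mulrA ler_wpM2r ?nm_ge0// (le_trans (nm_bop _ _))//.
  rewrite ler_wpM2r ?nm_ge0//.
  have Em : E' (m *o adj m).
    have [t Tt <-] := rprod_T (rprod_gen Mm Mm).
    by apply: subset_closure; exists t.
  rewrite (le_trans (ucp_contractive osE' qu Em))//.
  by rewrite (le_trans (nm_comp _ _))// nm_adj expr2.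
have [sP cP] := bop_preimage_closed_subspace s sV cV.
rewrite -sE; have : [set: Y] y by []; rewrite -(tau_dense tauP).
apply: (clspan_min sP cP) => _ [a Ma [xi _ <-]] /=.
by rewrite sE; apply: sub_clspan; exists (m, (a, xi)).
Qed.

(** For x = 1 this compares the Gram matrices, and for x in S it gives the intertwining relation.
    The outer factors b^* n and m^* a lie in A, so p splits them off. *)
Lemma sigma_tau_dot x m a n b xi eta : E x -> E' (n *o x *o adj m) ->
  M m -> M a -> M n -> M b ->
  dot (q (n *o x *o adj m) (tau a xi)) (tau b eta) =
  dot (p x (p (adj m *o a) xi)) (p (adj n *o b) eta).
Proof.
move=> Ex Ez Mm Ma Mn Mb; rewrite tau_rep_closure//.
have -> : adj b *o (n *o x *o adj m) *o a = (adj b *o n) *o (x *o (adj m *o a)).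
  by rewrite !compA.
have Exa : E (x *o (adj m *o a)).
  have [k [l fd]] := md_frame D; apply: (fd_mulr fd) => //; exact: lprod_A.
rewrite (mu_mul mu)//; last exact: lprod_A.
have [k [l fd]] := md_frame D; rewrite (mu_mulr fd mu)//; last exact: lprod_A.
rewrite bcompE -[adj b *o n]adjK adj_comp adjK (ucp_adj osE pu); last first.
  by apply: AE; exact: lprod_A.
by rewrite adjPl bcompE.
Qed.

Lemma sigma_tau_unitary : exists (u : intertwiner X Z) (v : intertwiner Z X),
  [/\ forall x, v (u x) = x, forall z, u (v z) = z &
      forall m a xi, M m -> M a ->
        u (p (adj m *o a) xi) = sigma (adj m) (tau a xi)].
Proof.
have one m n : M m -> M n -> n *o bid (md_H D) *o adj m = n *o adj m.
  by rewrite comp1r.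
have E'1 m n : M m -> M n -> E' (n *o adj m).
  move=> Mm Mn; have [t Tt <-] := rprod_T (rprod_gen Mn Mm).
  by apply: subset_closure; exists t.
have [|u [v [vu uv udot ux]]] := gram_unitary _ rep_dense sigma_tau_dense.
  move=> [m [a xi]] [n [b eta]] /= [Mm Ma] [Mn Mb].
  rewrite (tau_dot sigmaP); [|exact: Madj|exact: Madj]; rewrite adjK.
  have := @sigma_tau_dot (bid _) m a n b xi eta; rewrite comp1r => ->//.
  - by rewrite (ucp1 pu) bidE.
  - by case: osE.
  - exact: E'1.
have uK x : v (u x) = x by rewrite -bcompE vu.
have vK z : u (v z) = z by rewrite -bcompE uv.
have uP s : os_set S s -> u *o rep_map X s = rep_map Z s *o u.
  move=> Ss; apply: (dense_bop_eq rep_dense) => _ [[m [a xi]] /= [Mm Ma] <-].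
  (* Tested against the dense vectors, both sides equal <p(s) p(m^* a) xi, p(n^* b) eta>. *)
  rewrite !bcompE; apply: (dense_dot_eq sigma_tau_dense) => _ [[n [b eta]] /= [Mn Mb] <-].
  rewrite (ux (m, (a, xi)))// -(ux (n, (b, eta)))// udot (ux (n, (b, eta)))//=.
  rewrite (tau_rep sigmaP) ?adjK//; [|exact: Madj|exact: Madj].
  rewrite sigma_tau_dot//.
  - by rewrite closure_extensionE.
  - by apply: subset_closure; exists s.
  - case: (md_MP D) => _ _ _; apply=> //; by exists s.
have vP s : os_set S s -> v *o rep_map Z s = rep_map X s *o v.
  move=> Ss; rewrite -[LHS]comp1r -uv -(compA v) (compA (rep_map Z s)) -uP//.
  by rewrite -(compA u) (compA v) vu comp1l.
by exists (Intertwiner uP), (Intertwiner vP); split=> // m a xi Mm Ma; exact: (ux (m, (a, xi))).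
Qed.

End OneRepresentation.

Lemma induced_composition (F : functor (Hmod I) (Hmod J)) (G : functor (Hmod J) (Hmod I)) :
  induced_by_TRO D F -> induced_by_adjoint D G ->
  naturally_equivalent (functor_comp G F) (functor_id (Hmod I)).
Proof.
move=> [tau [tauP tauF]] [sigma [sigmaP sigmaG]].
pose w (X : crep I) := sigma_tau_unitary (tauP X) (sigmaP (F X)).
pose u (X : crep I) := projT1 (cid (w X)).
pose v (X : crep I) := projT1 (cid (projT2 (cid (w X)))).
have uvP (X : crep I) := projT2 (cid (projT2 (cid (w X)))).
exists v, u; split=> [X|X Y h].
  by have [vu uv _] := uvP X; split; apply: intertwiner_inj => x; [exact: uv|exact: vu].
have [vuX uvX uX] := uvP X; have [vuY uvY uY] := uvP Y.
(* Naturality is checked for u, whose values on a dense set are explicit, and is then transferred to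
   its inverse v. *)
have nat : ival (u Y) *o ival (h : intertwiner X Y) =
    ival (fmor G (fmor F h) : intertwiner (G (F X)) (G (F Y))) *o ival (u X).
  apply: (dense_bop_eq (rep_dense X)) => _ [[m [a xi]] /= [Mm Ma] <-].
  rewrite !bcompE uX//.
  have Ema : E (adj m *o a) by apply: AE; exact: lprod_A.
  have /(congr1 (fun T => bval T xi)) := intertwiner_closure fP h Ema.
  rewrite !bcompE => ->; rewrite uY// sigmaG; last by exists m.
  by rewrite tauF.
apply: intertwiner_inj => z.
have /(congr1 (fun T => bval T (v X z))) := nat; rewrite !bcompE uvX => nz.
rewrite -[LHS]/(v Y ((fmor G (fmor F h) : intertwiner (G (F X)) (G (F Y))) z)).
by rewrite -nz vuY.
Qed.

End Composition.

(** * Exchanging S and T *)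

Section Flip.
Variables (R : realType) (S T : opsys R).
Variables (I : injective_envelope S) (J : injective_envelope T).

Section AdjointTRO.
Variables (H K : hilbertType R) (M : set (bop H K)).

Lemma adj_image_inv : [set adj m | m in [set adj m | m in M]] = M.
Proof.
apply/seteqP; split=> [_ [_ [m Mm <-] <-]|m Mm]; first by rewrite adjK.
by exists (adj m); [exists m|rewrite adjK].
Qed.

Lemma lprod_adj_image : lprod [set adj m | m in M] = rprod M.
Proof.
congr clspan; apply/seteqP; split=> [_ [_ [a Ma <-] [_ [b Mb <-] <-]]|_ [a Ma [b Mb <-]]].
  by exists a => //; exists b => //; rewrite adjK.
by exists (adj a); [exists a|exists (adj b); [exists b|rewrite adjK]].
Qed.

Lemma rprod_adj_image : rprod [set adj m | m in M] = lprod M.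
Proof.
congr clspan; apply/seteqP; split=> [_ [_ [a Ma <-] [_ [b Mb <-] <-]]|_ [a Ma [b Mb <-]]].
  by exists a => //; exists b => //; rewrite adjK.
by exists (adj a); [exists a|exists (adj b); [exists b|rewrite adjK]].
Qed.

Lemma TRO_equivalent_via_adj (E : set (bop H H)) (E' : set (bop K K)) :
  TRO_equivalent_via E E' M -> TRO_equivalent_via E' E [set adj m | m in M].
Proof.
move=> [[sM MM] [lM rM] M1 M2]; split.
- split; first split; first by exists 0; [case: sM|exact: adj0].
    move=> a _ _ [x Mx <-] [y My <-]; exists (conjc a *: x + y).
      by case: sM => _; apply.
    by rewrite adjD adjZ conjcK.
  move=> _ _ _ [a Ma <-] [b Mb <-] [c Mc <-]; exists (c *o adj b *o a).
    exact: MM.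
  by rewrite !adj_comp adjK compA.
- by split; rewrite ?lprod_adj_image ?rprod_adj_image.
- by move=> _ s _ [a Ma <-] Es [b Mb <-]; rewrite adjK; exact: M2.
by move=> _ t _ [a Ma <-] Et [b Mb <-]; rewrite adjK; exact: M1.
Qed.

End AdjointTRO.

Definition md_flip (D : morita_data I J) : morita_data J I := @MoritaData R T S J I
  (md_K D) (md_H D) (md_T D) (md_S D) [set adj m | m in md_M D]
  (md_TP D) (md_SP D) (md_T_env D) (md_S_env D) (TRO_equivalent_via_adj (md_MP D))
  (etrans (md_rprod D) (esym (lprod_adj_image (md_M D))))
  (etrans (md_lprod D) (esym (rprod_adj_image (md_M D)))).

Lemma induced_by_adjoint_flip (D : morita_data I J) (F : functor (Hmod I) (Hmod J)) :
  induced_by_adjoint (md_flip D) F <-> induced_by_TRO D F.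
Proof. by rewrite /induced_by_adjoint /induced_by_TRO /= adj_image_inv. Qed.

End Flip.

Theorem theorem4p3 (R : realType) (S T : opsys R)
    (I : injective_envelope S) (J : injective_envelope T)
    (hST : Delta_equivalent S T) (D : morita_data I J) :
  (exists F : functor (Hmod I) (Hmod J), induced_by_TRO D F) /\
  (exists G : functor (Hmod J) (Hmod I), induced_by_adjoint D G) /\
  (forall (F : functor (Hmod I) (Hmod J)) (G : functor (Hmod J) (Hmod I)),
     induced_by_TRO D F -> induced_by_adjoint D G ->
     completely_contractive F /\ completely_contractive G /\
     naturally_equivalent (functor_comp G F) (functor_id (Hmod I)) /\
     naturally_equivalent (functor_comp F G) (functor_id (Hmod J))) /\
  completely_contractively_equivalent I J.
Proof.
have [F0 [_ [_ [F0D _]]]] := md_exists_functor D.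
have [G0 [_ [_ [G0D _]]]] := md_exists_functor (md_flip D).
have FG (F : functor (Hmod I) (Hmod J)) (G : functor (Hmod J) (Hmod I)) :
    induced_by_TRO D F -> induced_by_adjoint D G ->
    completely_contractive F /\ completely_contractive G /\
    naturally_equivalent (functor_comp G F) (functor_id (Hmod I)) /\
    naturally_equivalent (functor_comp F G) (functor_id (Hmod J)).
  move=> FD GD; split; first exact: induced_contractive FD.
  split; first exact: (@induced_contractive _ _ _ _ _ (md_flip D)).
  split; first exact: induced_composition FD GD.
  apply: (@induced_composition _ _ _ _ _ (md_flip D)) => //.
  exact/induced_by_adjoint_flip.
split; first by exists F0.
split; first by exists G0.
split=> //; have [cF [cG [GF FG0]]] := FG F0 G0 F0D G0D.
by exists F0, G0.
Qed.
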